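(* Let $F$ and $f=F'$ satisfy Assumption A, let $(u)_{\varepsilon}$ be the family of solutions of the Cahn–Hilliard problem, and suppose that Assumption B holds with exponents $\rho_1,\rho_2,\rho_3>0$ (Assumptions A and B are stated in the context). Let $\varepsilon_0\in(0,1)$ be as in the spectral estimate stated in the context. Define $$\alpha_0:=\max\{\rho_1+3,\ 2\rho_2+4,\ \rho_2+6,\ \rho_3+4\},\qquad \beta_0:=\frac{4\alpha_0+32+4d}{4-d}.$$ Then there exist constants $\tilde C>0$ and $\kappa_0>0$, independent of $\tau$ and $\varepsilon$, such that for every $\varepsilon\in(0,\varepsilon_0)$ and every time step $\tau=T/(N+1)$ ($N$ a positive integer) with $$\tau\le \tilde C\,\varepsilon^{\beta_0},$$ the solution $(u^n,r^n)$ of the semi-discrete SAV scheme satisfies, with $e^n:=u(t_n)-u^n$, for every $m=1,\dots,N+1$, $$\max_{1\le n\le m}\|e^n\|_{-1}^2+\frac12\sum_{n=1}^m\|e^n-e^{n-1}\|_{-1}^2+\frac12\varepsilon^4\sum_{n=1}^m\tau\|\nabla e^n\|^2+\max_{1\le n\le m}\tau\varepsilon^4\|\nabla e^n\|^2+\frac12\varepsilon^4\sum_{n=1}^m\tau\|\nabla e^n-\nabla e^{n-1}\|^2\le \kappa_0\,\varepsilon^{-\alpha_0}\tau^2 .$$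
   Context: Setting. $\Omega\subset\mathbb{R}^d$, $d\in\{2,3\}$, is a bounded domain (regular enough for the usual Sobolev and Poincaré inequalities), ${\bm n}$ its outward normal, $T>0$ fixed, $\varepsilon>0$ a small parameter. $\|\cdot\|$ and $(\cdot,\cdot)$ are the $L^2(\Omega)$ norm and inner product. $L_0^2(\Omega)$ is the space of $v\in L^2(\Omega)$ with $\int_\Omega v\,dx=0$. For $v\in L^2_0(\Omega)$, $-\Delta^{-1}v:=v_1\in H^1(\Omega)\cap L_0^2(\Omega)$ is the solution of $-\Delta v_1=v$ in $\Omega$, $\partial_{\bm n}v_1=0$ on $\partial\Omega$, and $\|v\|_{-1}:=\sqrt{(v,-\Delta^{-1}v)}=\|\nabla v_1\|$. ''$a\lesssim b$'' means $a\le Cb$ with $C>0$ independent of $\tau$ and $\varepsilon$. Cahn–Hilliard problem. For each $\varepsilon$, $u$ (depending on $\varepsilon$) solves $\partial_t u=\Delta\big(-\varepsilon\Delta u+\frac1\varepsilon f(u)\big)$ in $\Omega$ for $t>0$, with $\partial_{\bm n}u=\partial_{\bm n}\big(-\varepsilon\Delta u+\frac1\varepsilon f(u)\big)=0$ on $\partial\Omega$ and $u(\cdot,0)=u_0$ (the initial datum may depend on $\varepsilon$); errors are measured on $[0,T]$. Assumption A (on the potential, which does not depend on $\varepsilon$). (i) $F\in C^4(\mathbb{R})$, $F(\pm1)=0$, and $F>0$ elsewhere. (ii) $f=F'$ satisfies $f(\pm1)=0$, $f'(\pm1)>0$, and there is a constant $L\ge0$ with $\max_{v\in\mathbb{R}}|f(v)|\le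 L$, $\max_{v\in\mathbb{R}}|f'(v)|\le L$, $\max_{v\in\mathbb{R}}|f''(v)|\le L$. Assumption B (on the solution). There are positive $\varepsilon$-independent constants $m_0$ and $\rho_1,\rho_2,\rho_3$ such that $\frac{1}{|\Omega|}\int_\Omega u\,dx=m_0\in(-1,1)$; $\operatorname{ess\,sup}_{t\in[0,\infty]}\big\{\frac\varepsilon2\|\nabla u\|^2+\frac1\varepsilon\int_\Omega F(u)\,dx\big\}+\int_0^\infty\|u_t\|_{-1}^2\,ds\lesssim\varepsilon^{-\rho_1}$; $\int_0^\infty\|u_t\|^2\,ds\lesssim\varepsilon^{-\rho_2}$; $\int_0^\infty\|\Delta^{-1}u_{tt}\|_{-1}^2\,dt\lesssim\varepsilon^{-\rho_3}$. Spectral estimate (quoted from the literature in the paper as a known fact about the linearized Cahn–Hilliard operator; it fixes the range of $\varepsilon$). There exist $0<\varepsilon_0\ll1$ and a constant $\lambda_0>0$ (independent of $\varepsilon$) such that for all $\varepsilon\in(0,\varepsilon_0)$ and all $t\in[0,T]$, and all $v\in H^1(\Omega)\cap L_0^2(\Omega)$, $$\varepsilon\|\nabla v\|^2+\frac1\varepsilon\big(f'(u(\cdot,t))v,v\big)\ge-\lambda_0\|v\|_{-1}^2 ,$$ where $u$ is the solution of the Cahn–Hilliard problem. SAV scheme. Fix a constant $c_0>0$ independent of $\varepsilon$ and put $g(v)=f(v)\big/\sqrt{\int_\Omega F(v)\,dx+c_0}$. Let $t_n=n\tau$, $n=0,\dots,N+1$, $\tau=T/(N+1)$. Set $u^0=u_0$,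 $r^0=\sqrt{\int_\Omega F(u_0)\,dx+c_0}$, and for $n=0,1,\dots,N$ let $(u^{n+1},w^{n+1},r^{n+1})$ (with $r^{n+1}\in\mathbb{R}$) solve $$\frac{u^{n+1}-u^n}{\tau}=\Delta w^{n+1},\quad w^{n+1}=-\varepsilon\Delta u^{n+1}+\frac1\varepsilon r^{n+1}g(u^n),\quad r^{n+1}-r^n=\frac12\big(g(u^n),u^{n+1}-u^n\big),$$ with $\partial_{\bm n}u^{n+1}=\partial_{\bm n}w^{n+1}=0$ on $\partial\Omega$. (The functions $e^n$ have zero mean, and $e^0=0$.) *)

(* Defs.v *)
From HB Require Import structures.
From mathcomp Require Import all_boot all_order all_algebra.
From mathcomp Require Import all_classical all_reals all_analysis ess_sup_inf.

Set Implicit Arguments.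
Unset Strict Implicit.
Unset Printing Implicit Defensive.
Import Order.TTheory GRing.Theory Num.Theory.
Import numFieldNormedType.Exports.

Local Open Scope classical_set_scope.
Local Open Scope ring_scope.

(** * Lebesgue measure on R^n *)

Definition rV_display : measure_display -> measure_display.
Proof. exact. Qed.

Definition rV_coord (R : realType) n (i : 'I_n) (x : 'rV[R]_n) : R := x ord0 i.

Section rV_measurable.
Variables (R : realType) (n : nat).

Let rV_set0 : g_sigma_preimage (@rV_coord R n) set0.
Proof. exact: sigma_algebra0. Qed.

Let rV_setC A : g_sigma_preimage (@rV_coord R n) A ->
  g_sigma_preimage (@rV_coord R n) (~` A).
Proof. exact: sigma_algebraC. Qed.

Let rV_bigcup (F : (set 'rV[R]_n)^nat) :
  (forall i, g_sigma_preimage (@rV_coord R n) (F i)) ->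
  g_sigma_preimage (@rV_coord R n) (\bigcup_i F i).
Proof. exact: sigma_algebra_bigcup. Qed.

(* The product sigma-algebra, i.e. the Borel sets of R^n. *)
HB.instance Definition _ := @isMeasurable.Build
  (rV_display default_measure_display) 'rV[R]_n
  (g_sigma_preimage (@rV_coord R n)) rV_set0 rV_setC rV_bigcup.

End rV_measurable.

Lemma measurable_rV_coord (R : realType) n (i : 'I_n) :
  measurable_fun [set: 'rV[R]_n] (@rV_coord R n i).
Proof.
move=> _ Y mY; rewrite setTI; apply: sub_sigma_algebra => /=.
rewrite -bigcup_seq/=; exists i => /=; first by rewrite mem_index_enum.
by exists Y => //; rewrite setTI.
Qed.

Lemma measurable_fun_rV d (T : measurableType d) (R : realType) n
    (f : T -> 'rV[R]_n) :
  (forall i, measurable_fun [set: T] (@rV_coord R n i \o f)) ->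
  measurable_fun [set: T] f.
Proof.
move=> mf; suff : g_sigma_preimage (fun i => @rV_coord R n i \o f) `<=`
    measurable.
  rewrite g_sigma_preimage_comp => h _ A mA; apply: h; exists A => //.
apply: smallest_sub; first exact: sigma_algebra_measurable.
case: n => [|n] in f mf *; first by rewrite big_ord0.
rewrite -bigcup_mkord_ord; apply: bigcup_sub => i Ii.
by move=> A [B mB <-]; exact: mf.
Qed.

Definition rV_cons (R : realType) n (p : 'rV[R]_n * measurableTypeR R) :
    'rV[R]_n.+1 :=
  \row_(i < n.+1) oapp (fun j => p.1 ord0 j) p.2 (unlift ord0 i).

Lemma measurable_rV_cons (R : realType) n : measurable_fun setT (@rV_cons R n).
Proof.
apply: measurable_fun_rV => i; rewrite /comp /rV_coord.
case: (unliftP ord0 i) => [j|] ->.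
  rewrite (_ : (fun _ => _) = @rV_coord R n j \o fst).
    by apply: measurableT_comp => //; exact: measurable_rV_coord.
  by apply/funext => p /=; rewrite mxE liftK.
rewrite (_ : (fun _ => _) = snd); first exact: measurable_snd.
by apply/funext => p /=; rewrite mxE unlift_none.
Qed.

Fixpoint lebesgue_rV (R : realType) n : {measure set 'rV[R]_n -> \bar R} :=
  match n with
  | 0 => dirac (0 : 'rV[R]_0)
  | m.+1 =>
      (* pushforward (lebesgue_rV R m \x lebesgue_measure) rV_cons *)
      measure_function_pushforward__canonical__measure_function_Measure
        (lebesgue_rV R m \x @lebesgue_measure R)%E (@measurable_rV_cons R m)
  end.

Lemma measurable_rV_box (R : realType) n (A : 'I_n -> set R) :
  (forall i, measurable (A i)) ->
  measurable [set x : 'rV[R]_n | forall i, A i (x ord0 i)].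
Proof.
move=> mA.
rewrite (_ : mkset _ =
    \big[setI/setT]_(i < n) (@rV_coord R n i @^-1` A i)).
  apply: bigsetI_measurable => i _.
  by rewrite -[X in measurable X]setTI; exact: measurable_rV_coord.
apply/seteqP; split => x.
  by move=> Ax; rewrite -bigcap_seq => i _; exact: Ax.
by rewrite -bigcap_seq => Ax i; apply: Ax; rewrite /= mem_index_enum.
Qed.

Lemma lebesgue_rV_box (R : realType) n (A : 'I_n -> set R) :
  (forall i, measurable (A i)) ->
  lebesgue_rV R n [set x | forall i, A i (x ord0 i)] =
  (\prod_(i < n) @lebesgue_measure R (A i))%E.
Proof.
elim: n A => [|n IH] A mA.
  rewrite big_ord0 /= diracE; apply/eqP; rewrite eqe pnatr_eq1 eqb1.
  by rewrite inE => -[].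
rewrite big_ord_recl /= /pushforward.
rewrite (_ : _ @^-1` _ =
    [set x : 'rV[R]_n | forall i, A (lift ord0 i) (x ord0 i)] `*` A ord0).
  have mt : measurable
      [set x : 'rV[R]_n | forall i, A (lift ord0 i) (x ord0 i)].
    exact: (@measurable_rV_box R n (fun i => A (lift ord0 i))).
  rewrite product_measure1E//; last exact: mA.
  by rewrite (IH (fun i => A (lift ord0 i)))// muleC.
apply/seteqP; split => -[x a] /=.
  move=> h; split => [i|].
    by have := h (lift ord0 i); rewrite mxE liftK.
  by have := h ord0; rewrite mxE unlift_none.
move=> [hx ha] i; rewrite mxE.
by case: (unliftP ord0 i) => [j|] ->.
Qed.

(** * L^2, H^1 and H^{-1} on an open set Omega of R^d *)

Section Sobolev.
Variables (R : realType) (d : nat).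
Notation E := ('rV[R]_d).
Notation mu := (lebesgue_rV R d).
Variable Omega : set E.
Implicit Types (v w z phi : E -> R) (G : 'I_d -> E -> R).

Definition L2 v : Prop := (v \_ Omega : E -> R) \in Lfun mu 2%:E.

Definition inner v w : R := \int[mu]_(x in Omega) (v x * w x).

Definition L2norm v : R := Num.sqrt (inner v v).

Definition L20 v : Prop := L2 v /\ \int[mu]_(x in Omega) v x = 0.

Definition vinner G H : R := \sum_(i < d) inner (G i) (H i).

Definition vL2norm G : R := Num.sqrt (vinner G G).

Definition partial (i : 'I_d) (phi : E -> R) : E -> R :=
  fun x => 'D_(delta_mx 0 i) phi x.

Definition smooth phi : Prop := forall s : seq 'I_d,
  let psi := foldr partial phi s in
  continuous psi /\ forall (i : 'I_d) (x : E), derivable psi x (delta_mx 0 i).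

(* C_c^infty(Omega) *)
Definition test_function phi : Prop :=
  let supp := closure [set x | phi x != 0] in
  [/\ smooth phi, compact supp & supp `<=` Omega].

Definition is_weak_gradient v G : Prop := forall i, L2 (G i) /\
  forall phi, test_function phi -> inner v (partial i phi) = - inner (G i) phi.

Definition H1 v : Prop := L2 v /\ exists G, is_weak_gradient v G.

(* The weak gradient, defined up to a.e. equality; meaningful when H1 v. *)
Definition grad v : 'I_d -> E -> R :=
  xget (fun _ _ => 0) [set G | is_weak_gradient v G].

Definition H1norm v : R := Num.sqrt (L2norm v ^+ 2 + vL2norm (grad v) ^+ 2).

(* Delta v = z in Omega and d_n v = 0 on the boundary, in the variational sense
   (no regularity of the boundary is needed to make sense of it). *)
Definition neumann_laplacian v z : Prop := [/\ H1 v, L2 z &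
  forall phi, H1 phi -> vinner (grad v) (grad phi) = - inner z phi].

Definition is_neg_inv_lap v z : Prop :=
  [/\ H1 z, L20 z & neumann_laplacian z (fun x => - v x)].

(* - Delta^{-1} v, defined up to a.e. equality; meaningful when L20 v. *)
Definition neg_inv_lap v : E -> R := xget (fun=> 0) [set z | is_neg_inv_lap v z].

Definition inv_lap v : E -> R := fun x => - neg_inv_lap v x.

Definition normm1 v : R := Num.sqrt (inner v (neg_inv_lap v)).

Definition bounded_domain : Prop :=
  [/\ open Omega, connected Omega, Omega !=set0 & bounded_set Omega].

(* Omega is a bounded domain on which the Poincare inequality and the Sobolev
   inequalities hold, the latter in the Gagliardo-Nirenberg form
   |v|_{L^p} <= C |v|_{L^2}^(1 - theta) |v|_{H^1}^theta,
   theta = d (1/2 - 1/p), for all 2 <= p < oo with (d - 2) p <= 2 d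
   (theta = 1 is the critical embedding H^1 -> L^{2d/(d-2)}). *)
Definition regular_domain : Prop :=
  [/\ bounded_domain,
      exists C : R, forall v, H1 v -> L20 v ->
        L2norm v <= C * vL2norm (grad v) &
      forall p : R, 2 <= p -> (d%:R - 2) * p <= 2 * d%:R ->
        let theta := d%:R * (2^-1 - p^-1) in
        exists C : R, forall v, H1 v ->
          ('N[mu]_(p%:E)[EFin \o (v \_ Omega)] <=
           (C * (L2norm v `^ (1 - theta) * H1norm v `^ theta))%:E)%E].

(** * Functions of time with values in L^2(Omega) *)

(* [vt] is the time derivative of [v] on the interval [I]:
   v(t) - v(s) = \int_s^t vt(r) dr in L^2(Omega) for s <= t in I, the integral
   being tested against arbitrary elements of L^2(Omega). *)
Definition time_derivative (I : set R) (v vt : R -> E -> R) : Prop :=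
  forall phi, L2 phi -> forall s t, I s -> I t -> s <= t ->
    lebesgue_measure.-integrable `[s, t] (fun r => (inner (vt r) phi)%:E) /\
    inner (v t) phi - inner (v s) phi =
      \int[lebesgue_measure]_(r in `[s, t]) inner (vt r) phi.

(** * The Cahn-Hilliard problem and its SAV discretisation *)

(* w = - eps Delta v + s / eps in Omega, with d_n v = 0 on the boundary. *)
Definition chemical_potential (eps : R) v (s w : E -> R) : Prop :=
  exists2 z, neumann_laplacian v z &
    w = (fun x => - eps * z x + eps^-1 * s x) %[ae mu in Omega].

Definition cahn_hilliard (F : R -> R) (eps : R) (u0 : E -> R)
    (u ut : R -> E -> R) : Prop :=
  [/\ forall t : R, 0 <= t -> L2 (u t),
      u 0 = u0 %[ae mu in Omega],
      time_derivative `[0, +oo[ u ut &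
      forall t : R, 0 < t -> exists2 w,
        neumann_laplacian w (ut t) &
        chemical_potential eps (u t) (fun x => derive1 F (u t x)) w].

Definition energy (F : R -> R) (eps : R) v : R :=
  eps / 2 * vL2norm (grad v) ^+ 2 +
  eps^-1 * \int[mu]_(x in Omega) F (v x).

Definition sav_g (F : R -> R) (c0 : R) v : E -> R := fun x =>
  derive1 F (v x) / Num.sqrt (\int[mu]_(y in Omega) F (v y) + c0).

(* The SAV scheme with time step tau: (U n, W n, r n) for n = 0, ..., N + 1
   (W 0 is irrelevant). *)
Definition sav_scheme (F : R -> R) (c0 eps tau : R) (N : nat) (u0 : E -> R)
    (U W : nat -> E -> R) (r : nat -> R) : Prop :=
  [/\ U 0%N = u0 %[ae mu in Omega],
      r 0%N = Num.sqrt (\int[mu]_(x in Omega) F (u0 x) + c0) &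
      forall n, (n <= N)%N ->
      [/\ neumann_laplacian (W n.+1) (fun x => (U n.+1 x - U n x) / tau),
          chemical_potential eps (U n.+1)
            (fun x => r n.+1 * sav_g F c0 (U n) x) (W n.+1) &
          r n.+1 - r n =
            2^-1 * inner (sav_g F c0 (U n)) (fun x => U n.+1 x - U n x)]].

(** * The standing assumptions *)

Definition assumptionA (F : R -> R) : Prop :=
  let f := derive1 F in
  [/\ (forall (k : nat) (x : R), (k < 4)%N -> derivable (derive1n k F) x 1) /\
        continuous (derive1n 4 F),
      F 1 = 0 /\ F (-1) = 0,
      forall x : R, x != 1 -> x != -1 -> 0 < F x,
      [/\ f 1 = 0, f (-1) = 0, 0 < derive1 f 1 & 0 < derive1 f (-1)] &
      exists2 L : R, 0 <= L & forall x : R,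
        [/\ `|f x| <= L, `|derive1 f x| <= L & `|derive1n 2 f x| <= L]].

(* In the last bound Delta^{-1} u_tt is the time derivative, for t > 0, of
   t |-> Delta^{-1} u_t(t); u_tt itself need not be a function. *)
Definition assumptionB (F : R -> R) (eps0 : R) (u ut : R -> R -> E -> R)
    (m0 rho1 rho2 rho3 : R) : Prop :=
  let leb := @lebesgue_measure R in
  let leb_pos := mrestr leb (measurable_itv `[0, +oo[) in
  [/\ forall eps t : R, 0 < eps < eps0 -> 0 <= t ->
        (fine (mu Omega))^-1 * \int[mu]_(x in Omega) u eps t x = m0,
      -1 < m0 < 1,
      exists2 C : R, 0 < C & forall eps : R, 0 < eps < eps0 ->
        (ess_sup leb_pos (fun t => (energy F eps (u eps t))%:E) +
         \int[leb]_(t in `[0%R, +oo[) (normm1 (ut eps t) ^+ 2)%:E <=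
         (C * eps `^ (- rho1))%:E)%E,
      exists2 C : R, 0 < C & forall eps : R, 0 < eps < eps0 ->
        (\int[leb]_(t in `[0%R, +oo[) (L2norm (ut eps t) ^+ 2)%:E <=
         (C * eps `^ (- rho2))%:E)%E &
      exists2 C : R, 0 < C & forall eps : R, 0 < eps < eps0 ->
        exists q : R -> E -> R,
          [/\ time_derivative `]0, +oo[ (fun t => inv_lap (ut eps t)) q,
              forall t : R, 0 < t -> L20 (q t) &
              (\int[leb]_(t in `]0%R, +oo[) (normm1 (q t) ^+ 2)%:E <=
               (C * eps `^ (- rho3))%:E)%E]].

Definition spectral_estimate (F : R -> R) (T eps0 lambda0 : R)
    (u : R -> R -> E -> R) : Prop :=
  forall (eps t : R) v, 0 < eps < eps0 -> 0 <= t <= T -> H1 v -> L20 v ->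
    - lambda0 * normm1 v ^+ 2 <=
    eps * vL2norm (grad v) ^+ 2 +
    eps^-1 * inner (fun x => derive1 (derive1 F) (u eps t x) * v x) v.

End Sobolev.

(* Main.v *)
(* Test the difference of the two equations with - Delta^-1 e', where
   e = u(t_n) - u^n and primes denote the next time level.  This gives
     (|e'|_{-1}^2 - |e|_{-1}^2 + |e' - e|_{-1}^2) / 2 + tau eps |grad e'|^2
       + (tau / eps) (f(u') - r' g(U), e') = tau (consistency, - Delta^-1 e').
   The consistency error is an integral of Delta^-1 u_tt.  Freezing the
   nonlinearity at the old level costs |U' - U|^2 <= 2 |u' - u|^2 + 2 |e' - e|^2,
   and |e' - e|^2 is absorbed by interpolating between H^{-1} and H^1;
   r^n - sqrt (int F(U^n) + c0) is bounded by sum_k |U^{k+1} - U^k|^2, so no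
   discrete energy law is needed.  Using the spectral estimate with weight
   1 - eps^3 only leaves eps^4 |grad e'|^2 on the left, and the cubic remainder
   of f is at most a fraction of it, by Gagliardo-Nirenberg, as soon as e' is
   known to be small.  A crude version of the same identity provides this
   smallness from the estimate at the previous level when tau is small, and a
   discrete Gronwall argument closes the induction. *)

Require Import Defs.
From HB Require Import structures.
From mathcomp Require Import all_boot all_order all_algebra.
From mathcomp Require Import all_classical all_reals all_analysis.
From mathcomp Require Import measurable_realfun ring lra.
Import Order.TTheory GRing.Theory Num.Theory.
Import numFieldNormedType.Exports.
Local Open Scope classical_set_scope.
Local Open Scope ring_scope.

Set Implicit Arguments.
Unset Strict Implicit.
Unset Printing Implicit Defensive.

(** * The bilinear form of L^2 *)

(** [grad] and [neg_inv_lap] are choices among the solutions of a weak formulation. Weak gradients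
    must therefore be shown unique almost everywhere, which takes enough test functions, and
    -Delta^-1 must be shown to exist, by minimizing the Dirichlet functional in the complete space
    L^2; the material on bumps, boxes and minimizing sequences serves this. In time, only the
    pairings of u_t and of q (the derivative of Delta^-1 u_t) with fixed functions are known to be
    measurable, not their norms. Each time integral is taken after testing with one normalized
    function per time step. Write A = eps^-alpha0; the squared error is kept below kappa A tau^2.
    Absorption into eps^4 |grad e'|^2 puts a factor eps^-4 on every source, whence the terms 2 rho2
    + 4 and rho3 + 4 in alpha0; rho2 is doubled because the drift of r enters squared. The step
    restriction acts through tau A^2 <= C eps^20, which yields both the smallness of e' and the
    absorption constants. *)

Lemma discriminant_le0 (R : realFieldType) (a b c : R) :
  (forall t, 0 <= a + 2 * t * b + t ^+ 2 * c) -> b ^+ 2 <= a * c.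
Proof.
move=> h.
have c0 : 0 <= c.
  rewrite leNgt; apply/negP => c0.
  have a0 : 0 <= a by move: (h 0); rewrite mulr0 mul0r expr0n/= mul0r !addr0.
  (* At this t >= 1, t * -c is at least 1 + a + 2 |b|, so t^2 c outweighs a + 2 t b. *)
  have := h ((1 + a + 2 * `|b|) / - c + 1).
  set s := _ / _.
  have s0 : 0 <= s by rewrite divr_ge0//; [have := normr_ge0 b; lra|lra].
  have sc : s * - c = 1 + a + 2 * `|b| by rewrite /s divfK//; lra.
  have bn : b <= `|b| by exact: ler_norm.
  nra.
have [c1|] := ltP 0 c; last first.
  move=> c1; have c_eq0 : c = 0 by apply/eqP; rewrite eq_le c0 c1.
  rewrite c_eq0 {c c_eq0 c0 c1} in h *.
  rewrite mulr0; have [->|b0] := eqVneq b 0; first by rewrite expr0n.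
  have := h (- (a + 1) / b / 2).
  have -> : a + 2 * (- (a + 1) / b / 2) * b + (- (a + 1) / b / 2) ^+ 2 * 0 = -1.
    by field.
  lra.
have := h (- b / c).
have -> : a + 2 * (- b / c) * b + (- b / c) ^+ 2 * c = a - b ^+ 2 / c.
  by field; rewrite gt_eqF.
by rewrite subr_ge0 ler_pdivrMr.
Qed.

Section square_integrable.
Context dd (T : measurableType dd) (R : realType).
Variables (mu : {measure set T -> \bar R}) (D : set T).
Hypothesis mD : measurable D.
Implicit Types v w z : T -> R.

(** Measurability is asked of v itself, since that of its square does not imply it. Only values on D
    matter, so sums and products need no extension by 0. *)
Definition sqint v := measurable_fun D v /\
  mu.-integrable D (EFin \o (fun x => v x ^+ 2)).

Local Notation ip v w := (\int[mu]_(x in D) (v x * w x)).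

Lemma sqint_mul v w : sqint v -> sqint w ->
  mu.-integrable D (EFin \o (fun x => v x * w x)).
Proof.
move=> [mv iv] [mw iw].
apply: (le_integrable mD _ _ (integrableD mD iv iw)).
  by apply/measurable_EFinP; exact: measurable_funM.
move=> x Dx /=; rewrite lee_fin normrM [leRHS]ger0_norm; last first.
  by rewrite addr_ge0// sqr_ge0.
rewrite -[v x ^+ 2]real_normK ?num_real// -[w x ^+ 2]real_normK ?num_real//.
have := sqr_ge0 (`|v x| - `|w x|); have := normr_ge0 (v x); have := normr_ge0 (w x).
nra.
Qed.

Lemma sqintZ k v : sqint v -> sqint (fun x => k * v x).
Proof.
move=> [mv iv]; split; first exact: measurable_funM.
apply: eq_integrable (integrableZl mD (k ^+ 2) iv) => // x xD /=.
by rewrite exprMn EFinM.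
Qed.

Lemma sqintD v w : sqint v -> sqint w -> sqint (fun x => v x + w x).
Proof.
move=> Sv Sw; have [mv iv] := Sv; have [mw iw] := Sw; split; first exact: measurable_funD.
apply: eq_integrable (integrableD mD (integrableD mD iv
  (integrableZl mD 2 (sqint_mul Sv Sw))) iw) => // x xD /=.
by rewrite -!EFinM -!EFinD; congr EFin; rewrite sqrrD mulr_natl.
Qed.

Lemma sqintN v : sqint v -> sqint (fun x => - v x).
Proof.
by move=> /(sqintZ (-1)); under eq_fun do rewrite mulN1r.
Qed.

Lemma sqintB v w : sqint v -> sqint w -> sqint (fun x => v x - w x).
Proof. by move=> Sv /sqintN; exact: sqintD. Qed.

Lemma sqint0 : sqint (fun=> 0).
Proof.
split; first exact: measurable_cst.
under eq_fun do rewrite expr0n/=; exact: integrable0.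
Qed.

Lemma ipC v w : ip v w = ip w v.
Proof. by apply: eq_Rintegral => x _; rewrite mulrC. Qed.

Lemma ipDl v w z : sqint v -> sqint w -> sqint z ->
  ip (fun x => v x + w x) z = ip v z + ip w z.
Proof.
move=> Sv Sw Sz; rewrite -RintegralD//; try exact: sqint_mul.
by apply: eq_Rintegral => x _; rewrite mulrDl.
Qed.

Lemma ipZl k v z : sqint v -> sqint z -> ip (fun x => k * v x) z = k * ip v z.
Proof.
move=> Sv Sz; rewrite -RintegralZl//; last exact: sqint_mul.
by apply: eq_Rintegral => x _; rewrite mulrA.
Qed.

Lemma ipNl v z : sqint v -> sqint z -> ip (fun x => - v x) z = - ip v z.
Proof.
move=> Sv Sz; rewrite -mulN1r -ipZl//; apply: eq_Rintegral => x _.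
by rewrite mulN1r.
Qed.

Lemma ipBl v w z : sqint v -> sqint w -> sqint z ->
  ip (fun x => v x - w x) z = ip v z - ip w z.
Proof.
by move=> Sv Sw Sz; rewrite ipDl ?ipNl//; exact: sqintN.
Qed.

Lemma ipDr v w z : sqint v -> sqint w -> sqint z ->
  ip z (fun x => v x + w x) = ip z v + ip z w.
Proof. by move=> *; rewrite ipC ipDl// (ipC v) (ipC w). Qed.

Lemma ipZr k v z : sqint v -> sqint z -> ip z (fun x => k * v x) = k * ip z v.
Proof. by move=> *; rewrite ipC ipZl// (ipC v). Qed.

Lemma ipBr v w z : sqint v -> sqint w -> sqint z ->
  ip z (fun x => v x - w x) = ip z v - ip z w.
Proof. by move=> *; rewrite ipC ipBl// (ipC v) (ipC w). Qed.

Lemma ip_ge0 v : 0 <= ip v v.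
Proof. by apply: Rintegral_ge0 => x _; rewrite -expr2 sqr_ge0. Qed.

Lemma cauchy_schwarz v w : sqint v -> sqint w -> ip v w ^+ 2 <= ip v v * ip w w.
Proof.
move=> Sv Sw; apply: discriminant_le0 => t.
have Sw' := sqintZ t Sw.
have := ip_ge0 (fun x => v x + t * w x).
have Svw := sqintD Sv Sw'.
by rewrite ipDl// !ipDr// !ipZl// !ipZr// (ipC w v); lra.
Qed.

Lemma ip_ae v v' w : sqint v -> sqint v' -> sqint w ->
  v = v' %[ae mu in D] -> ip v w = ip v' w.
Proof.
move=> Sv Sv' Sw vv'; congr fine; apply: ae_eq_integral => //.
- by have /integrableP[] := sqint_mul Sv Sw.
- by have /integrableP[] := sqint_mul Sv' Sw.
by apply: filterS vv' => x vv' Dx; rewrite vv'.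
Qed.

End square_integrable.

(** * Completeness of L^2 *)

(** Cauchy-Schwarz for the telescoping sum of (2^-i)^(1/2) times (2^i)^(1/2) (a i.+1 - a i): the
    first factor on the right is the sum of 2^-i over n <= i < n + k. *)
Lemma weighted_tail (R : realFieldType) (a : nat -> R) n k :
  (a (n + k)%N - a n) ^+ 2 <= (2 * 2^-1 ^+ n - 2 * 2^-1 ^+ (n + k)) *
    (\sum_(n <= i < n + k) 2 ^+ i * (a i.+1 - a i) ^+ 2).
Proof.
elim: k => [|k IH]; first by rewrite addn0 !subrr expr0n/= mul0r.
rewrite addnS big_nat_recr/= ?leq_addr//.
set X := \sum_(_ <= i < _) _ in IH *; set p := (n + k)%N in IH *.
have -> : a p.+1 - a n = (a p - a n) + (a p.+1 - a p) by ring.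
set A := a p - a n in IH *; set b := a p.+1 - a p.
set b2 : R := 2^-1 ^+ p in IH *.
have b20 : 0 < b2 by rewrite exprn_gt0// invr_gt0.
rewrite (exprS _ p) -/b2; set al := 2 * _ - _ in IH *.
have al0 : 0 <= al.
  rewrite /al subr_ge0 ler_pM2l// /b2 /p exprD ler_piMr ?exprn_ge0 ?invr_ge0//.
  by rewrite exprn_ile1 ?invr_ge0// invf_le1// ler1n.
have X0 : 0 <= X by apply: sumr_ge0 => i _; rewrite mulr_ge0 ?sqr_ge0 ?exprn_ge0.
have -> : 2 * 2^-1 ^+ n - 2 * (2^-1 * b2) = al + b2 by rewrite /al; field.
set Y := 2 ^+ p * _.
have bY : b ^+ 2 = b2 * Y by rewrite /Y mulrA /b2 exprVn mulVf ?mul1r// expf_neq0.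
have Y0 : 0 <= Y by rewrite mulr_ge0 ?sqr_ge0 ?exprn_ge0.
clearbody Y al X.
(* The arithmetic-geometric mean inequality, from A^2 <= al X and b^2 = b2 Y. *)
have : 2 * A * b <= b2 * X + al * Y.
  have := ler_norm (2 * A * b); move/le_trans; apply.
  have b20' := ltW b20.
  have rhs0 : 0 <= b2 * X + al * Y by rewrite addr_ge0 ?mulr_ge0.
  rewrite -ler_sqr ?nnegrE//.
  rewrite real_normK ?num_real// !exprMn.
  apply: (@le_trans _ _ (4 * (al * X) * (b2 * Y))).
    rewrite bY ler_wpM2r ?mulr_ge0//.
    by move: IH; lra.
  have := sqr_ge0 (b2 * X - al * Y); lra.
by rewrite sqrrD bY; lra.
Qed.

Lemma weighted_cvg (R : realType) (a : nat -> R) w :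
  (forall m, \sum_(0 <= i < m) 2 ^+ i * (a i.+1 - a i) ^+ 2 <= w) ->
  cvgn a /\ forall n, (limn a - a n) ^+ 2 <= 2 * 2^-1 ^+ n * w.
Proof.
move=> aw.
have w0 : 0 <= w by have := aw 0%N; rewrite big_geq.
have bnd n m : (n <= m)%N -> (a m - a n) ^+ 2 <= 2 * 2^-1 ^+ n * w.
  move=> /subnKC <-; apply: (le_trans (weighted_tail _ _ _)).
  have s0 j : 0 <= 2 ^+ j * (a j.+1 - a j) ^+ 2.
    by rewrite mulr_ge0 ?sqr_ge0 ?exprn_ge0.
  apply: ler_pM.
  - rewrite subr_ge0 ler_pM2l// exprD ler_piMr ?exprn_ge0 ?invr_ge0//.
    by rewrite exprn_ile1 ?invr_ge0// invf_le1// ler1n.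
  - by apply: sumr_ge0.
  - by rewrite lerBlDr lerDl mulr_ge0// exprn_ge0// invr_ge0.
  - apply: le_trans (aw (n + (m - n))%N).
    rewrite [leRHS](@big_cat_nat _ _ _ n)//= ?leq_addr//.
    by rewrite lerDr sumr_ge0.
have ca : cvgn a.
  apply/cauchy_cvgP/cauchy_exP => e e0.
  have /cvgrPdist_lt/(_ (e ^+ 2 / (2 * w + 1))) : (GRing.exp (2^-1) : R^nat) @ \oo --> (0 : R).
    by apply: cvg_expr; rewrite ger0_norm ?invr_ge0// invf_lt1// ltr1n.
  have w1 : 0 < 2 * w + 1 by rewrite ltr_wpDl// mulr_ge0.
  case; first by rewrite divr_gt0// exprn_gt0.
  move=> N _ /(_ N (leqnn _)); rewrite sub0r normrN ger0_norm ?exprn_ge0 ?invr_ge0//.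
  rewrite ltr_pdivlMr// => hN.
  exists (a N); exists N => // m /= Nm.
  have e0' := ltW e0.
  rewrite /ball/= -(@ltr_pXn2r _ 2)// ?nnegrE// real_normK ?num_real//.
  rewrite -sqrrN opprB; apply: le_lt_trans (bnd _ _ Nm) _.
  apply: le_lt_trans hN; have : (0 : R) <= 2^-1 ^+ N by rewrite exprn_ge0// invr_ge0.
  by lra.
split => // n.
have : (fun m => (a m - a n) ^+ 2) @ \oo --> (limn a - a n) ^+ 2.
  by rewrite expr2; under eq_fun do rewrite expr2; apply: cvgM; apply: cvgB => //; exact: cvg_cst.
move=> h; rewrite -(cvg_lim _ h)//; apply: limr_le; first by apply/cvg_ex; exists ((limn a - a n) ^+ 2).
by exists n => // m /= nm; exact: bnd.
Qed.

Section L2_complete.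
Context dd (T : measurableType dd) (R : realType).
Variables (mu : {measure set T -> \bar R}) (D : set T).
Hypothesis mD : measurable D.

(** Riesz-Fischer for a rapidly Cauchy sequence. The sum [W] of 2^k (f k.+1 - f k)^2 has integral at
    most the sum of 2^k 4^-k, which is 2, so it is finite almost everywhere. There [weighted_cvg]
    gives a pointwise limit with |g - f n|^2 <= 2 2^-n W, and integration gives the rate. *)
Lemma sqint_complete (f : nat -> T -> R) : (forall n, sqint mu D (f n)) ->
  (forall n, \int[mu]_(x in D) ((f n.+1 x - f n x) * (f n.+1 x - f n x)) <= 2^-1 ^+ n * 2^-1 ^+ n) ->
  exists2 g, sqint mu D g &
    forall n, \int[mu]_(x in D) ((g x - f n x) * (g x - f n x)) <= 4 * 2^-1 ^+ n.
Proof.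
move=> Sf fC.
pose h k x : \bar R := (2 ^+ k * (f k.+1 x - f k x) ^+ 2)%:E.
pose W x := (\sum_(k <oo) h k x)%E.
have h0 k x : (0 <= h k x)%E by rewrite lee_fin mulr_ge0 ?sqr_ge0 ?exprn_ge0.
have mf n : measurable_fun D (f n) by have [] := Sf n.
have mh k : measurable_fun D (h k).
  by apply/measurable_EFinP; apply: measurable_funM => //; apply: measurable_funX; exact: measurable_funB.
have W0 x : (0 <= W x)%E by exact: nneseries_ge0.
have mW : measurable_fun D W by apply: ge0_emeasurable_sum.
have ih k : (\int[mu]_(x in D) h k x <= (2^-1 ^+ k)%:E)%E.
  have Sd := sqintB mD (Sf k.+1) (Sf k).
  have := fC k; rewrite -lee_fin /Rintegral.
  rewrite (_ : (\int[mu]_(x in D) _)%E = (\int[mu]_(x in D) ((f k.+1 x - f k x) ^+2)%:E)%E); last first.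
    by apply: eq_integral => x _; rewrite expr2.
  rewrite fineK; last exact: integrable_fin_num (proj2 Sd).
  move=> hk.
  under eq_integral do rewrite /h EFinM.
  rewrite (integralZl mD (proj2 Sd)).
  apply: (@le_trans _ _ ((2 ^+ k)%:E * (2^-1 ^+ k * 2^-1 ^+ k)%:E)%E).
    by rewrite lee_pmul2l// ?lte_fin ?exprn_gt0.
  by rewrite -EFinM lee_fin mulrA -exprMn divff// expr1n mul1r.
have iW : (\int[mu]_(x in D) W x <= 2%:E)%E.
  rewrite integral_nneseries//.
  have := @cvg_geometric_eseries_half R 2 0; rewrite expr0 divr1 => /cvg_lim <-//.
  apply: lee_nneseries => [k _ _|k _]; first by apply: integral_ge0.
  apply: le_trans (ih k) _.
  by rewrite lee_fin addn1 expnS natrM invfM mulrA divff// mul1r natrX exprVn.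
pose A := D `&` [set x | (W x < +oo)%E].
have mA : measurable A by exact: emeasurable_fun_infty_o.
have key x : A x -> cvgn (f ^~ x) /\ forall n, (limn (f ^~ x) - f n x) ^+ 2 <= 2 * 2^-1 ^+ n * fine (W x).
  move=> [Dx Wx]; apply: weighted_cvg => m.
  rewrite -lee_fin fineK ?ge0_fin_numE// -sumEFin.
  exact: (@nneseries_lim_ge R (h ^~ x) xpredT 0%N m (fun n _ _ => h0 n x)).
(* Cutting off outside the convergence set [A] makes the sequence converge at every point of D, so
   that its limit is measurable. *)
pose f' n x := f n x * \1_A x.
pose g x := limn (f' ^~ x).
have gE x : A x -> g x = limn (f ^~ x).
  by move=> Ax; rewrite /g /f' indicE mem_set//; under eq_fun do rewrite mulr1.
have g0 x : ~ A x -> g x = 0.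
  move=> Ax; rewrite /g /f' indicE memNset//; under eq_fun do rewrite mulr0.
  exact: lim_cst.
have mg : measurable_fun D g.
  apply: (@measurable_fun_cvg _ _ _ D f') => [m|x Dx].
    by apply: measurable_funM => //; exact: measurable_indic.
  have [Ax|nAx] := pselect (A x).
    rewrite gE// /f' indicE mem_set//; under eq_fun do rewrite mulr1.
    exact: (key x Ax).1.
  by rewrite g0// /f' indicE memNset//; under eq_fun do rewrite mulr0; exact: cvg_cst.
have bnd n : (\int[mu]_(x in D) ((g x - f n x) ^+ 2)%:E <= (4 * 2^-1 ^+ n)%:E)%E.
  apply: (@le_trans _ _ (\int[mu]_(x in D) ((2 * 2^-1 ^+ n)%:E * W x))%E).
    apply: ge0_le_integral => //=.
    - by move=> x _; rewrite lee_fin sqr_ge0.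
    - by apply/measurable_EFinP; apply: measurable_funX; exact: measurable_funB.
    - exact: measurable_funeM.
    - move=> x Dx; have [Ax|nAx] := pselect (A x).
        rewrite gE//; have [_ /(_ n)] := key x Ax; rewrite -lee_fin.
        by rewrite [X in (_ <= X)%E -> _]EFinM fineK// ge0_fin_numE//; case: Ax.
      have -> : W x = +oo%E.
        by apply/eqP; rewrite -leye_eq leNgt; apply/negP => h'; apply: nAx.
      by rewrite gt0_muley ?leey// lte_fin mulr_gt0// exprn_gt0// invr_gt0.
  rewrite ge0_integralZl_EFin//.
  apply: (@le_trans _ _ ((2 * 2^-1 ^+ n)%:E * 2%:E)%E).
    by rewrite lee_pmul2l// lte_fin mulr_gt0// exprn_gt0// invr_gt0.
  by rewrite -EFinM lee_fin; lra.
have Sgf n : sqint mu D (fun x => g x - f n x).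
  split; first exact: measurable_funB.
  apply/integrableP; split.
    by apply/measurable_EFinP; apply: measurable_funX; exact: measurable_funB.
  under eq_integral do rewrite /= ger0_norm ?sqr_ge0//.
  exact: le_lt_trans (bnd n) (ltry _).
exists g; first by have := sqintD mD (Sgf 0%N) (Sf 0%N); under eq_fun do rewrite subrK.
move=> n; rewrite -lee_fin; apply: le_trans (bnd n).
rewrite /Rintegral (_ : (\int[mu]_(x in D) _)%E = (\int[mu]_(x in D) ((g x - f n x) ^+2)%:E)%E); last first.
  by apply: eq_integral => x _; rewrite expr2.
by rewrite fineK//; exact: integrable_fin_num (proj2 (Sgf n)).
Qed.

End L2_complete.

(** * Lebesgue measure on R^n *)

Lemma bounded_support_integrable dd (T : measurableType dd) (R : realType)
  (mu : {measure set T -> \bar R}) (A : set T) (f : T -> R) C :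
  measurable A -> (mu A < +oo)%E -> measurable_fun setT f ->
  (forall x, `|f x| <= C) -> (forall x, ~ A x -> f x = 0) ->
  mu.-integrable setT (EFin \o f).
Proof.
move=> mA fA mf bf sf.
have -> : EFin \o f = (EFin \o f) \_ A.
  apply/funext => x; rewrite patchE; case: ifPn => //.
  by rewrite notin_setE /= => /sf ->.
apply/(integrable_mkcond _ mA); apply: measurable_bounded_integrable => //.
  exact: measurable_funTS.
exists C; split; first exact: num_real.
by move=> y Cy x Ax /=; apply: le_trans (bf x) (ltW Cy).
Qed.

(* Fubini's theorem wants a canonical sigma-finite measure, an instance that
   cannot be declared for the Fixpoint lebesgue_rV. *)
Definition sigma_finite_copy dd (T : measurableType dd) (R : realType)
  (mu : {measure set T -> \bar R}) of sigma_finite setT mu : set T -> \bar R := mu.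

Section sigma_finite_copy.
Context dd (T : measurableType dd) (R : realType).
Variables (mu : {measure set T -> \bar R}) (h : sigma_finite setT mu).

HB.instance Definition _ := Measure.copy (sigma_finite_copy h) mu.

HB.instance Definition _ := Measure_isSigmaFinite.Build _ _ _ (sigma_finite_copy h) h.

End sigma_finite_copy.

Section cubes.
Variable R : realType.

Definition cube n (M : R) : set 'rV[R]_n := [set x | forall i, - M < x ord0 i < M].

Definition upd n (x : 'rV[R]_n) (i : 'I_n) (t : R) : 'rV[R]_n :=
  \row_j (if j == i then t else x ord0 j).

Let cubeE n M : @cube n M = [set x | forall i, [set` `]-M, M[] (x ord0 i)].
Proof. by apply/seteqP; split => x /= h i; have := h i; rewrite in_itv. Qed.

Lemma measurable_cube n M : measurable (@cube n M).
Proof. by rewrite cubeE; exact: (@measurable_rV_box R n (fun=> [set` `]-M, M[])). Qed.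

Lemma cube_fin n M : (lebesgue_rV R n (cube M) < +oo)%E.
Proof.
rewrite cubeE (lebesgue_rV_box (A := fun=> [set` `]-M, M[]))//.
suff /andP[] : (0 <= \prod_(i < n) @lebesgue_measure R [set` `](- M)%R, M[] < +oo)%E by [].
apply: (big_ind (fun x => 0 <= x < +oo)%E) => [|x y /andP[x0 xy] /andP[y0 yy]|i _].
- by rewrite lee_fin ler01 ltry.
- by rewrite mule_ge0// lte_mul_pinfty// ge0_fin_numE.
- rewrite measure_ge0/= lebesgue_measure_itv/=; case: ifP => // _.
  by rewrite -EFinD ltry.
Qed.

Lemma lebesgue_rV_sigma_finite n : sigma_finite setT (lebesgue_rV R n).
Proof.
exists (fun k : nat => cube (k%:R : R)); last first.
  by move=> k; split; [exact: measurable_cube|exact: cube_fin].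
apply/seteqP; split => // x _.
exists (Num.bound (\sum_i `|x ord0 i|)) => // i; rewrite -ltr_norml.
apply: le_lt_trans (archi_boundP _); last by rewrite sumr_ge0.
by rewrite (bigD1 i)//= lerDl sumr_ge0.
Qed.

(** Fubini along the recursion that defines [lebesgue_rV]: coordinate 0 is the last factor, so i = 0
    is an inner integral, and any other i is handled by induction on the slices. The bound C and the
    cube provide integrability at every level. *)
Lemma int_slice0 n (i : 'I_n) (psi : 'rV[R]_n -> R) C M :
  measurable_fun setT psi -> (forall x, `|psi x| <= C) ->
  (forall x, ~ cube M x -> psi x = 0) ->
  (forall x, \int[lebesgue_measure]_t (psi (upd x i t))%:E = 0)%E ->
  (\int[lebesgue_rV R n]_x (psi x)%:E = 0)%E.
Proof.
elim: n => [|n IH] in i psi *; first by case: i.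
move=> mpsi bpsi spsi zpsi.
pose m1 : {sigma_finite_measure set _ -> \bar R} := sigma_finite_copy (@lebesgue_rV_sigma_finite n).
pose f (p : 'rV[R]_n * measurableTypeR R) := (psi (rV_cons p))%:E.
have mf : measurable_fun setT f.
  by apply/measurable_EFinP; apply: measurableT_comp => //; exact: measurable_rV_cons.
have fi : (m1 \x @lebesgue_measure R)%E.-integrable setT f.
  apply: (@bounded_support_integrable _ _ _ _ (@rV_cons R n @^-1` cube M) (psi \o @rV_cons R n) C).
  - rewrite -[X in measurable X]setTI; apply: measurable_rV_cons => //; exact: measurable_cube.
  - exact: (@cube_fin n.+1 M).
  - exact/measurable_EFinP.
  - by move=> x; exact: bpsi.
  - by move=> x nx; apply: spsi.
have -> : (\int[lebesgue_rV R n.+1]_x (psi x)%:E = \int[m1 \x @lebesgue_measure R]_p f p)%E.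
  apply: (@integral_pushforward _ _ _ _ _ _ (@measurable_rV_cons R n) (m1 \x @lebesgue_measure R)%E setT (EFin \o psi)) => //.
  exact/measurable_EFinP.
case: (unliftP ord0 i) => [j|] ij.
  rewrite -(integral21_prod_meas1 fi); apply: integral0_eq => y _.
  apply: (IH j (fun x => psi (rV_cons (x, y)))) => //.
  - by apply: measurableT_comp => //; apply: measurableT_comp; [exact: measurable_rV_cons|exact: measurable_pair2].
  - move=> x nx; apply: spsi => h; apply: nx => k.
    by have := h (lift ord0 k); rewrite mxE liftK.
  - move=> x; rewrite -[RHS](zpsi (rV_cons (x, y))); apply: eq_integral => t _.
    congr (psi _)%:E; apply/rowP => k; rewrite !mxE ij.
    case: (unliftP ord0 k) => [k'|] ->.
      by rewrite /= mxE (inj_eq lift_inj).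
    by [].
rewrite -(integral12_prod_meas1 fi); apply: integral0_eq => x _.
rewrite -[RHS](zpsi (rV_cons (x, 0))); apply: eq_integral => t _.
congr (psi _)%:E; apply/rowP => k; rewrite !mxE ij.
by case: (unliftP ord0 k) => [k'|] ->; rewrite ?eqxx.
Qed.

End cubes.

(** * Boxes *)

Section boxes.
Variables (R : realType) (n : nat).
Implicit Types (b c : 'I_n -> R) (O : set 'rV[R]_n).

Definition obox b c : set 'rV[R]_n := [set x | forall i, b i < x ord0 i < c i].
Definition cbox b c : set 'rV[R]_n := [set x | forall i, b i <= x ord0 i <= c i].

Lemma measurable_obox b c : measurable (obox b c).
Proof.
rewrite (_ : obox b c = [set x | forall i, [set` `]b i, c i[] (x ord0 i)]).
  exact: (@measurable_rV_box R n (fun i => [set` `]b i, c i[])).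
by apply/seteqP; split => x /= h i; have := h i; rewrite in_itv.
Qed.

Lemma coord_le_norm (x : 'rV[R]_n) i : `|x ord0 i| <= `|x|.
Proof.
by rewrite [leRHS]/Num.norm/= mx_normrE; apply/bigmax_geP; right => /=; exists (ord0, i).
Qed.

Lemma open_rat_box O x : open O -> O x -> exists p : 'rV[rat]_n * 'rV[rat]_n,
  obox (fun i => ratr (p.1 ord0 i)) (fun i => ratr (p.2 ord0 i)) x /\
  cbox (fun i => ratr (p.1 ord0 i)) (fun i => ratr (p.2 ord0 i)) `<=` O.
Proof.
move=> oO Ox; have /nbhs_ballP[e /= e0 eO] : nbhs x O by exact: open_nbhs_nbhs.
have h i : exists p : rat * rat, [/\ x ord0 i - e < ratr p.1, ratr p.1 < x ord0 i,
    x ord0 i < ratr p.2 & ratr p.2 < x ord0 i + e].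
  have [q] := @rat_in_itvoo R (x ord0 i - e) (x ord0 i) ltac:(by rewrite ltrBlDr ltrDl).
  have [q'] := @rat_in_itvoo R (x ord0 i) (x ord0 i + e) ltac:(by rewrite ltrDl).
  by rewrite !in_itv/= => /andP[? ?] /andP[? ?]; exists (q, q').
have [p hp] := boolp.choice h.
exists (\row_i (p i).1, \row_i (p i).2); split.
  by move=> i /=; rewrite !mxE; have [_ -> ->] := hp i.
move=> y hy; apply: eO; rewrite mx_norm_ball /ball_ /=.
rewrite [ltLHS]/Num.norm/= mx_normrE; apply/bigmax_ltP; split => // -[i j] _ /=.
rewrite !mxE ord1; have [h1 h2 h3 h4] := hp j; have := hy j; rewrite /= !mxE => /andP[h5 h6].
by rewrite ltr_norml; lra.
Qed.

(** The closed box must lie in O so that a bump living on the open box is a test function of O.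
    Indices encoding no such box give [set0], which makes the family a plain sequence. *)
Definition rat_boxes O (k : nat) : set 'rV[R]_n :=
  if @unpickle ('rV[rat]_n * 'rV[rat]_n)%type k is Some p then
    if `[< cbox (fun i => ratr (p.1 ord0 i)) (fun i => ratr (p.2 ord0 i)) `<=` O >] then
    obox (fun i => ratr (p.1 ord0 i)) (fun i => ratr (p.2 ord0 i)) else set0
  else set0.

Lemma rat_boxesP O k : rat_boxes O k = set0 \/ exists b c, rat_boxes O k = obox b c /\ cbox b c `<=` O.
Proof.
rewrite /rat_boxes; case: unpickle => [p|]; last by left.
by case: asboolP => h; [right; eexists; eexists; split; [reflexivity|]|left].
Qed.

Lemma rat_boxes_cover O : open O -> O = \bigcup_k rat_boxes O k.
Proof.
move=> oO; apply/seteqP; split => x.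
  move=> /(open_rat_box oO)[p [px pO]]; exists (pickle p) => //.
  by rewrite /rat_boxes pickleK; case: asboolP.
move=> [k _]; have [->//|[b [c [-> bc]]]] := rat_boxesP O k.
by move=> xbc; apply: bc => i; have /andP[/ltW -> /ltW ->] := xbc i.
Qed.

(** The sigma-algebra is generated by the coordinates and not by the topology; the countable cover
    by rational boxes links the two. *)
Lemma open_measurable_rV O : open O -> measurable O.
Proof.
move=> /rat_boxes_cover ->; apply: bigcup_measurable => k _.
by have [->//|[b [c [-> _]]]] := rat_boxesP O k; exact: measurable_obox.
Qed.

Lemma continuous_measurable_rV (f : 'rV[R]_n -> R) :
  continuous f -> measurable_fun setT f.
Proof.
move=> cf; apply: (measurability _ (RGenOInfty.measurableE R)) => /=.
move=> _ [_ [x ->] <-]; rewrite setTI; apply: open_measurable_rV.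
by apply: open_comp; [move=> y _; exact: cf|exact: interval_open].
Qed.

Lemma compact_sub_cube (K : set 'rV[R]_n) : compact K -> exists2 M, 0 < M & K `<=` cube M.
Proof.
move=> /compact_bounded [M [_ hM]]; exists (`|M| + 2); first by rewrite ltr_wpDl.
move=> x Kx i; rewrite -ltr_norml; apply: le_lt_trans (coord_le_norm x i) _.
have := hM (`|M| + 1); rewrite ltr_pwDr ?ler_norm// => /(_ isT x Kx) /le_lt_trans; apply.
by rewrite ltrD2l ltr1n.
Qed.

Lemma closure_cbox b c (A : set 'rV[R]_n) : A `<=` cbox b c -> closure A `<=` cbox b c.
Proof.
move=> AB; have cB : closed (cbox b c).
  rewrite (_ : cbox b c = \bigcap_(i in [set: 'I_n])
    ((fun x : 'rV[R]_n => x ord0 i) @^-1` [set` `[b i, c i]])).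
    apply: closed_bigI => i _; apply: closed_comp; last exact: interval_closed.
    by move=> x _; exact: coord_continuous.
  apply/seteqP; split => x /= h i; first by move=> _; rewrite /= in_itv/=; exact: h.
  by have := h i I; rewrite /= in_itv.
by rewrite closureE; apply: smallest_sub.
Qed.

End boxes.

(** * Integrals of partial derivatives *)

Lemma upd_shift (R : realType) n (x : 'rV[R]_n) i (t h : R) :
  upd x i (h *: 1 + t) = h *: delta_mx 0 i + upd x i t.
Proof.
apply/rowP => j.
rewrite !mxE.
have [_|ji] := eqVneq j i; first by rewrite eqxx.
by rewrite andbF mulr0 add0r.
Qed.

Lemma is_derive_slice (R : realType) n (f : 'rV[R]_n -> R) x i t :
  derivable f (upd x i t) (delta_mx 0 i) ->
  is_derive t 1 (fun s => f (upd x i s)) ('D_(delta_mx 0 i) f (upd x i t)).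
Proof.
have E : (fun h : R => h^-1 *: (((fun s => f (upd x i s)) \o shift t) (h *: 1) - f (upd x i t))) =
   (fun h => h^-1 *: ((f \o shift (upd x i t)) (h *: delta_mx 0 i) - f (upd x i t))).
  by apply/funext => h /=; rewrite upd_shift.
move=> df; apply: DeriveDef.
  by rewrite /derivable E.
by rewrite /derive E.
Qed.

Section test_function_integral.
Variables (R : realType) (n : nat) (Omega : set 'rV[R]_n).
Notation mu := (lebesgue_rV R n).

Lemma partial_out (phi : 'rV[R]_n -> R) i x :
  ~ closure [set x | phi x != 0] x -> partial i phi x = 0.
Proof.
move=> nx; rewrite /partial -(derive_cst (0 : R) x (delta_mx 0 i)).
apply: near_eq_derive.
have : nbhs x (~` closure [set x | phi x != 0]).
  by apply: open_nbhs_nbhs; split => //; apply: closed_openC; exact: closed_closure.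
apply: filterS => y ny /=; apply/eqP; apply/negPn/negP => py.
by apply: ny; exact: subset_closure.
Qed.

Lemma test_function_integrable (phi : 'rV[R]_n -> R) i : test_function Omega phi ->
  exists C M : R, [/\ 0 < M, measurable_fun setT (partial i phi),
    forall x, `|partial i phi x| <= C,
    forall x, ~ cube M x -> partial i phi x = 0 & forall x, ~ cube M x -> phi x = 0].
Proof.
move=> [sphi cK KO]; set K := closure _ in cK KO.
have [M M0 KM] := compact_sub_cube cK.
have [/= cphi _] := sphi [:: i].
have : compact (partial i phi @` K) by apply: continuous_compact => //; exact: continuous_subspaceT.
move=> /compact_bounded [C [_ hC]]; exists (`|C| + 1), M; split => //.
- exact: continuous_measurable_rV.
- move=> x; have [Kx|nKx] := pselect (K x); last first.
    by rewrite partial_out// normr0 addr_ge0.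
  by apply: hC; [rewrite ltr_pwDr ?ler_norm|exists x].
- by move=> x nx; apply: partial_out => /KM.
- move=> x nx; apply/eqP; apply/negPn/negP => px; apply: nx; apply: KM.
  exact: subset_closure.
Qed.

(** The fundamental theorem of calculus on each line parallel to axis i, phi being 0 at both ends -M
    and M. This is what makes constants H^1 functions with zero gradient, hence admissible in the
    Neumann problem. *)
Lemma integral_partial0 (phi : 'rV[R]_n -> R) i : test_function Omega phi ->
  (\int[mu]_(x in Omega) (partial i phi x)%:E = 0)%E.
Proof.
move=> tphi; have [C [M [M0 mp bp sp sphi]]] := test_function_integrable i tphi.
have [sm cK KO] := tphi.
rewrite integral_mkcond.
have -> : (fun x => (partial i phi x)%:E) \_ Omega = (fun x => (partial i phi x)%:E).
  apply/funext => x; rewrite patchE; case: ifPn => //; rewrite notin_setE => nx.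
  by rewrite partial_out// => /KO.
apply: (int_slice0 (i := i) mp bp sp) => x.
pose g t := phi (upd x i t).
have dg (t : R) : is_derive t 1 g (partial i phi (upd x i t)).
  by apply: is_derive_slice; have [_] := sm [::]; exact.
have cpu : continuous (fun t => partial i phi (upd x i t)).
  have [/= cphi _] := sm [:: i].
  move=> t; apply: (@continuous_comp _ _ _ (upd x i)); last exact: cphi.
  have -> : upd x i = (fun s => s *: delta_mx 0 i + upd x i 0).
    by apply/funext => s; rewrite -upd_shift; congr upd; rewrite scaler1 addr0.
  by apply: cvgD; [apply: cvgZr_tmp; exact: cvg_id|exact: cvg_cst].
have outM (t : R) : ~ (- M < t < M) -> ~ cube M (upd x i t).
  by move=> nt h; apply: nt; have := h i; rewrite mxE eqxx.
transitivity (\int[lebesgue_measure]_(t in `[(- M)%R, M]) (partial i phi (upd x i t))%:E)%E.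
  rewrite [RHS]integral_mkcond; apply: eq_integral => t _.
  rewrite patchE; case: ifPn => //; rewrite notin_setE/= in_itv/= => nt.
  rewrite sp//; apply: outM => /andP[h1 h2]; apply: nt.
  by rewrite !ltW.
rewrite (@continuous_FTC2 _ (fun t => partial i phi (upd x i t)) g).
- rewrite /g !sphi ?subee//; apply: outM; rewrite ltxx ?andbF//.
- by rewrite gtrN.
- exact: continuous_subspaceT.
- have cg : continuous g.
    move=> t; apply: differentiable_continuous; apply/derivable1_diffP.
    by have [] := dg t.
  split.
  + by move=> t _; have [] := dg t.
  + exact/cvg_at_right_filter/cg.
  + exact/cvg_at_left_filter/cg.
- by move=> t _; rewrite derive1E; have [_ ->] := dg t.
Qed.

End test_function_integral.

(** * Bump functions *)

Lemma is_derive1_compose (R : realType) (f g : R -> R) (x df dg : R) :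
  is_derive x 1 g dg -> is_derive (g x) 1 f df -> is_derive x 1 (f \o g) (df * dg).
Proof.
move=> [dg1 dg2] [df1 df2]; apply: DeriveDef.
  by apply/derivable1_diffP; apply: differentiable_comp; apply/derivable1_diffP.
by rewrite -derive1E derive1_comp// !derive1E df2 dg2.
Qed.

Section flat_functions.
Variable R : realType.
Implicit Types p : {poly R}.

(* Closed under derivatives: (p(1/x) exp(-1/x))' has the same form. *)
Definition flat p (x : R) : R := if 0 < x then p.[x^-1] * expR (- x^-1) else 0.

(** Termwise, y^k <= k! exp y; this explains the factorials in the witness. *)
Lemma poly_expR_bound p : exists2 C, 0 <= C &
  forall y, 0 <= y -> `|p.[y]| * expR (- y) <= C.
Proof.
exists (\sum_(i < size p) `|p`_i| * i`!%:R).
  by apply: sumr_ge0 => i _; rewrite mulr_ge0.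
move=> y y0; rewrite horner_coef.
apply: (@le_trans _ _ (\sum_(i < size p) (`|p`_i| * y ^+ i) * expR (- y))).
  rewrite -mulr_suml ler_wpM2r ?expR_ge0//.
  apply: le_trans (ler_norm_sum _ _ _) _; apply: ler_sum => i _.
  by rewrite normrM normrX (ger0_norm y0).
apply: ler_sum => i _; rewrite -mulrA ler_wpM2l//.
rewrite expRN ler_pdivrMr ?expR_gt0// -ler_pdivrMl ?ltr0n ?fact_gt0// mulrC.
case: (nat_of_ord i) => [|k].
  by rewrite expr0 fact0 invr1 mulr1 (le_trans _ (expR_ge1Dx y))// lerDl.
by apply: le_trans (expR_ge1Dxn k y0); rewrite lerDr.
Qed.

Lemma is_derive_flat p (x : R) : is_derive x 1 (flat p) (flat ('X^2 * (p - p^`())) x).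
Proof.
have [x0|x0|x0] := ltgtP 0 x.
- have nE : \forall y \near x, p.[y^-1] * expR (- y^-1) = flat p y.
    near=> y; rewrite /flat ifT//; near: y; exact: lt_nbhsr.
  apply: near_eq_is_derive nE _.
  have xn0 : x != 0 by rewrite gt_eqF.
  have dV : is_derive x 1 (fun y : R => y^-1) (- x ^- 2).
    by apply: is_derive_eq; [exact: is_deriveV|rewrite /= scaler1].
  have dp : is_derive x 1 (horner p \o (fun y : R => y^-1)) (p^`().[x^-1] * - x ^- 2).
    have dh : is_derive (x^-1 : R) (1 : R) (horner p) p^`().[x^-1].
      apply: DeriveDef; first exact: derivable_horner.
      by rewrite -derive1E derivE.
    exact: is_derive1_compose dV dh.
  have de : is_derive x 1 (expR \o (fun y : R => - y^-1)) (expR (- x^-1) * - (- x ^- 2)).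
    by apply: is_derive1_compose; exact: is_deriveN.
  apply: is_derive_eq (is_deriveM dp de) _.
  rewrite /flat x0 /= hornerM hornerXn hornerD hornerN.
  by rewrite /GRing.scale/= exprVn; ring.
- have nE : \forall y \near x, 0 = flat p y.
    near=> y; rewrite /flat ltNge ifF//; apply/negbTE; rewrite negbK ltW//.
    near: y; exact: lt_nbhsl.
  rewrite /flat ltNge (ltW x0)/=.
  by apply: near_eq_is_derive nE _; exact: is_derive_cst.
- rewrite -{x}x0; rewrite /flat ltxx.
  (* At 0 the difference quotient is (1/h) p(1/h) exp(-1/h). One factor ['X] accounts for the 1/h,
     the other leaves the bound C h, which tends to 0. *)
  have [C C0 hC] := poly_expR_bound ('X^2 * p).
  have cv : (fun h : R => h^-1 *: ((flat p \o shift 0) (h *: 1) - flat p 0)) @ 0^' --> (0 : R).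
    apply/cvgrPdist_le => e e0; near=> h.
    rewrite sub0r normrN /= scaler1 addr0 {2}/flat ltxx subr0 /flat.
    case: ifPn => [h0|_]; last by rewrite scaler0 normr0 ltW.
    have hC' := hC h^-1 (ltac:(by rewrite invr_ge0 ltW)).
    apply: (@le_trans _ _ (C * h)).
      rewrite -ler_pdivrMr//; apply: le_trans hC'.
      rewrite hornerM hornerXn /GRing.scale/= !normrM (ger0_norm (expR_ge0 _)).
      by rewrite [`|h^-1|]gtr0_norm ?invr_gt0//; lra.
    apply: (@le_trans _ _ ((C + 1) * (e / (C + 1)))); last first.
      by rewrite mulrCA divff ?mulr1// gt_eqF// ltr_wpDl.
    apply: ler_pM => //; [exact: ltW|by rewrite lerDl|].
    apply: le_trans (ler_norm h) _; near: h.
    by apply: dnbhs0_le; rewrite divr_gt0// ltr_wpDl.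
  apply: DeriveDef; first by apply/cvg_ex; exists 0.
  exact/cvg_lim.
Unshelve. all: by end_near.
Qed.

End flat_functions.

Section flat_algebra.
Variable R : realType.

(** A class stable under differentiation: continuity and derivability of its members then hold for
    all iterated derivatives at once. Affine substitution is allowed only inside [flat], which is
    enough for the bumps. *)
Inductive flat_alg : (R -> R) -> Prop :=
| FlatAff p k c : flat_alg (fun x => flat p (k * x + c))
| FlatCst a : flat_alg (fun=> a)
| FlatAdd f g : flat_alg f -> flat_alg g -> flat_alg (fun x => f x + g x)
| FlatMul f g : flat_alg f -> flat_alg g -> flat_alg (fun x => f x * g x).

Lemma flat_alg_derive f : flat_alg f ->
  exists2 g, flat_alg g & forall x : R, is_derive x 1 f (g x).
Proof.
elim=> {f} [p k c|a|f g _ [f' ff' df] _ [g' fg' dg]|f g ff [f' ff' df] fg [g' fg' dg]].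
- exists (fun x => flat ('X^2 * (p - p^`())) (k * x + c) * k).
    by apply: FlatMul; [exact: FlatAff|exact: FlatCst].
  move=> x; have da : is_derive x (1 : R) (fun y : R => k * y + c) k.
    have dz : is_derive x (1 : R) (k *: (@id R)) (k *: 1) by exact: is_deriveZ.
    apply: (is_derive_eq (is_deriveD dz (is_derive_cst c x 1))).
    by rewrite addr0 /GRing.scale/= mulr1.
  exact: (is_derive1_compose da (is_derive_flat p (k * x + c))).
- by exists (fun=> 0); [exact: FlatCst|move=> x; exact: is_derive_cst].
- exists (fun x => f' x + g' x); first exact: FlatAdd.
  by move=> x; exact: (is_deriveD (df x) (dg x)).
- exists (fun x => f x * g' x + g x * f' x); first by apply: FlatAdd; exact: FlatMul.
  by move=> x; exact: (is_deriveM (df x) (dg x)).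
Qed.

Variable n : nat.

Definition prod_fun (f : 'I_n -> R -> R) (x : 'rV[R]_n) : R := \prod_i f i (x ord0 i).

Lemma is_derive_prod_fun (f : 'I_n -> R -> R) (j : 'I_n) (g : R -> R)
    (x : 'rV[R]_n) :
  is_derive (x ord0 j : R) 1 (f j) (g (x ord0 j)) ->
  is_derive x (delta_mx 0 j) (prod_fun f)
    (prod_fun (fun i => if i == j then g else f i) x).
Proof.
move=> [df gE]; pose c := \prod_(i | i != j) f i (x ord0 i).
have E : (fun h : R => h^-1 *: ((prod_fun f \o shift x) (h *: delta_mx 0 j) - prod_fun f x))
  = (fun h : R => c * (h^-1 *: ((f j \o shift (x ord0 j)) (h *: 1) - f j (x ord0 j)))).
  apply/funext => h.
  have e1 : prod_fun f (h *: delta_mx 0 j + x) = f j (h *: 1 + x ord0 j) * c.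
    rewrite /prod_fun (bigD1 j)//=; congr (_ * _); first by rewrite !mxE !eqxx.
    by apply: eq_bigr => i ij; rewrite !mxE (negbTE ij) andbF mulr0 add0r.
  have e2 : prod_fun f x = f j (x ord0 j) * c by rewrite /prod_fun (bigD1 j).
  rewrite [X in _ *: (X - _)]e1 e2 -mulrBl.
  set D := _ - _; rewrite -[LHS]/(h^-1 * (D * c)) -[RHS]/(c * (h^-1 * D)).
  by rewrite mulrA mulrC.
have cv : (fun h : R => c * (h^-1 *: ((f j \o shift (x ord0 j)) (h *: 1) - f j (x ord0 j)))) @ 0^'
    --> c * g (x ord0 j).
  by apply: cvgM; [exact: cvg_cst|rewrite -gE; exact: df].
have PE : prod_fun (fun i => if i == j then g else f i) x = c * g (x ord0 j).
  rewrite /prod_fun (bigD1 j)//= eqxx mulrC; congr (_ * _).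
  by apply: eq_bigr => i /negbTE ->.
apply: DeriveDef; first by rewrite /derivable E; apply/cvg_ex; exists (c * g (x ord0 j)).
by rewrite /derive E PE; exact/cvg_lim.
Qed.

Lemma continuous_prod_fun (f : 'I_n -> R -> R) :
  (forall i, continuous (f i)) -> continuous (prod_fun f).
Proof.
move=> cf; rewrite /prod_fun; elim: (index_enum _) => [|k r IH].
  have -> : (fun y : 'rV[R]_n => \prod_(i <- [::]) f i (y ord0 i)) = fun=> 1.
    by apply/funext => y; rewrite big_nil.
  exact: cst_continuous.
have -> : (fun y : 'rV[R]_n => \prod_(i <- k :: r) f i (y ord0 i)) =
    fun y => f k (y ord0 k) * \prod_(i <- r) f i (y ord0 i).
  by apply/funext => y; rewrite big_cons.
move=> x; apply: continuousM; last exact: IH.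
apply: (@continuous_comp _ _ _ (fun y : 'rV[R]_n => y ord0 k)); last exact: cf.
exact: coord_continuous.
Qed.

Lemma flat_alg_continuous f : flat_alg f -> continuous f.
Proof.
move=> /flat_alg_derive[g _ dg] x; apply: differentiable_continuous.
by apply/derivable1_diffP; have [] := dg x.
Qed.

(** A partial derivative of a tensor product replaces one factor by its derivative, so every
    iterated partial derivative is again a tensor product of [flat_alg] factors. *)
Lemma smooth_prod_fun (f : 'I_n -> R -> R) : (forall i, flat_alg (f i)) -> smooth (prod_fun f).
Proof.
move=> ff s.
suff [f' ff' ->] : exists2 f', (forall i, flat_alg (f' i)) &
    foldr (@partial R n) (prod_fun f) s = prod_fun f'.
  split; first by apply: continuous_prod_fun => i; exact: flat_alg_continuous.
  move=> j x; have [g _ dg] := flat_alg_derive (ff' j).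
  by have [] := is_derive_prod_fun (dg (x ord0 j)).
elim: s => [|j s [f' ff' IH]]; first by exists f.
have [g fg dg] := flat_alg_derive (ff' j).
exists (fun i => if i == j then g else f' i); first by move=> i; case: ifP.
apply/funext => x /=; rewrite IH /partial.
by have [] := is_derive_prod_fun (dg (x ord0 j)).
Qed.

Variables (b c : 'I_n -> R).

(** In each coordinate, exp(-1/((k+1)(y - b))) exp(-1/((k+1)(c - y))) between b and c, and 0
    elsewhere. The dilation by k+1 makes the bumps tend pointwise to the indicator of the open
    box. *)
Definition box_bump (k : nat) : 'rV[R]_n -> R := prod_fun (fun i y =>
  flat 1 (k.+1%:R * y + - (k.+1%:R * b i)) * flat 1 (- k.+1%:R * y + k.+1%:R * c i)).

Lemma flat1_itv (y : R) : 0 <= flat 1 y <= 1.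
Proof.
rewrite /flat; case: ifPn => y0; last by rewrite lexx ler01.
by rewrite hornerC mul1r expR_ge0 expR_le1 oppr_le0 invr_ge0 ltW.
Qed.

Lemma box_bump_itv k x : 0 <= box_bump k x <= 1.
Proof.
rewrite /box_bump /prod_fun; apply: (big_ind (fun z => 0 <= z <= 1)) => [|y z|i _].
- by rewrite lexx ler01.
- by move=> /andP[y0 y1] /andP[z0 z1]; rewrite mulr_ge0//= mulr_ile1.
- set y := flat _ _; set z := flat _ _.
  have /andP[y0 y1] : 0 <= y <= 1 := flat1_itv _.
  have /andP[z0 z1] : 0 <= z <= 1 := flat1_itv _.
  by rewrite mulr_ge0//= mulr_ile1.
Qed.

Lemma box_bump_out k x : ~ obox b c x -> box_bump k x = 0.
Proof.
move=> nx; have [i] : exists i, ~ (b i < x ord0 i < c i) by exact/existsNP.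
move=> /negP; rewrite negb_and -!leNgt => h.
rewrite /box_bump /prod_fun (bigD1 i)//=; set y := flat _ _; set z := flat _ _.
suff -> : y * z = 0 by rewrite mul0r.
case/orP: h => h.
  rewrite /y /flat ifF ?mul0r//; apply/negbTE; rewrite -leNgt.
  by rewrite -mulrBr mulr_ge0_le0// subr_le0.
rewrite /z /flat ifF ?mulr0//; apply/negbTE; rewrite -leNgt.
by rewrite mulNr addrC -mulrBr mulr_ge0_le0// subr_le0.
Qed.

Lemma box_bump_cvg x : obox b c x -> (fun k => box_bump k x) @ \oo --> (1 : R).
Proof.
move=> bx.
have M1 (u v : nat -> R) : u @ \oo --> (1 : R) -> v @ \oo --> (1 : R) ->
    (fun k => u k * v k) @ \oo --> (1 : R).
  by move=> hu hv; rewrite -[X in _ --> X](mulr1 (1 : R)); exact: cvgM.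
have key (y : R) : 0 < y -> (fun k : nat => flat 1 (k.+1%:R * y)) @ \oo --> (1 : R).
  move=> y0; rewrite /flat.
  have -> : (fun k : nat => if 0 < k.+1%:R * y then (1 : {poly R}).[(k.+1%:R * y)^-1] * expR (- (k.+1%:R * y)^-1) else 0)
     = (fun k : nat => expR (- y^-1 * k.+1%:R^-1)).
    apply/funext => k; rewrite mulr_gt0// hornerC mul1r; congr expR.
    by rewrite invfM mulNr mulrC.
  have h : (fun k : nat => - y^-1 * k.+1%:R^-1) @ \oo --> (0 : R).
    rewrite -[X in _ --> X](mulr0 (- y^-1)).
    by apply: cvgM; [exact: cvg_cst|exact: cvg_harmonic].
  rewrite -[X in _ --> X]expR0.
  exact: (cvg_comp _ _ h (@continuous_expR R 0)).
rewrite /box_bump /prod_fun; elim: (index_enum _) => [|i r IH].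
  by rewrite (_ : (fun=> _) = fun=> 1); [exact: cvg_cst|apply/funext => k; rewrite big_nil].
pose u k := flat 1 (k.+1%:R * (x ord0 i - b i)); pose v k := flat 1 (k.+1%:R * (c i - x ord0 i)).
rewrite (_ : (fun=> _) = (fun k => (u k * v k) * \prod_(i <- r)
    (flat 1 (k.+1%:R * x ord0 i + - (k.+1%:R * b i)) *
     flat 1 (- k.+1%:R * x ord0 i + k.+1%:R * c i)))); last first.
  apply/funext => k; rewrite big_cons; congr (_ * _); congr (flat _ _ * flat _ _).
    by rewrite mulrBr.
  by rewrite mulrBr mulNr addrC.
have /andP[h1 h2] := bx i.
by apply: (M1 _ _ (M1 _ _ _ _)) IH; apply: key; rewrite subr_gt0.
Qed.

Lemma test_function_box_bump (O : set 'rV[R]_n) k : cbox b c `<=` O -> test_function O (box_bump k).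
Proof.
move=> bcO; have cl : closure [set x | box_bump k x != 0] `<=` cbox b c.
  apply: closure_cbox => x bx.
  have : obox b c x by apply: contrapT => /box_bump_out h; move: bx; rewrite /= h eqxx.
  by move=> bcx i; have /andP[/ltW -> /ltW ->] := bcx i.
split.
- apply: smooth_prod_fun => i; apply: FlatMul; exact: FlatAff.
- apply: (@subclosed_compact _ _ (cbox b c)) => //; first exact: closed_closure.
  have := @rV_compact R n (fun i => [set` `[b i, c i]]) (fun i => @segment_compact R (b i) (c i)).
  by congr compact; apply/seteqP; split => x h i; have := h i; rewrite /= in_itv.
- exact: subset_trans bcO.
Qed.

Lemma measurable_box_bump k : measurable_fun setT (box_bump k).
Proof.
apply: continuous_measurable_rV; apply: continuous_prod_fun => i.
by apply: flat_alg_continuous; apply: FlatMul; exact: FlatAff.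
Qed.

End flat_algebra.

(** * The fundamental lemma of the calculus of variations *)

Section rays.
Variables (R : realType) (n : nat).

(** [None] leaves a coordinate free. These sets form a pi-system generating the sigma-algebra, and
    they cut an open box in an open box; this is what the Dynkin argument on a box needs. *)
Definition ray (l : 'I_n -> option R) : set 'rV[R]_n :=
  [set x | forall i, if l i is Some a then a < x ord0 i else true].

Definition rays : set (set 'rV[R]_n) := range ray.

Lemma rays_setI : setI_closed rays.
Proof.
move=> _ _ [l _ <-] [l' _ <-].
exists (fun i => match l i, l' i with
  | Some a, Some a' => Some (Num.max a a') | Some a, None => Some a | None, o => o end) => //.
apply/seteqP; split => x /=.
  move=> h; split => i; have := h i; case: (l i) => [a|//]; case: (l' i) => [a'|//];
  by rewrite gt_max => /andP[].
move=> [h h'] i; have := h i; have := h' i; case: (l i) => [a|//]; case: (l' i) => [a'|//].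
by rewrite gt_max => -> ->.
Qed.

Lemma measurable_rays : @measurable _ 'rV[R]_n = <<s rays>>.
Proof.
apply/seteqP; split => A.
  apply: smallest_sub; first exact: smallest_sigma_algebra.
  rewrite -bigcup_seq => B [i _ [Y mY <-]].
  have : measurable_fun setT (@rV_coord R n i : g_sigma_algebraType rays -> R).
    apply: (measurability _ (RGenOInfty.measurableE R)) => /=.
    move=> _ [_ [a ->] <-]; rewrite setTI; apply: sub_sigma_algebra.
    exists (fun j => if j == i then Some a else None) => //.
    apply/seteqP; split => x /=; rewrite in_itv/= andbT.
      by move=> /(_ i); rewrite eqxx.
    by move=> h j; case: eqP => [->|].
  by move=> /(_ measurableT Y mY).
apply: smallest_sub; first exact: sigma_algebra_measurable.
move=> _ [l _ <-].
rewrite (_ : ray l = [set x | forall i, (if l i is Some a then [set` `]a, +oo[] else setT) (x ord0 i)]).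
  apply: (@measurable_rV_box R n (fun i => if l i is Some a then [set` `]a, +oo[] else setT)).
  by move=> i; case: (l i).
by apply/seteqP; split => x /= h i; have := h i; case: (l i) => //= a; rewrite in_itv/= andbT.
Qed.

End rays.

Section fundamental_lemma.
Variables (R : realType) (n : nat) (Omega : set 'rV[R]_n) (G : 'rV[R]_n -> R).
Notation mu := (lebesgue_rV R n).
Hypothesis oO : open Omega.
Hypothesis iG : mu.-integrable Omega (EFin \o G).
Hypothesis G0 : forall phi, test_function Omega phi ->
  \int[mu]_(x in Omega) (G x * phi x) = 0.

Let mO : measurable Omega := open_measurable_rV oO.

Let mG : measurable_fun Omega G.
Proof. by apply/measurable_EFinP; case/integrableP: iG. Qed.

(** Dominated convergence along the bumps of the box, whose values lie between 0 and 1, with |G| as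
    the dominating function. *)
Lemma integral_obox0 b c : cbox b c `<=` Omega ->
  (\int[mu]_(x in Omega) (G x * \1_(obox b c) x)%:E = 0)%E.
Proof.
move=> bcO.
have mb k := measurable_box_bump b c k.
have igb k : mu.-integrable Omega (EFin \o (fun x => G x * box_bump b c k x)).
  apply: (le_integrable mO _ _ (integrable_abse iG)).
    by apply/measurable_EFinP; apply: measurable_funM => //; exact: measurable_funTS.
  move=> x Ox /=; rewrite lee_fin normrM [leRHS]normr_id ler_piMr//.
  by have /andP[h0 h1] := box_bump_itv b c k x; rewrite ger0_norm.
have [] := @dominated_convergence _ _ _ mu _ mO (fun k x => (G x * box_bump b c k x)%:E)
  (fun x => (G x * \1_(obox b c) x)%:E) (fun x => `|(G x)%:E|%E).
- by move=> k; case/integrableP: (igb k).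
- apply/measurable_EFinP; apply: measurable_funM => //.
  by apply: measurable_indic; exact: measurable_obox.
- apply: aeW => x Ox; apply: cvg_EFin; first exact: nearW.
  apply: cvgM; first exact: cvg_cst.
  have [bx|nbx] := pselect (obox b c x).
    by rewrite indicE mem_set//; exact: box_bump_cvg.
  rewrite indicE memNset//; under eq_fun do rewrite box_bump_out//; exact: cvg_cst.
- exact: integrable_abse.
- apply: aeW => x k Ox; rewrite lee_fin normrM ler_piMr//.
  by have /andP[h0 h1] := box_bump_itv b c k x; rewrite ger0_norm.
move=> _ _ /=.
have -> : (fun k => \int[mu]_(x in Omega) (G x * box_bump b c k x)%:E)%E = (fun=> 0%E).
  apply/funext => k; have := G0 (test_function_box_bump k bcO).
  rewrite /Rintegral => h; have := fineK (integrable_fin_num mO (igb k)).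
  by rewrite h => <-.
by move=> /cvg_lim <-//; rewrite lim_cst.
Qed.

Section one_box.
Variables b c : 'I_n -> R.
Hypothesis bcO : cbox b c `<=` Omega.

Let H x : \bar R := ((G x * \1_(obox b c) x)%:E).
Let HO := H \_ Omega.

Let iHO : mu.-integrable setT HO.
Proof.
apply/(integrable_mkcond H mO).
apply: (le_integrable mO _ _ (integrable_abse iG)).
  apply/measurable_EFinP; apply: measurable_funM => //.
  by apply: measurable_indic; exact: measurable_obox.
move=> x Ox /=; rewrite lee_fin normrM [leRHS]normr_id ler_piMr//.
by rewrite indicE; case: (_ \in _); rewrite ?normr1 ?normr0.
Qed.

Let HO_obox (b' c' : 'I_n -> R) : (forall i, b i <= b' i) -> (forall i, c' i <= c i) ->
  (\int[mu]_(x in obox b' c') HO x = 0)%E.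
Proof.
move=> bb cc; have b'c'O : cbox b' c' `<=` Omega.
  apply: subset_trans bcO => x h i; have /andP[h1 h2] := h i.
  by rewrite (le_trans (bb i))// (le_trans h2).
rewrite -[RHS](integral_obox0 b'c'O) [LHS]integral_mkcond [RHS]integral_mkcond.
apply: eq_integral => x _; rewrite /HO !patchE.
have [Ox|nOx] := boolP (x \in Omega); last by case: ifP.
have [|nbx] := boolP (x \in obox b' c'); last by rewrite indicE (negbTE nbx) mulr0.
move=> bx'; rewrite /H !indicE bx' mem_set// => i; have := bx'; rewrite inE => bx.
by have /andP[h1 h2] := bx i; rewrite (le_lt_trans (bb i))// (lt_le_trans h2).
Qed.

(** The sets on which [HO] integrates to 0 contain the rays, since a ray meets the box in a smaller
    box with the same upper corner, and are closed under complement (the total integral is 0) and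
    countable disjoint union. *)
Lemma integral_HO A : measurable A -> (\int[mu]_(x in A) HO x = 0)%E.
Proof.
move=> mA.
have T0 : (\int[mu]_x HO x = 0)%E.
  rewrite -(HO_obox (fun=> lexx _) (fun=> lexx _)) [RHS]integral_mkcond.
  apply: eq_integral => x _; rewrite patchE; case: ifPn => // nx.
  by rewrite /HO patchE; case: ifP => // _; rewrite /H indicE (negbTE nx) mulr0.
move: mA; rewrite measurable_rays; move: A.
apply: (dynkin_induction (P := fun A => (\int[mu]_(x in A) HO x = 0)%E)
  (@measurable_rays R n) (@rays_setI R n)) => //.
- move=> _ [l _ <-].
  pose b' i := if l i is Some a then Num.max a (b i) else b i.
  rewrite -(HO_obox (b' := b') (c' := c)) //; last first.
    by move=> i; rewrite /b'; case: (l i) => // a; rewrite le_max lexx orbT.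
  rewrite [LHS]integral_mkcond [RHS]integral_mkcond.
  apply: eq_integral => x _; rewrite ![in LHS]patchE ![in RHS]patchE.
  have [bx|nbx] := boolP (x \in obox b c); last first.
    have -> : HO x = 0%E.
      by rewrite /HO patchE; case: ifP => // _; rewrite /H indicE (negbTE nbx) mulr0.
    by rewrite !if_same.
  have -> // : (x \in ray l) = (x \in obox b' c).
  apply/idP/idP; rewrite !inE => h i; have := h i; rewrite inE in bx; have /andP[bi ci] := bx i;
    rewrite /b'; case: (l i) => [a|].
  + by rewrite gt_max bi ci => ->.
  + by rewrite bi ci.
  + by rewrite gt_max => /andP[/andP[->]].
  + by [].
- move=> S mS S0.
  have := T0; rewrite -(setUv S) integral_setU//; first last.
  + exact/disj_setPCl.
  + by rewrite setUv; case/integrableP: iHO.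
  + exact: measurableC.
  by rewrite S0 add0e.
- move=> F mF tF F0; rewrite integral_bigcup//; last first.
    by apply: integrableS iHO => //; exact: bigcup_measurable.
  by rewrite eseries0.
Qed.

Lemma obox_ae0 : {ae mu, forall x, obox b c x -> G x = 0}.
Proof.
have : ae_eq mu setT HO (cst 0%E).
  apply: integral_ae_eq => //.
  by move=> E _ mE; rewrite integral_HO// integral0.
apply: filterS => x /(_ I) /=; rewrite /HO patchE => h bx.
have Ox : Omega x by apply: bcO => i; have /andP[/ltW -> /ltW ->] := bx i.
by move: h; rewrite mem_set// /H indicE mem_set// mulr1 => -[].
Qed.

End one_box.

Lemma test_function_ae0 : G = (fun=> 0) %[ae mu in Omega].
Proof.
have : forall k, {ae mu, forall x, rat_boxes Omega k x -> G x = 0}.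
  move=> k; have [->|[b [c [-> bcO]]]] := rat_boxesP Omega k; first exact: aeW.
  exact: obox_ae0.
move=> /ae_foralln; apply: filterS => x h.
by rewrite {1}(rat_boxes_cover oO) => -[k _]; exact: h.
Qed.

End fundamental_lemma.

(** * L^2 and H^1 *)

(* Locked, like inv_laplacian and dual_sqr below: unification otherwise gets
   lost in the choice operator behind grad. *)
HB.lock Definition dirichlet (R : realType) n (Omega : set 'rV[R]_n)
    (v w : 'rV[R]_n -> R) : R :=
  vinner Omega (grad Omega v) (grad Omega w).

Section Sobolev_spaces.
Variables (R : realType) (n : nat) (Omega : set 'rV[R]_n).
Notation E := ('rV[R]_n).
Notation mu := (lebesgue_rV R n).
Hypothesis oO : open Omega.
Hypothesis bO : bounded_set Omega.
Implicit Types (v w z phi : E -> R) (G H Z : 'I_n -> E -> R).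

Notation L2 := (@L2 R n Omega).
Notation inner := (@inner R n Omega).
Notation vinner := (@vinner R n Omega).
Notation H1 := (@H1 R n Omega).
Notation grad := (@grad R n Omega).
Notation L20 := (@L20 R n Omega).
Notation L2norm := (@L2norm R n Omega).
Notation vL2norm := (@vL2norm R n Omega).

Lemma measurable_Omega : measurable Omega.
Proof. exact: open_measurable_rV. Qed.
Let mO := measurable_Omega.

Lemma Omega_fin : (mu Omega < +oo)%E.
Proof.
have [M [_ hM]] := bO.
apply: le_lt_trans (@cube_fin R n (`|M| + 2)); apply: le_measure; rewrite ?inE//.
  exact: measurable_cube.
move=> x Ox i; rewrite -ltr_norml; apply: le_lt_trans (coord_le_norm x i) _.
have := hM (`|M| + 1); rewrite ltr_pwDr ?ler_norm// => /(_ isT x Ox) /le_lt_trans; apply.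
by rewrite ltrD2l ltr1n.
Qed.

Lemma L2P v : L2 v <-> sqint mu Omega v.
Proof.
have E2 : (EFin \o (fun x => (v \_ Omega) x ^+ 2)) = (EFin \o (fun x => v x ^+ 2)) \_ Omega.
  by apply/funext => x /=; rewrite !patchE; case: ifP => //; rewrite expr0n.
split.
  move=> Lv; have mv : measurable_fun setT (v \_ Omega).
    by move: Lv; rewrite /Defs.L2 inE => /andP[]; rewrite inE.
  split; first exact/measurable_restrictT.
  by apply/(integrable_mkcond _ mO); rewrite -E2; exact: Lfun2_integrable_sqr.
move=> [mv iv]; rewrite /Defs.L2 inE; apply/andP; split; rewrite inE/=.
  by apply/(measurable_restrictT _ mO).
rewrite /finite_norm unlock; apply: poweR_lty.
move/(integrable_mkcond _ mO): iv; rewrite -E2 => /integrableP[_].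
apply: le_lt_trans; rewrite le_eqVlt; apply/orP; left; apply/eqP.
apply: eq_integral => x _ /=; congr EFin.
by rewrite -[2]/(2%:R) powR_mulrn// normrX.
Qed.

Lemma L2D v w : L2 v -> L2 w -> L2 (fun x => v x + w x).
Proof. by move=> /L2P Lv /L2P Lw; apply/L2P; exact: sqintD. Qed.
Lemma L2B v w : L2 v -> L2 w -> L2 (fun x => v x - w x).
Proof. by move=> /L2P Lv /L2P Lw; apply/L2P; exact: sqintB. Qed.
Lemma L2N v : L2 v -> L2 (fun x => - v x).
Proof. by move=> /L2P Lv; apply/L2P; exact: sqintN. Qed.
Lemma L2Z k v : L2 v -> L2 (fun x => k * v x).
Proof. by move=> /L2P Lv; apply/L2P; exact: sqintZ. Qed.
Lemma L2_0 : L2 (fun=> 0).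
Proof. by apply/L2P; exact: sqint0. Qed.

Lemma L2_bounded v C : measurable_fun Omega v -> (forall x, Omega x -> `|v x| <= C) -> L2 v.
Proof.
move=> mv bv; apply/L2P; split => //.
apply: measurable_bounded_integrable => //; first exact: Omega_fin.
  exact: measurable_funX.
exists (C ^+ 2); split; first exact: num_real.
move=> y Cy x Ox /=; rewrite ger0_norm ?sqr_ge0//; apply: le_trans (ltW Cy).
have h := bv x Ox; rewrite -[v x ^+ 2]real_normK ?num_real//.
by rewrite ler_pXn2r// nnegrE (le_trans _ h).
Qed.

Lemma L2_cst k : L2 (fun=> k).
Proof. by apply: (@L2_bounded _ `|k|) => //; exact: measurable_cst. Qed.

Lemma innerC v w : inner v w = inner w v.
Proof. exact: ipC. Qed.
Lemma innerDl v w z : L2 v -> L2 w -> L2 z ->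
  inner (fun x => v x + w x) z = inner v z + inner w z.
Proof. by move=> /L2P ? /L2P ? /L2P ?; exact: ipDl. Qed.
Lemma innerBl v w z : L2 v -> L2 w -> L2 z ->
  inner (fun x => v x - w x) z = inner v z - inner w z.
Proof. by move=> /L2P ? /L2P ? /L2P ?; exact: ipBl. Qed.
Lemma innerNl v z : L2 v -> L2 z -> inner (fun x => - v x) z = - inner v z.
Proof. by move=> /L2P ? /L2P ?; exact: ipNl. Qed.
Lemma innerZl k v z : L2 v -> L2 z -> inner (fun x => k * v x) z = k * inner v z.
Proof. by move=> /L2P ? /L2P ?; exact: ipZl. Qed.
Lemma innerDr v w z : L2 v -> L2 w -> L2 z ->
  inner z (fun x => v x + w x) = inner z v + inner z w.
Proof. by move=> /L2P ? /L2P ? /L2P ?; exact: ipDr. Qed.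
Lemma innerBr v w z : L2 v -> L2 w -> L2 z ->
  inner z (fun x => v x - w x) = inner z v - inner z w.
Proof. by move=> /L2P ? /L2P ? /L2P ?; exact: ipBr. Qed.
Lemma innerZr k v z : L2 v -> L2 z -> inner z (fun x => k * v x) = k * inner z v.
Proof. by move=> /L2P ? /L2P ?; exact: ipZr. Qed.
Lemma inner_ge0 v : 0 <= inner v v.
Proof. exact: ip_ge0. Qed.
Lemma inner_CS v w : L2 v -> L2 w -> inner v w ^+ 2 <= inner v v * inner w w.
Proof. by move=> /L2P ? /L2P ?; exact: cauchy_schwarz. Qed.
Lemma inner_ae v v' w : L2 v -> L2 v' -> L2 w -> v = v' %[ae mu in Omega] ->
  inner v w = inner v' w.
Proof. by move=> /L2P ? /L2P ? /L2P ?; exact: ip_ae. Qed.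
Lemma inner_aer v v' w : L2 v -> L2 v' -> L2 w -> v = v' %[ae mu in Omega] ->
  inner w v = inner w v'.
Proof. by move=> *; rewrite innerC (innerC w); exact: inner_ae. Qed.

Lemma L2normE v : L2norm v ^+ 2 = inner v v.
Proof. by rewrite sqr_sqrtr// inner_ge0. Qed.

Definition L2v G := forall i, L2 (G i).

Lemma vinnerC G H : vinner G H = vinner H G.
Proof. by apply: eq_bigr => i _; exact: innerC. Qed.
Lemma vinnerDl G H Z : L2v G -> L2v H -> L2v Z ->
  vinner (fun i x => G i x + H i x) Z = vinner G Z + vinner H Z.
Proof. by move=> *; rewrite -big_split; apply: eq_bigr => i _; exact: innerDl. Qed.
Lemma vinnerZl k G Z : L2v G -> L2v Z ->
  vinner (fun i x => k * G i x) Z = k * vinner G Z.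
Proof. by move=> *; rewrite /Defs.vinner mulr_sumr; apply: eq_bigr => i _; exact: innerZl. Qed.
Lemma vinnerBl G H Z : L2v G -> L2v H -> L2v Z ->
  vinner (fun i x => G i x - H i x) Z = vinner G Z - vinner H Z.
Proof. by move=> *; rewrite -sumrB; apply: eq_bigr => i _; exact: innerBl. Qed.
Lemma vinner_ge0 G : 0 <= vinner G G.
Proof. by apply: sumr_ge0 => i _; exact: inner_ge0. Qed.
Lemma vinner_ae G G' H : L2v G -> L2v G' -> L2v H ->
  (forall i, G i = G' i %[ae mu in Omega]) -> vinner G H = vinner G' H.
Proof. by move=> LG LG' LH GG'; apply: eq_bigr => i _; exact: inner_ae. Qed.
Lemma vL2normE G : vL2norm G ^+ 2 = vinner G G.
Proof. by rewrite sqr_sqrtr// vinner_ge0. Qed.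

Lemma test_function_bounded phi : test_function Omega phi ->
  measurable_fun setT phi /\ exists C, forall x, `|phi x| <= C.
Proof.
move=> [sphi cK KO]; have [/= cphi _] := sphi [::].
split; first exact: continuous_measurable_rV.
have : compact (phi @` closure [set x | phi x != 0]).
  by apply: continuous_compact => //; exact: continuous_subspaceT.
move=> /compact_bounded [C [_ hC]]; exists (`|C| + 1) => x.
have [->|px] := eqVneq (phi x) 0; first by rewrite normr0 addr_ge0.
apply: hC; first by rewrite ltr_pwDr ?ler_norm.
by exists x => //; exact: subset_closure.
Qed.

Lemma L2_test phi : test_function Omega phi -> L2 phi.
Proof.
move=> /test_function_bounded[mp [C hC]].
by apply: (@L2_bounded _ C) => //; exact: measurable_funTS.
Qed.

Lemma L2_partial_test phi i : test_function Omega phi -> L2 (partial i phi).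
Proof.
move=> /(test_function_integrable i)[C [M [_ mp bp _ _]]].
by apply: (@L2_bounded _ C) => //; exact: measurable_funTS.
Qed.

Lemma L2_integrable v : L2 v -> mu.-integrable Omega (EFin \o v).
Proof.
move=> Lv; have := sqint_mul mO (proj1 (L2P _) Lv) (proj1 (L2P _) (L2_cst 1)).
by apply: eq_integrable => // x _ /=; rewrite mulr1.
Qed.

Lemma int_inner1 v : \int[mu]_(x in Omega) v x = inner v (fun=> 1).
Proof. by apply: eq_Rintegral => x _; rewrite mulr1. Qed.

Lemma L2_test_ae0 v : L2 v -> (forall phi, test_function Omega phi -> inner v phi = 0) ->
  v = (fun=> 0) %[ae mu in Omega].
Proof. by move=> Lv h; apply: test_function_ae0 => //; exact: L2_integrable. Qed.

(** The fundamental lemma applied to G i - G' i. As [grad] is a choice, its linearity and its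
    insensitivity to null sets all rest on this. *)
Lemma weak_gradient_unique v v' G G' : L2 v -> L2 v' -> v = v' %[ae mu in Omega] ->
  is_weak_gradient Omega v G -> is_weak_gradient Omega v' G' ->
  forall i, G i = G' i %[ae mu in Omega].
Proof.
move=> Lv Lv' vv' gG gG' i; have [LG hG] := gG i; have [LG' hG'] := gG' i.
have : (fun x => G i x - G' i x) = (fun=> 0) %[ae mu in Omega].
  apply: L2_test_ae0 => [|phi tphi]; first exact: L2B.
  have Lp := L2_test tphi; have Ldp := L2_partial_test i tphi.
  rewrite innerBl//; apply/eqP; rewrite subr_eq0 -eqr_opp -hG// -hG'//.
  by apply/eqP; exact: inner_ae.
by apply: filterS => x h /h /eqP; rewrite subr_eq0 => /eqP.
Qed.

Lemma H1_L2 v : H1 v -> L2 v. Proof. by case. Qed.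

Lemma gradP v : H1 v -> is_weak_gradient Omega v (grad v).
Proof. by move=> [_ vG]; exact: (xgetPex _ vG). Qed.

Lemma L2_grad v : H1 v -> L2v (grad v).
Proof. by move=> /gradP h i; have [] := h i. Qed.

Lemma weak_gradientD v w G H : L2 v -> L2 w -> is_weak_gradient Omega v G ->
  is_weak_gradient Omega w H ->
  is_weak_gradient Omega (fun x => v x + w x) (fun i x => G i x + H i x).
Proof.
move=> Lv Lw vG wH i; have [LG hG] := vG i; have [LH hH] := wH i; split; first exact: L2D.
move=> phi tphi; have Lp := L2_test tphi; have Ldp := L2_partial_test i tphi.
by rewrite !innerDl// hG// hH// opprD.
Qed.

Lemma weak_gradientZ k v G : L2 v -> is_weak_gradient Omega v G ->
  is_weak_gradient Omega (fun x => k * v x) (fun i x => k * G i x).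
Proof.
move=> Lv vG i; have [LG hG] := vG i; split; first exact: L2Z.
move=> phi tphi; have Lp := L2_test tphi; have Ldp := L2_partial_test i tphi.
by rewrite !innerZl// hG// mulrN.
Qed.

Lemma weak_gradient_ae v v' G : L2 v -> L2 v' -> v = v' %[ae mu in Omega] ->
  is_weak_gradient Omega v G -> is_weak_gradient Omega v' G.
Proof.
move=> Lv Lv' vv' vG i; have [LG hG] := vG i; split => // phi tphi.
by rewrite -hG//; apply: inner_ae; [| | |exact: ae_eq_sym] => //; exact: L2_partial_test.
Qed.

Lemma weak_gradient_cst k : is_weak_gradient Omega (fun=> k) (fun _ _ => 0).
Proof.
move=> i; split; first exact: L2_0.
move=> phi tphi; have Lp := L2_test tphi; have Ldp := L2_partial_test i tphi.
have -> : inner (fun=> 0) phi = 0.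
  by rewrite /Defs.inner; under eq_Rintegral do rewrite mul0r; rewrite Rintegral_cst// mul0r.
rewrite oppr0 /Defs.inner; rewrite RintegralZl//; last exact: L2_integrable.
by rewrite /Rintegral (integral_partial0 i tphi) mulr0.
Qed.

Lemma H1D v w : H1 v -> H1 w -> H1 (fun x => v x + w x).
Proof.
move=> Hv Hw; split; first by apply: L2D; exact: H1_L2.
by eexists; apply: weak_gradientD; [exact: H1_L2|exact: H1_L2|exact: gradP|exact: gradP].
Qed.
Lemma H1Z k v : H1 v -> H1 (fun x => k * v x).
Proof.
move=> Hv; split; first by apply: L2Z; exact: H1_L2.
by eexists; apply: weak_gradientZ; [exact: H1_L2|exact: gradP].
Qed.
Lemma H1N v : H1 v -> H1 (fun x => - v x).
Proof. by move=> /(H1Z (-1)); under eq_fun do rewrite mulN1r. Qed.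
Lemma H1B v w : H1 v -> H1 w -> H1 (fun x => v x - w x).
Proof. by move=> Hv /H1N; exact: H1D. Qed.
Lemma H1_cst k : H1 (fun=> k).
Proof. by split; [exact: L2_cst|eexists; exact: weak_gradient_cst]. Qed.
Lemma H1_ae v v' : H1 v -> L2 v' -> v = v' %[ae mu in Omega] -> H1 v'.
Proof.
move=> Hv Lv' vv'; split => //; exists (grad v).
by apply: weak_gradient_ae vv' _ => //; [exact: H1_L2|exact: gradP].
Qed.

Lemma grad_ae v v' G : H1 v -> L2 v' -> v = v' %[ae mu in Omega] ->
  is_weak_gradient Omega v' G -> forall i, grad v i = G i %[ae mu in Omega].
Proof.
move=> Hv Lv' vv' v'G; apply: (weak_gradient_unique _ Lv' vv') => //; first exact: H1_L2.
exact: gradP.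
Qed.

Notation gi := (@dirichlet R n Omega).

Lemma giE v w : gi v w = vinner (grad v) (grad w).
Proof. by rewrite dirichlet.unlock. Qed.

Lemma giC v w : gi v w = gi w v. Proof. by rewrite !giE vinnerC. Qed.

Lemma gi_grad v v' G w : H1 v -> L2 v' -> v = v' %[ae mu in Omega] ->
  is_weak_gradient Omega v' G -> H1 w -> gi v w = vinner G (grad w).
Proof.
move=> Hv Lv' vv' v'G Hw; rewrite giE; apply: vinner_ae; try exact: L2_grad.
  by move=> i; have [] := v'G i.
exact: grad_ae vv' v'G.
Qed.

Lemma gi_ae v v' w : H1 v -> H1 v' -> H1 w -> v = v' %[ae mu in Omega] -> gi v w = gi v' w.
Proof. by move=> Hv Hv' Hw vv'; rewrite [RHS]giE; apply: gi_grad vv' _ _ => //; [exact: H1_L2|exact: gradP]. Qed.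

Lemma giDl v w z : H1 v -> H1 w -> H1 z -> gi (fun x => v x + w x) z = gi v z + gi w z.
Proof.
move=> Hv Hw Hz; rewrite [gi v z]giE [gi w z]giE -vinnerDl; try exact: L2_grad.
have Lvw := L2D (H1_L2 Hv) (H1_L2 Hw).
apply: (gi_grad (v' := fun x => v x + w x)) => //; [exact: H1D|exact: aeW|].
by apply: weak_gradientD; try exact: H1_L2; exact: gradP.
Qed.

Lemma giZl k v z : H1 v -> H1 z -> gi (fun x => k * v x) z = k * gi v z.
Proof.
move=> Hv Hz; rewrite [in RHS]giE -vinnerZl; try exact: L2_grad.
have Lv := L2Z k (H1_L2 Hv).
apply: (gi_grad (v' := fun x => k * v x)) => //; [exact: H1Z|exact: aeW|].
by apply: weak_gradientZ; try exact: H1_L2; exact: gradP.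
Qed.

Lemma giBl v w z : H1 v -> H1 w -> H1 z -> gi (fun x => v x - w x) z = gi v z - gi w z.
Proof.
move=> Hv Hw Hz; have Hw' := H1Z (-1) Hw.
have -> : (fun x => v x - w x) = (fun x => v x + -1 * w x).
  by apply/funext => x; rewrite mulN1r.
by rewrite giDl// giZl// mulN1r.
Qed.

Lemma giDr v w z : H1 v -> H1 w -> H1 z -> gi z (fun x => v x + w x) = gi z v + gi z w.
Proof. by move=> Hv Hw Hz; rewrite (giC z) (giDl Hv Hw Hz) (giC z v) (giC z w). Qed.
Lemma giBr v w z : H1 v -> H1 w -> H1 z -> gi z (fun x => v x - w x) = gi z v - gi z w.
Proof. by move=> Hv Hw Hz; rewrite (giC z) (giBl Hv Hw Hz) (giC z v) (giC z w). Qed.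
Lemma giZr k v z : H1 v -> H1 z -> gi z (fun x => k * v x) = k * gi z v.
Proof. by move=> Hv Hz; rewrite (giC z) (giZl k Hv Hz) (giC z v). Qed.

Lemma gi_cst k z : H1 z -> gi (fun=> k) z = 0.
Proof.
move=> Hz; rewrite (gi_grad (v' := fun=> k) (H1_cst k) (L2_cst k) _ (weak_gradient_cst k) Hz); last exact: aeW.
apply: big1 => i _; rewrite /Defs.inner.
by under eq_Rintegral do rewrite mul0r; rewrite Rintegral_cst// mul0r.
Qed.

Lemma gi_ge0 v : 0 <= gi v v. Proof. by rewrite giE vinner_ge0. Qed.

Lemma gi_CS v w : H1 v -> H1 w -> gi v w ^+ 2 <= gi v v * gi w w.
Proof.
move=> Hv Hw; apply: discriminant_le0 => t.
have Hw' := H1Z t Hw; have := gi_ge0 (fun x => v x + t * w x).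
have Hvw := H1D Hv Hw'.
by rewrite giDl// !giDr// !giZl// !giZr// (giC w v); lra.
Qed.

Lemma L2_norm0 v : L2 v -> inner v v = 0 -> forall w, L2 w -> inner v w = 0.
Proof.
move=> Lv v0 w Lw; have := inner_CS Lv Lw; rewrite v0 mul0r => h.
by apply/eqP; rewrite -sqrf_eq0 eq_le h sqr_ge0.
Qed.

End Sobolev_spaces.

(** * The inverse Neumann Laplacian *)

HB.lock Definition inv_laplacian (R : realType) n (Omega : set 'rV[R]_n) :=
  neg_inv_lap Omega.

HB.lock Definition dual_sqr (R : realType) n (Omega : set 'rV[R]_n)
    (v : 'rV[R]_n -> R) : R :=
  normm1 Omega v ^+ 2.

Section inverse_laplacian.
Variables (R : realType) (n : nat) (Omega : set 'rV[R]_n).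
Notation E := ('rV[R]_n).
Notation mu := (lebesgue_rV R n).
Hypothesis oO : open Omega.
Hypothesis bO : bounded_set Omega.
Implicit Types (v w z phi : E -> R).

Notation L2 := (@L2 R n Omega).
Notation inner := (@inner R n Omega).
Notation vinner := (@vinner R n Omega).
Notation H1 := (@H1 R n Omega).
Notation grad := (@grad R n Omega).
Notation L20 := (@L20 R n Omega).
Notation gi := (@dirichlet R n Omega).
Notation one := (fun=> 1 : R).

Let L2c := @L2_cst R n Omega oO bO.
Let L2D := @L2D R n Omega oO.
Let L2B := @L2B R n Omega oO.
Let L2Z := @L2Z R n Omega oO.

Lemma L20P v : L20 v <-> L2 v /\ inner v one = 0.
Proof. by rewrite /Defs.L20 int_inner1. Qed.

Lemma L20B v w : L20 v -> L20 w -> L20 (fun x => v x - w x).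
Proof.
move=> /L20P[Lv v0] /L20P[Lw w0]; apply/L20P; split; first exact: L2B.
by rewrite innerBl// v0 w0 subrr.
Qed.

Lemma L20D v w : L20 v -> L20 w -> L20 (fun x => v x + w x).
Proof.
move=> /L20P[Lv v0] /L20P[Lw w0]; apply/L20P; split; first exact: L2D.
by rewrite innerDl// v0 w0 addr0.
Qed.

Lemma L20Z k v : L20 v -> L20 (fun x => k * v x).
Proof.
move=> /L20P[Lv v0]; apply/L20P; split; first exact: L2Z.
by rewrite innerZl// v0 mulr0.
Qed.

Lemma L20_ae v v' : L20 v -> L2 v' -> v = v' %[ae mu in Omega] -> L20 v'.
Proof.
move=> /L20P[Lv v0] Lv' vv'; apply/L20P; split => //.
by rewrite -v0; apply/esym; exact: inner_ae.
Qed.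

Variable K : R.
Hypothesis poincare : forall v, H1 v -> L20 v -> inner v v <= K * gi v v.
Hypothesis K0 : 0 <= K.

Section riesz.
Variable v : E -> R.
Hypothesis v0 : L20 v.

Let Lv : L2 v. Proof. by case: v0. Qed.

Let V : set (E -> R) := [set phi | H1 phi /\ L20 phi].
(** The Dirichlet functional: a minimizer over mean-zero H^1 functions solves - Delta phi = v with
    the Neumann condition. *)
Let J phi := gi phi phi / 2 - inner v phi.

Let V_nonempty : V (fun=> 0).
Proof.
split; first exact: H1_cst.
apply/L20P; split; first exact: L2c.
by rewrite /Defs.inner; under eq_Rintegral do rewrite mul0r; rewrite Rintegral_cst ?mul0r//; exact: measurable_Omega.
Qed.

(** By Cauchy-Schwarz and Poincare, (v, phi)^2 <= K |v|^2 |grad phi|^2, hence 2 (v, phi) <= K |v|^2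
    + |grad phi|^2. *)
Let J_lb phi : V phi -> - (K * inner v v) / 2 <= J phi.
Proof.
move=> [Hp p0]; have := inner_CS oO Lv (H1_L2 Hp).
have := poincare Hp p0; have g0 := gi_ge0 Omega phi; have i0 := inner_ge0 Omega v.
rewrite /J; set a := inner v v in i0 *; set g := gi phi phi in g0 *; set c := inner phi phi; set b := inner v phi.
move=> h1 h2; have h3 : b ^+ 2 <= (K * a) * g by rewrite (le_trans h2)// [K * a]mulrC -mulrA ler_wpM2l.
have Ka : 0 <= K * a by rewrite mulr_ge0.
have : 2 * b <= K * a + g.
  rewrite (le_trans (ler_norm _))// -ler_sqr ?nnegrE ?addr_ge0// real_normK ?num_real//.
  by have := sqr_ge0 (K * a - g); clearbody b; nra.
lra.
Qed.

Let minimizing (e : R) : 0 < e -> exists2 phi, V phi & forall psi, V psi -> J phi <= J psi + e.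
Proof.
move=> e0; pose S := [set J phi | phi in V].
have hS : has_inf S.
  split; first by exists (J (fun=> 0)), (fun=> 0).
  by exists (- (K * inner v v) / 2) => _ [phi Vp <-]; exact: J_lb.
have [_ [phi Vp <-] hp] := inf_adherent e0 hS.
exists phi => // psi Vpsi; apply: (le_trans (ltW hp)); rewrite lerD2r.
by apply: ge_inf; [case: hS|exists psi].
Qed.

(* The Euler-Lagrange equation of an almost minimizer holds up to sqrt e, which
   makes gradients of a minimizing sequence Cauchy. *)
Let almost_EL (e : R) phi psi : V phi -> (forall psi, V psi -> J phi <= J psi + e) -> V psi ->
  (gi phi psi - inner v psi) ^+ 2 <= 2 * e * gi psi psi.
Proof.
move=> [Hp p0] hmin [Hs s0]; have Lp := H1_L2 Hp; have Ls := H1_L2 Hs.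
(* Twice the almost-minimality inequality along phi + t psi is a nonnegative quadratic in t with
   constant term 2 e. *)
apply: discriminant_le0 => t.
have Hts := H1Z oO bO t Hs.
have := hmin (fun x => phi x + t * psi x).
have Vt : V (fun x => phi x + t * psi x).
  by split; [exact: H1D|apply: L20D => //; exact: L20Z].
move=> /(_ Vt); rewrite /J giDl//; last exact: H1D.
rewrite !giDr// !giZl// !giZr// (giC Omega psi phi).
by rewrite innerDr//; [rewrite innerZr//; lra|exact: L2Z].
Qed.

(** Two almost Euler-Lagrange equations give |grad (p k.+1 - p k)|^2 <= 8 [small k]. The factor 1 +
    K leaves room for Poincare, so functions and gradients both reach the rate 2^-k 2^-k asked by
    [sqint_complete]. *)
Let small (k : nat) : R := 4^-1 ^+ k / (8 * (1 + K)).

Let small0 k : 0 < small k.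
Proof. by rewrite divr_gt0// ?exprn_gt0 ?invr_gt0// mulr_gt0// ltr_pwDl. Qed.

(** The direct method. Completeness of L^2 is applied to a minimizing sequence and to each component
    of its gradients separately; the limits [Z] of the gradients are then recognized as a weak
    gradient of the limit [z]. *)
Lemma neg_inv_lap_exists : exists z, is_neg_inv_lap Omega v z.
Proof.
have /boolp.choice[p hp] : forall k : nat, exists phi, V phi /\ forall psi, V psi -> J phi <= J psi + small k.
  by move=> k; have [phi] := minimizing (small0 k); exists phi.
have Vp k : V (p k) by have [] := hp k.
have EL k psi : V psi -> (gi (p k) psi - inner v psi) ^+ 2 <= 2 * small k * gi psi psi.
  by move=> Vs; have [? ?] := hp k; exact: almost_EL.
have Hp k : H1 (p k) by case: (Vp k).
have Lp k : L2 (p k) by exact: H1_L2.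
have smallS k : small k.+1 <= small k.
  rewrite /small ler_pM2r ?invr_gt0 ?mulr_gt0// ?ltr_pwDl//.
  by rewrite exprS ler_piMl ?exprn_ge0 ?invr_ge0// invf_le1// ler1n.
pose d k := (fun x => p k.+1 x - p k x).
have Vd k : V (d k).
  by have [? ?] := Vp k.+1; have [? ?] := Vp k; split; [exact: H1B|exact: L20B].
have gd k : (1 + K) * gi (d k) (d k) <= 2^-1 ^+ k * 2^-1 ^+ k.
  have g0 := gi_ge0 Omega (d k).
  have h1 := EL k.+1 _ (Vd k); have h2 := EL k _ (Vd k); have sS := smallS k.
  have gE : gi (d k) (d k) = (gi (p k.+1) (d k) - inner v (d k)) - (gi (p k) (d k) - inner v (d k)).
    by rewrite {1}/d giBl//; [ring|case: (Vd k)].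
  move: gE h1 h2; set g := gi (d k) (d k) in g0 *; set a := _ - inner _ _; set b := _ - inner _ _.
  move=> gE h1 h2.
  have h3 : g ^+ 2 <= 8 * small k * g.
    rewrite {1}gE; have := sqr_ge0 (a + b); have : 2 * small k.+1 * g <= 2 * small k * g by nra.
    by clearbody a b g; nra.
  have h4 : g <= 8 * small k.
    have [g1|] := ltP 0 g; first by rewrite -(ler_pM2r g1) -expr2.
    by move=> /le_trans; apply; rewrite mulr_ge0// ltW.
  apply: (@le_trans _ _ ((1 + K) * (8 * small k))).
    by rewrite ler_wpM2l// addr_ge0.
  rewrite /small -exprMn -invfM -natrM; have K1 : 1 + K != 0 by rewrite gt_eqF// ltr_pwDl.
  by rewrite le_eqVlt; apply/orP; left; apply/eqP; field.
have cp k : inner (d k) (d k) <= 2^-1 ^+ k * 2^-1 ^+ k.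
  have [Hd d0] := Vd k; apply: le_trans (gd k); apply: le_trans (poincare Hd d0) _.
  by rewrite ler_wpM2r ?gi_ge0// lerDr.
have mO := measurable_Omega oO.
have [z Sz hz] := sqint_complete mO (fun k => proj1 (L2P oO _) (Lp k)) cp.
have Lz : L2 z by apply/L2P.
have Lg k i : L2 (grad (p k) i) by exact: L2_grad.
have cg i k : inner (fun x => grad (p k.+1) i x - grad (p k) i x) (fun x => grad (p k.+1) i x - grad (p k) i x)
    <= 2^-1 ^+ k * 2^-1 ^+ k.
  apply: le_trans (gd k); apply: (@le_trans _ _ (gi (d k) (d k))); last first.
    by rewrite ler_peMl ?gi_ge0// lerDl.
  have Hd : H1 (d k) by case: (Vd k).
  pose D i := (fun x => grad (p k.+1) i x - grad (p k) i x).
  have wD : is_weak_gradient Omega (d k) D.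
    have := weak_gradientD oO bO (Lp k.+1) (L2Z (-1) (Lp k)) (gradP (Hp k.+1)) (weak_gradientZ oO bO (-1) (Lp k) (gradP (Hp k))).
    have -> : (fun x => p k.+1 x + -1 * p k x) = d k by apply/funext => x; rewrite mulN1r.
    by rewrite /D; under eq_fun do under eq_fun do rewrite mulN1r.
  have LD j : L2 (D j) by exact: L2B.
  rewrite (gi_grad oO bO Hd (H1_L2 Hd) _ wD Hd); last exact: aeW.
  have -> : vinner D (grad (d k)) = vinner D D.
    rewrite vinnerC; apply: (vinner_ae oO) => //; first exact: L2_grad.
    by apply: (grad_ae oO bO Hd (H1_L2 Hd) _ wD); exact: aeW.
  rewrite /Defs.vinner (bigD1 i)//= lerDl; apply: sumr_ge0 => j _; exact: inner_ge0.
have /boolp.choice[Z hZ] : forall i, exists Zi, L2 Zi /\ forall k,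
    inner (fun x => Zi x - grad (p k) i x) (fun x => Zi x - grad (p k) i x) <= 4 * 2^-1 ^+ k.
  move=> i; have [Zi SZi hZi] := sqint_complete mO (fun k => proj1 (L2P oO _) (Lg k i)) (cg i).
  by exists Zi; split => //; apply/L2P.
have LZ i : L2 (Z i) by case: (hZ i).
have lim0 (a b : R) : 0 <= b -> (forall k : nat, a ^+ 2 <= b * 2^-1 ^+ k) -> a = 0.
  move=> b0 hk; apply/eqP; rewrite -sqrf_eq0 eq_le sqr_ge0 andbT.
  have cv : (fun k : nat => b * 2^-1 ^+ k) @ \oo --> b * (0 : R).
    apply: cvgM; first exact: cvg_cst.
    by apply: cvg_expr; rewrite ger0_norm ?invr_ge0// invf_lt1// ltr1n.
  rewrite mulr0 in cv; rewrite -(cvg_lim _ cv)//.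
  by apply: limr_ge; [apply/cvg_ex; exists 0|exact: nearW].
have half0 k : (0 : R) <= 2^-1 ^+ k by rewrite exprn_ge0// invr_ge0.
have wZ : is_weak_gradient Omega z Z.
  move=> i; split => // phi tphi; have Lphi := L2_test oO bO tphi; have Ldphi := L2_partial_test oO bO i tphi.
  apply/eqP; rewrite -subr_eq0 opprK; apply/eqP.
  apply: (lim0 _ (8 * (inner (partial i phi) (partial i phi) + inner phi phi))).
    by rewrite mulr_ge0// addr_ge0// inner_ge0.
  move=> k; have [_ hk] := gradP (Hp k) i; have e0 := hk _ tphi.
  have Lzk := L2B Lz (Lp k); have LZk := L2B (LZ i) (Lg k i).
  (* The pair [p k], [grad (p k)] satisfies the weak identity exactly; subtracting it leaves two
     pairings that vanish as k grows. *)
  have -> : inner z (partial i phi) + inner (Z i) phi = inner (fun x => z x - p k x) (partial i phi)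
      + inner (fun x => Z i x - grad (p k) i x) phi.
    by rewrite !innerBl// e0; ring.
  have c1 := inner_CS oO Lzk Ldphi; have c2 := inner_CS oO LZk Lphi.
  have [_ /(_ k) h2] := hZ i; have h1 := hz k.
  have i1 := inner_ge0 Omega (partial i phi); have i2 := inner_ge0 Omega phi.
  move: c1 c2 h1 h2 i1 i2; rewrite -/(inner _ _).
  set a := inner _ (partial i phi); set b := inner _ phi; set A := inner (partial i phi) _; set B := inner phi _.
  set X := inner _ _; set Y := inner _ _ => c1 c2 h1 h2 i1 i2; have hk0 := half0 k.
  have h3 : X * A <= 4 * 2^-1 ^+ k * A by rewrite ler_wpM2r.
  have h4 : Y * B <= 4 * 2^-1 ^+ k * B by rewrite ler_wpM2r.
  have := sqr_ge0 (a - b); clearbody a b A B X Y; nra.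
have Hz : H1 z by split => //; exists Z.
have ELz phi : V phi -> gi z phi = inner v phi.
  move=> Vphi; have [Hphi _] := Vphi; have Lphi := H1_L2 Hphi.
  have Lgp i : L2 (grad phi i) by exact: L2_grad.
  apply/eqP; rewrite -subr_eq0; apply/eqP.
  apply: (lim0 _ ((8 * n%:R + 4) * gi phi phi)).
    by rewrite mulr_ge0 ?gi_ge0// addr_ge0// mulr_ge0.
  move=> k; have Hzk := H1B oO bO Hz (Hp k).
  have zE i : grad (fun x => z x - p k x) i = (fun x => Z i x - grad (p k) i x) %[ae mu in Omega].
    have := weak_gradientD oO bO Lz (L2Z (-1) (Lp k)) wZ (weak_gradientZ oO bO (-1) (Lp k) (gradP (Hp k))).
    have -> : (fun x => z x + -1 * p k x) = (fun x => z x - p k x) by apply/funext => x; rewrite mulN1r.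
    under [fun i x => _ + -1 * _]eq_fun do under eq_fun do rewrite mulN1r.
    by move=> /(grad_ae oO bO Hzk (H1_L2 Hzk)); apply; exact: aeW.
  have gz : gi (fun x => z x - p k x) (fun x => z x - p k x) <= n%:R * (4 * 2^-1 ^+ k).
    rewrite giE /Defs.vinner; apply: (@le_trans _ _ (\sum_(i < n) (4 * 2^-1 ^+ k))); last first.
      by rewrite sumr_const card_ord -[leLHS]mulr_natl.
    apply: ler_sum => i _; have [_ /(_ k) h2] := hZ i; apply: le_trans h2.
    have LZk := L2B (LZ i) (Lg k i); have Lgz := L2_grad Hzk i.
    by rewrite (inner_ae oO Lgz LZk Lgz (zE i)) (inner_aer oO Lgz LZk LZk (zE i)).
  have c1 := gi_CS oO bO Hzk Hphi; have c2 := EL k _ Vphi.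
  have g0 := gi_ge0 Omega phi.
  have s1 : small k <= 2^-1 ^+ k.
    rewrite /small ler_pdivrMr ?mulr_gt0// ?ltr_pwDl//.
    apply: (@le_trans _ _ (2^-1 ^+ k)).
      by rewrite lerXn2r ?nnegrE ?invr_ge0// lef_pV2 ?posrE// ler_nat.
    by rewrite ler_peMr//; move: K0; lra.
  have -> : gi z phi - inner v phi = gi (fun x => z x - p k x) phi + (gi (p k) phi - inner v phi).
    by rewrite giBl//; ring.
  move: c1 c2 gz; set a := gi _ phi; set b := _ - inner _ _; set X := gi _ _; set B := gi phi phi in g0 *.
  move=> c1 c2 gz; have hk0 := half0 k.
  have h3 : X * B <= n%:R * (4 * 2^-1 ^+ k) * B by rewrite ler_wpM2r.
  have h4 : small k * B <= 2^-1 ^+ k * B by rewrite ler_wpM2r.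
  have := sqr_ge0 (a - b); clearbody a b B X; nra.
have z0 : L20 z.
  apply/L20P; split => //; apply: (lim0 _ (4 * inner one one)).
    by rewrite mulr_ge0// inner_ge0.
  move=> k; have [_ /L20P[_ pk0]] := Vp k.
  rewrite -[inner z one]subr0 -pk0 -innerBl//.
  have := inner_CS oO (L2B Lz (Lp k)) (L2c 1); move/le_trans; apply.
  by rewrite mulrAC ler_wpM2r ?inner_ge0//; exact: hz.
exists z; split => //; split => //.
  by have := L2Z (-1) Lv; under eq_fun do rewrite mulN1r.
move=> phi Hphi; have Lphi := H1_L2 Hphi; rewrite innerNl// opprK -giE.
(* [ELz] covers mean-zero test functions only. Removing the mean changes neither the gradient nor
   the pairing with v. Should the constant 1 have norm 0, its pairings vanish by Cauchy-Schwarz. *)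
pose m := inner phi one / inner one one.
have Vm : V (fun x => phi x - m).
  split; first by apply: H1B => //; exact: H1_cst.
  apply/L20P; split; first by apply: L2B => //; exact: L2c.
  rewrite innerBl//; try exact: L2c.
  have -> : inner (fun=> m) one = m * inner one one.
    by rewrite -innerZl//; apply: eq_Rintegral => x _; rewrite !mulr1.
  have [q0|q0] := eqVneq (inner one one) 0; last by rewrite /m divfK// subrr.
  by rewrite q0 mulr0 subr0 innerC; apply: L2_norm0 => //; exact: L2c.
have Hm : H1 (fun=> m) by exact: H1_cst.
have := ELz _ Vm; rewrite giBr// (giC _ z (fun=> m)) gi_cst// subr0 => ->.
rewrite innerBr//.
suff -> : inner v (fun=> m) = 0 by rewrite subr0.
have [_ v1] := (L20P v).1 v0.
transitivity (m * inner v one); last by rewrite v1 mulr0.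
by rewrite -innerZr//; apply: eq_Rintegral => x _; rewrite mulr1.
Qed.

End riesz.

Notation N := (inv_laplacian Omega).
Notation sqm := (dual_sqr Omega).

Lemma dual_sqrE v : normm1 Omega v ^+ 2 = sqm v.
Proof. by rewrite dual_sqr.unlock. Qed.

Lemma inv_laplacianP v : L20 v -> is_neg_inv_lap Omega v (N v).
Proof.
by move=> v0; rewrite inv_laplacian.unlock; apply: (xgetPex _ (neg_inv_lap_exists v0)).
Qed.

Lemma H1_N v : L20 v -> H1 (N v). Proof. by move=> /inv_laplacianP[]. Qed.
Lemma gi_N v phi : L20 v -> H1 phi -> gi (N v) phi = inner v phi.
Proof.
move=> v0 Hphi; have [_ _ [_ _ /(_ _ Hphi)]] := inv_laplacianP v0; rewrite giE => ->.
by rewrite innerNl ?opprK//; [case: v0|exact: H1_L2].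
Qed.

Lemma inner_N_sym v w : L20 v -> L20 w -> inner v (N w) = inner w (N v).
Proof.
by move=> v0 w0; rewrite -(gi_N v0) ?(giC _ (N v)) ?gi_N//; exact: H1_N.
Qed.

Lemma dual_sqr_inner v : L20 v -> sqm v = inner v (N v).
Proof.
move=> v0; have h : 0 <= inner v (N v).
  by rewrite -gi_N ?gi_ge0//; exact: H1_N.
by move: h; rewrite inv_laplacian.unlock dual_sqr.unlock => h; rewrite sqr_sqrtr.
Qed.

Lemma dual_sqr_ge0 v : 0 <= sqm v. Proof. by rewrite dual_sqr.unlock sqr_ge0. Qed.

Lemma inner0l w : inner (fun=> 0) w = 0.
Proof.
rewrite /Defs.inner; under eq_Rintegral do rewrite mul0r.
by rewrite Rintegral_cst ?mul0r//; exact: measurable_Omega.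
Qed.

(** Here (v, phi) is the Dirichlet product of N v and phi. The case phi = v is the interpolation of
    L^2 between H^{-1} and H^1. *)
Lemma dual_CS v phi : L20 v -> H1 phi -> inner v phi ^+ 2 <= sqm v * gi phi phi.
Proof.
move=> v0 Hphi; have Hv := H1_N v0.
by rewrite dual_sqr_inner// -!gi_N//; exact: gi_CS.
Qed.

Lemma dual_sqr_polar a b : L20 a -> L20 b ->
  inner (fun x => a x - b x) (N a) =
  2^-1 * (sqm a - sqm b + sqm (fun x => a x - b x)).
Proof.
move=> a0 b0; have ab0 := L20B a0 b0; have [La _] := a0; have [Lb _] := b0.
have LN v : L20 v -> L2 (N v) by move=> /H1_N /H1_L2.
have LNa := LN _ a0; have LNb := LN _ b0; have LNab := LN _ ab0.
rewrite (dual_sqr_inner a0) (dual_sqr_inner b0) (dual_sqr_inner ab0).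
rewrite (innerBl oO La Lb LNab) (inner_N_sym a0 ab0) (inner_N_sym b0 ab0).
rewrite (innerBl oO La Lb LNa) (innerBl oO La Lb LNb) (inner_N_sym b0 a0).
by move: (inner a (N a)) (inner a (N b)) (inner b (N b)) => p q r; field.
Qed.

Lemma dual_sqr_ae0 v : L20 v -> v = (fun=> 0) %[ae mu in Omega] -> sqm v = 0.
Proof.
move=> v0 v00; have [Lv _] := v0; have LN := H1_L2 (H1_N v0).
by rewrite (dual_sqr_inner v0) (inner_ae oO Lv (L2c 0) LN v00) inner0l.
Qed.

Lemma neumann_laplacian_weak v z phi : neumann_laplacian Omega v z -> H1 phi ->
  gi v phi = - inner z phi.
Proof. by move=> [_ _ h] Hphi; rewrite giE; exact: h. Qed.

(** Test with the constant 1, whose gradient vanishes. This is mass conservation, for u_t as well as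
    for the increments of the scheme. *)
Lemma neumann_laplacian_L20 v z : neumann_laplacian Omega v z -> L20 z.
Proof.
move=> h; have [Hv Lz _] := h; apply/L20P; split; first exact: Lz.
have := neumann_laplacian_weak h (H1_cst oO bO 1); rewrite giC gi_cst//.
by move=> /esym/eqP; rewrite oppr_eq0 => /eqP.
Qed.

(* The weak form of z = Delta (- eps Delta v + s / eps) tested with - Delta^-1 e. *)
Lemma chemical_potential_weak eps v s w z e :
  neumann_laplacian Omega w z -> chemical_potential Omega eps v s w ->
  L2 s -> H1 e -> L20 e ->
  inner z (N e) = - (eps * gi v e + eps^-1 * inner s e).
Proof.
move=> hw [y hy wE] Ls He e0; have Le := H1_L2 He; have [Hw Lz _] := hw; have [Hv Ly _] := hy.
have -> : inner z (N e) = - gi w (N e).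
  by rewrite (neumann_laplacian_weak hw) ?opprK//; exact: H1_N.
rewrite giC gi_N// innerC.
have Lw := H1_L2 Hw; have L1 := L2Z (- eps) Ly; have L3 := L2Z eps^-1 Ls.
rewrite (inner_ae oO Lw (L2D L1 L3) Le wE) innerDl// !innerZl//.
by rewrite (neumann_laplacian_weak hy He); ring.
Qed.

End inverse_laplacian.

(** * The cubic Gagliardo-Nirenberg bound *)

Section gagliardo_nirenberg.
Variables (R : realType) (n : nat) (Omega : set 'rV[R]_n).
Notation E := ('rV[R]_n).
Notation mu := (lebesgue_rV R n).
Hypothesis oO : open Omega.
Hypothesis bO : bounded_set Omega.
Implicit Types (v w z phi : E -> R).
Notation inner := (@inner R n Omega).
Notation H1 := (@H1 R n Omega).
Notation L20 := (@L20 R n Omega).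
Notation gi := (@dirichlet R n Omega).
Variable K : R.
Hypothesis poincare : forall v, H1 v -> L20 v -> inner v v <= K * gi v v.
Hypothesis K0 : 0 <= K.

Lemma powR_expn (a x : R) (k m : nat) : 0 <= a -> x * k%:R = m%:R -> (a `^ x) ^+ k = a ^+ m.
Proof. by move=> a0 xk; rewrite -powR_mulrn ?powR_ge0// -powRrM xk powR_mulrn. Qed.

Lemma Lnorm3_cube v (B : R) : Defs.L2 Omega v ->
  ('N[mu]_(3%:E)[EFin \o (v \_ Omega)] <= B%:E)%E ->
  [/\ 0 <= B, mu.-integrable Omega (EFin \o (fun x => `|v x| ^+ 3)) &
      (\int[mu]_(x in Omega) `|v x| ^+ 3) <= B ^+ 3].
Proof.
move=> Lv; have mO := measurable_Omega oO; have [mv _] := (L2P oO v).1 Lv.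
rewrite unlock /=.
have -> : (\int[mu]_x (`|((v \_ Omega) x)%:E| `^ 3)%E = \int[mu]_(x in Omega) (`|v x| ^+ 3)%:E)%E.
  rewrite [RHS]integral_mkcond; apply: eq_integral => x _.
  rewrite !patchE; case: ifP => _.
    by rewrite /= -[3]/(3%:R) powR_mulrn.
  by rewrite /= normr0 powR0// gt_eqF.
set I := integral _ _ _ => hB.
have I0 : (0 <= I)%E by apply: integral_ge0 => x _; rewrite lee_fin exprn_ge0.
have Ify : (I < +oo)%E.
  apply: (@lty_poweRy _ _ 3^-1); first by rewrite invr_neq0.
  exact: le_lt_trans hB (ltry _).
have If : I \is a fin_num by rewrite ge0_fin_numE.
have Tge : 0 <= fine I by exact: fine_ge0.
move: hB; rewrite -(fineK If) poweR_EFin lee_fin => hB.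
have B0 : 0 <= B by apply: le_trans hB; exact: powR_ge0.
split => //.
  apply/integrableP; split.
    by apply/measurable_EFinP; apply: measurable_funX; exact: measurableT_comp.
  by under eq_integral do rewrite /= ger0_norm ?exprn_ge0//.
have e3 : (fine I `^ 3^-1) ^+ 3 = fine I by rewrite (@powR_expn _ _ 3 1)//; rewrite mulVf.
rewrite -[leLHS]/(fine I) -e3.
by rewrite lerXn2r ?nnegrE ?powR_ge0.
Qed.

Hypothesis hn : n = 2%N \/ n = 3%N.
Hypothesis GN : forall p : R, 2 <= p -> (n%:R - 2) * p <= 2 * n%:R ->
  let theta := n%:R * (2^-1 - p^-1) in
  exists C : R, forall v, H1 v ->
    ('N[mu]_(p%:E)[EFin \o (v \_ Omega)] <=
     (C * (L2norm Omega v `^ (1 - theta) * H1norm Omega v `^ theta))%:E)%E.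

(** For p = 3, theta = d/6 is 1/3 or 1/2, and the 12th power of the L^3 norm clears the fractions:
    it is bounded by a^8 h^4 for d = 2 and a^6 h^6 for d = 3, with a the L^2 and h the H^1 norm. For
    d = 2, Poincare trades a^2 for the squared gradient norm, so both cases end in the same form. *)
Lemma cubic_bound : exists2 C : R, 0 <= C & forall v, H1 v -> L20 v ->
  mu.-integrable Omega (EFin \o (fun x => `|v x| ^+ 3)) /\
  (\int[mu]_(x in Omega) `|v x| ^+ 3) ^+ 4 <= C * (inner v v ^+ 3 * gi v v ^+ 3).
Proof.
have [C hC] := GN (p := 3) ltac:(by rewrite ler_nat) ltac:(by case: hn => ->; lra).
have C12 : 0 <= C ^+ 12 by exact: exprn_even_ge0.
exists (C ^+ 12 * ((1 + K) ^+ 2 * (1 + K))).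
  by rewrite mulr_ge0// mulr_ge0 ?sqr_ge0// addr_ge0.
move=> v Hv v0; have := hC v Hv; move/(Lnorm3_cube (H1_L2 Hv)) => [B0 iv hT]; split => //.
have T0 : 0 <= \int[mu]_(x in Omega) `|v x| ^+ 3 by apply: Rintegral_ge0 => x _; rewrite exprn_ge0.
move: hT B0 T0; set T := Rintegral _ _ _; set th := n%:R * _.
set a := L2norm _ _; set h := H1norm _ _ => hT B0 T0.
have a0 : 0 <= a by exact: sqrtr_ge0.
have h0 : 0 <= h by exact: sqrtr_ge0.
have a2 : a ^+ 2 = inner v v by exact: L2normE.
have g0 := gi_ge0 Omega v; have i0 := inner_ge0 Omega v; have hP := poincare Hv v0.
have h2 : h ^+ 2 = inner v v + gi v v.
  by rewrite sqr_sqrtr ?addr_ge0 ?sqr_ge0// L2normE vL2normE giE.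
have h2' : h ^+ 2 <= (1 + K) * gi v v by rewrite h2; lra.
apply: (@le_trans _ _ ((C * (a `^ (1 - th) * h `^ th)) ^+ 12)).
  by rewrite -[12%N]/(3 * 4)%N exprM lerXn2r ?nnegrE// exprn_ge0.
rewrite !exprMn -mulrA ler_wpM2l//.
have K1 : 0 <= 1 + K by rewrite addr_ge0.
move: (gi v v) (inner v v) => g i in g0 i0 hP a2 h2 h2' *.
case: hn => n2.
  rewrite (@powR_expn a _ 12 8)//; last by rewrite /th n2; field.
  rewrite (@powR_expn h _ 12 4)//; last by rewrite /th n2; field.
  rewrite (@exprM _ a 2 4) (@exprM _ h 2 2) a2.
  apply: (@le_trans _ _ ((K * g) * i ^+ 3 * ((1 + K) * g) ^+ 2)).
    apply: ler_pM; rewrite ?exprn_ge0// ?sqr_ge0//.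
      by rewrite exprS ler_wpM2r// exprn_ge0.
    by rewrite lerXn2r ?nnegrE ?sqr_ge0// mulr_ge0.
  have -> : K * g * i ^+ 3 * ((1 + K) * g) ^+ 2 = K * ((1 + K) ^+ 2 * (i ^+ 3 * g ^+ 3)) by ring.
  rewrite [leRHS](_ : _ = (1 + K) * ((1 + K) ^+ 2 * (i ^+ 3 * g ^+ 3))); last by ring.
  by rewrite ler_wpM2r ?mulr_ge0 ?exprn_ge0// lerDr.
rewrite (@powR_expn a _ 12 6)//; last by rewrite /th n2; field.
rewrite (@powR_expn h _ 12 6)//; last by rewrite /th n2; field.
rewrite (@exprM _ a 2 3) (@exprM _ h 2 3) a2.
rewrite [leRHS](_ : _ = i ^+ 3 * ((1 + K) * g) ^+ 3); last by ring.
by rewrite ler_wpM2l ?exprn_ge0// lerXn2r ?nnegrE ?sqr_ge0// mulr_ge0.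
Qed.

End gagliardo_nirenberg.

(** * The nonlinearity *)

Section mean_value.
Variables (R : realType) (g : R -> R).
Hypothesis dg : forall x, derivable g x 1.

Lemma mean_value a b : exists2 c, `|c - a| <= `|b - a| & g b - g a = (derive1 g) c * (b - a).
Proof.
have cg : continuous g by move=> x; apply: differentiable_continuous; exact/derivable1_diffP.
have dgx x : is_derive x (1 : R) g ((derive1 g) x) by apply: DeriveDef; rewrite ?derive1E.
have [ab|ba|->] := ltgtP a b.
- have [c cab e] := MVT ab (fun x _ => dgx x) (continuous_subspaceT cg).
  exists c => //; move: cab; rewrite in_itv/= => /andP[h1 h2].
  by rewrite !ger0_norm ?subr_ge0 ?(ltW ab) ?(ltW h1)// lerD2r ltW.
- have [c cab e] := MVT ba (fun x _ => dgx x) (continuous_subspaceT cg).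
  exists c; last by rewrite -opprB e -mulrN opprB.
  move: cab; rewrite in_itv/= => /andP[h1 h2].
  by rewrite !ler0_norm ?subr_le0 ?(ltW ba) ?(ltW h2)// lerN2 lerD2r ltW.
- by exists b; rewrite ?subrr ?mulr0.
Qed.

Lemma bounded_derive_lipschitz L : (forall x, `|(derive1 g) x| <= L) ->
  forall a b, `|g b - g a| <= L * `|b - a|.
Proof. by move=> hL a b; have [c _ ->] := mean_value a b; rewrite normrM ler_wpM2r. Qed.

End mean_value.

(** The mean value theorem for g and for its derivative: the intermediate point is no further from a
    than b is. *)
Lemma taylor_order1 (R : realType) (g : R -> R) L :
  (forall x, derivable g x 1) -> (forall x, derivable (derive1 g) x 1) ->
  (forall x, `|derive1 (derive1 g) x| <= L) ->
  forall a b, `|g b - g a - (derive1 g) a * (b - a)| <= L * (b - a) ^+ 2.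
Proof.
move=> dg ddg hL a b; have [c hc ->] := mean_value dg a b.
rewrite -mulrBl normrM -[(b - a) ^+ 2]real_normK ?num_real// expr2 mulrA ler_wpM2r//.
apply: le_trans (bounded_derive_lipschitz ddg hL _ _) _.
by rewrite ler_wpM2l// (le_trans _ (hL 0)).
Qed.

(** b - a - P/(2a) equals (b^2 - a^2 - P - (b - a)^2)/(2a), and (b - a)^2 is (b^2 - a^2)^2/(b + a)^2
    with b + a >= s. Here a and b stand for square roots of energies and P for the derivative of the
    energy. *)
Lemma sqrt_taylor (R : realFieldType) (a b s L m D P : R) :
  0 < s -> s <= a -> s <= b -> 0 <= L -> 0 <= m -> 0 <= D ->
  `|b ^+ 2 - a ^+ 2 - P| <= L * D -> (b ^+ 2 - a ^+ 2) ^+ 2 <= L ^+ 2 * m * D ->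
  `|b - a - 2^-1 * (P / a)| <= (L + L ^+ 2 * m / s ^+ 2) / s * D.
Proof.
move=> s0 sa sb L0 m0 D0 h1 h2.
have a0 : 0 < a by exact: lt_le_trans sa.
have -> : b - a - 2^-1 * (P / a) = ((b ^+ 2 - a ^+ 2 - P) - (b - a) ^+ 2) / (2 * a).
  by field; rewrite gt_eqF.
rewrite normrM normfV [`|2 * a|]gtr0_norm ?mulr_gt0// ler_pdivrMr ?mulr_gt0//.
apply: le_trans (ler_normB _ _) _.
rewrite [`|(b - a) ^+ 2|]ger0_norm ?sqr_ge0//.
have h3 : (b - a) ^+ 2 <= L ^+ 2 * m * D / s ^+ 2.
  rewrite ler_pdivlMr ?exprn_gt0//; apply: le_trans h2.
  have -> : b ^+ 2 - a ^+ 2 = (b - a) * (b + a) by ring.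
  rewrite exprMn ler_wpM2l ?sqr_ge0// lerXn2r ?nnegrE ?(ltW s0)//; lra.
apply: (@le_trans _ _ (L * D + L ^+ 2 * m * D / s ^+ 2)); first by rewrite lerD.
have -> : L * D + L ^+ 2 * m * D / s ^+ 2 = (L + L ^+ 2 * m / s ^+ 2) / s * D * s.
  by field; rewrite gt_eqF.
apply: ler_wpM2l; last by lra.
by rewrite mulr_ge0// divr_ge0 ?(ltW s0)// addr_ge0// divr_ge0 ?sqr_ge0// mulr_ge0 ?sqr_ge0.
Qed.

Section nonlinearity.
Variables (R : realType) (n : nat) (Omega : set 'rV[R]_n).
Notation E := ('rV[R]_n).
Notation mu := (lebesgue_rV R n).
Hypothesis oO : open Omega.
Hypothesis bO : bounded_set Omega.
Implicit Types (v w z e U V : E -> R).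
Notation L2 := (@L2 R n Omega).
Notation inner := (@inner R n Omega).
Notation one := (fun=> 1 : R).
Let mO := measurable_Omega oO.

Lemma L2_measurable v : L2 v -> measurable_fun Omega v.
Proof. by move=> /(L2P oO)[]. Qed.

Lemma L2_dom v z : measurable_fun Omega v -> (forall x, Omega x -> `|v x| <= `|z x|) ->
  L2 z -> L2 v.
Proof.
move=> mv vz /(L2P oO)[mz iz]; apply/(L2P oO); split => //.
apply: (le_integrable mO _ _ iz); first by apply/measurable_EFinP; exact: measurable_funX.
by move=> x Ox /=; rewrite lee_fin !normrX lerXn2r ?nnegrE// vz.
Qed.

Lemma L2_norm z : L2 z -> L2 (fun x => `|z x|).
Proof.
move=> Lz; apply: (L2_dom _ _ Lz); last by move=> x _; rewrite normr_id.
by apply: measurableT_comp => //; exact: L2_measurable.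
Qed.

Lemma L2_integrableM v w : L2 v -> L2 w -> mu.-integrable Omega (EFin \o (fun x => v x * w x)).
Proof. by move=> /(L2P oO) Sv /(L2P oO) Sw; exact: sqint_mul. Qed.

Lemma inner_le v w v' w' : L2 v -> L2 w -> L2 v' -> L2 w' ->
  (forall x, Omega x -> v x * w x <= v' x * w' x) -> inner v w <= inner v' w'.
Proof. by move=> *; apply: le_Rintegral => //; exact: L2_integrableM. Qed.

Lemma inner_dom v z k : L2 v -> L2 z -> 0 <= k ->
  (forall x, Omega x -> `|v x| <= k * `|z x|) -> inner v v <= k ^+ 2 * inner z z.
Proof.
move=> Lv Lz k0 vz; have Lkz := L2Z oO k Lz.
have -> : k ^+ 2 * inner z z = inner (fun x => k * z x) (fun x => k * z x).
  by rewrite innerZl// innerZr// mulrA -expr2.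
apply: inner_le => // x Ox; rewrite -!expr2 -[v x ^+ 2]real_normK ?num_real//.
rewrite -[(k * z x) ^+ 2]real_normK ?num_real// lerXn2r ?nnegrE// normrM (ger0_norm k0).
exact: vz.
Qed.

Variables (F : R -> R) (L c0 : R).
Notation f := (derive1 F).
Hypothesis dF : forall x, derivable F x 1.
Hypothesis df : forall x, derivable f x 1.
Hypothesis ddf : forall x, derivable (derive1 f) x 1.
Hypothesis F0 : forall x, 0 <= F x.
Hypothesis L0 : 0 <= L.
Hypothesis f_le : forall x, `|f x| <= L.
Hypothesis f'_le : forall x, `|(derive1 f) x| <= L.
Hypothesis f''_le : forall x, `|derive1 (derive1 f) x| <= L.
Hypothesis c00 : 0 < c0.

Let derivable_measurable (g : R -> R) v : (forall x, derivable g x 1) ->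
  L2 v -> measurable_fun Omega (fun x => g (v x)).
Proof.
move=> dg Lv; apply: (@measurableT_comp _ _ _ _ _ _ g); last exact: L2_measurable.
apply: continuous_measurable_fun => x.
by apply: differentiable_continuous; exact/derivable1_diffP.
Qed.

Lemma L2_f v : L2 v -> L2 (fun x => f (v x)).
Proof.
move=> Lv; apply: (L2_bounded oO bO (C := L)) => [|x _]; last exact: f_le.
exact: (derivable_measurable df Lv).
Qed.

Lemma L2_f'M v w : L2 v -> L2 w -> L2 (fun x => (derive1 f) (v x) * w x).
Proof.
move=> Lv Lw; apply: (L2_dom _ _ (L2Z oO L Lw)).
  by apply: measurable_funM; [exact: (derivable_measurable ddf Lv)|exact: L2_measurable].
by move=> x _; rewrite !normrM ler_wpM2r// (ger0_norm L0).
Qed.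

Lemma L2_F v : L2 v -> L2 (fun x => F (v x)).
Proof.
move=> Lv; apply: (@L2_dom _ (fun x => F 0 + L * `|v x|)).
- exact: (derivable_measurable dF Lv).
- move=> x _; rewrite [leRHS]ger0_norm ?addr_ge0// ?mulr_ge0//.
  have := bounded_derive_lipschitz dF f_le 0 (v x); rewrite subr0 => h.
  by rewrite -[F (v x)](subrK (F 0)) (le_trans (ler_normD _ _))// addrC (ger0_norm (F0 0)) lerD2l.
- by apply: L2D => //; [exact: L2_cst|apply: L2Z => //; exact: L2_norm].
Qed.

Notation I v := (\int[mu]_(x in Omega) F (v x) + c0).
Notation vol := (inner one one).

Let L2one : L2 one. Proof. exact: L2_cst. Qed.

Lemma energy_ge v : c0 <= I v.
Proof. by rewrite lerDr; apply: Rintegral_ge0. Qed.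

Lemma sqrt_energy_ge v : Num.sqrt c0 <= Num.sqrt (I v).
Proof. by rewrite ler_wsqrtr// energy_ge. Qed.

Let sc0 : 0 < Num.sqrt c0. Proof. by rewrite sqrtr_gt0. Qed.

Lemma sav_gE w : sav_g Omega F c0 w = (fun x => (Num.sqrt (I w))^-1 * f (w x)).
Proof. by apply/funext => x; rewrite /sav_g mulrC. Qed.

Lemma L2_sav_g w : L2 w -> L2 (sav_g Omega F c0 w).
Proof. by move=> Lw; rewrite sav_gE; apply: L2Z => //; exact: L2_f. Qed.

Lemma energy_diff v w : L2 v -> L2 w ->
  `|I v - I w - inner (fun x => f (w x)) (fun x => v x - w x)| <=
    L * inner (fun x => v x - w x) (fun x => v x - w x) /\
  (I v - I w) ^+ 2 <= L ^+ 2 * vol * inner (fun x => v x - w x) (fun x => v x - w x).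
Proof.
move=> Lv Lw; have Ld := L2B oO Lv Lw; have LFv := L2_F Lv; have LFw := L2_F Lw.
have Lfw := L2_f Lw.
have E1 : I v - I w = inner one (fun x => F (v x) - F (w x)).
  rewrite innerBr// ![inner one _]innerC -!int_inner1; ring.
rewrite E1; split.
  rewrite ler_norml; have Lp := L2Z oO L Ld.
  have E2 : L * inner (fun x => v x - w x) (fun x => v x - w x) =
      inner (fun x => L * (v x - w x)) (fun x => v x - w x) by rewrite innerZl.
  have LP : L2 (fun x => F (v x) - F (w x)) by exact: L2B.
  have iP := L2_integrableM L2one LP; have if' := L2_integrableM Lfw Ld.
  have E3 : inner one (fun x => F (v x) - F (w x)) - inner (fun x => f (w x)) (fun x => v x - w x)
     = \int[mu]_(x in Omega) (1 * (F (v x) - F (w x)) - f (w x) * (v x - w x)).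
    by rewrite RintegralB.
  have iD : mu.-integrable Omega (EFin \o (fun x => 1 * (F (v x) - F (w x)) - f (w x) * (v x - w x))).
    exact: (integrableB mO iP if').
  have iL := L2_integrableM Lp Ld.
  have iNL := L2_integrableM (L2N oO Lp) Ld.
  have key x : `|1 * (F (v x) - F (w x)) - f (w x) * (v x - w x)| <= L * (v x - w x) * (v x - w x).
    by rewrite mul1r -mulrA -expr2; exact: taylor_order1.
  rewrite E3 E2 -innerNl//; apply/andP; split; apply: le_Rintegral => // x Ox.
    by rewrite mulNr lerNl (le_trans _ (key x))// -normrN ler_norm.
  by rewrite (le_trans _ (key x))// ler_norm.
apply: le_trans (inner_CS oO L2one (L2B oO LFv LFw)) _.
rewrite [L ^+ 2 * _]mulrC -mulrA ler_wpM2l ?inner_ge0//.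
by apply: inner_dom => //; [exact: L2B|move=> x _; exact: bounded_derive_lipschitz].
Qed.

Lemma inner_sav_g w h : L2 w -> L2 h ->
  inner (sav_g Omega F c0 w) h = inner (fun x => f (w x)) h / Num.sqrt (I w).
Proof.
by move=> Lw Lh; rewrite sav_gE innerZl// 1?mulrC//; exact: L2_f.
Qed.

(** The scheme changes r by exactly this linear term, so the bound measures the drift of r in one
    step. The constant c0 > 0 keeps the square root away from its singularity. *)
Lemma sqrt_energy_taylor : exists2 C : R, 0 <= C & forall v w, L2 v -> L2 w ->
  `|Num.sqrt (I v) - Num.sqrt (I w) - 2^-1 * inner (sav_g Omega F c0 w) (fun x => v x - w x)| <=
    C * inner (fun x => v x - w x) (fun x => v x - w x).
Proof.
exists ((L + L ^+ 2 * vol / c0) / Num.sqrt c0).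
  by rewrite divr_ge0 ?(ltW sc0)// addr_ge0// divr_ge0 ?(ltW c00)// mulr_ge0 ?sqr_ge0 ?inner_ge0.
move=> v w Lv Lw; have Ld := L2B oO Lv Lw; have [h1 h2] := energy_diff Lv Lw.
rewrite inner_sav_g//.
have Iv0 : 0 <= I v by rewrite (le_trans (ltW c00))// energy_ge.
have Iw0 : 0 <= I w by rewrite (le_trans (ltW c00))// energy_ge.
have := sqrt_energy_ge v; have := sqrt_energy_ge w.
have := inner_ge0 Omega (fun x => v x - w x).
move: h1 h2 Iv0 Iw0; set P := inner (fun x => f _) _; set D := inner _ _.
set Iv := I v; set Iw := I w; clearbody P D Iv Iw.
move=> h1 h2 Iv0 Iw0 D0 hw hv.
have := sqrt_taylor (P := P) sc0 hw hv L0 (inner_ge0 Omega one) D0.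
by rewrite !sqr_sqrtr ?(ltW c00)//; apply.
Qed.

Lemma inner_sav_g_CS w h : L2 w -> L2 h ->
  inner (sav_g Omega F c0 w) h ^+ 2 <= L ^+ 2 / c0 * vol * inner h h.
Proof.
move=> Lw Lh; apply: le_trans (inner_CS oO (L2_sav_g Lw) Lh) _.
rewrite ler_wpM2r ?inner_ge0//.
have -> : L ^+ 2 / c0 = (L / Num.sqrt c0) ^+ 2 by rewrite expr_div_n sqr_sqrtr// ltW.
apply: inner_dom => //; [exact: L2_sav_g|by rewrite divr_ge0 ?sqrtr_ge0|].
move=> x _; rewrite normr1 mulr1 sav_gE normrM normfV (ger0_norm (sqrtr_ge0 _)) mulrC.
rewrite ler_pM ?invr_ge0 ?sqrtr_ge0//.
by rewrite lef_pV2 ?posrE ?sqrt_energy_ge// (lt_le_trans sc0)// sqrt_energy_ge.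
Qed.

Lemma inner_f_lipschitz U V e : L2 U -> L2 V -> L2 e ->
  inner (fun x => f (V x) - f (U x)) e ^+ 2 <=
    L ^+ 2 * inner (fun x => V x - U x) (fun x => V x - U x) * inner e e.
Proof.
move=> LU LV Le; have LfU := L2_f LU; have LfV := L2_f LV.
apply: le_trans (inner_CS oO (L2B oO LfV LfU) Le) _; rewrite ler_wpM2r ?inner_ge0//.
apply: inner_dom => //; try exact: L2B.
by move=> x _; exact: (bounded_derive_lipschitz df f'_le).
Qed.

(** f(U) is Num.sqrt (I U) times [sav_g] of U, so the difference is a scalar multiple of [sav_g]. *)
Lemma inner_sav_residual U r e : L2 U -> L2 e ->
  inner (fun x => f (U x) - r * sav_g Omega F c0 U x) e ^+ 2 <=
    L ^+ 2 / c0 * vol * (r - Num.sqrt (I U)) ^+ 2 * inner e e.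
Proof.
move=> LU Le; have LfU := L2_f LU; have Lg := L2_sav_g LU.
have a0 : 0 < Num.sqrt (I U) by rewrite (lt_le_trans sc0)// sqrt_energy_ge.
have -> : (fun x => f (U x) - r * sav_g Omega F c0 U x) =
    (fun x => (Num.sqrt (I U) - r) * sav_g Omega F c0 U x).
  by apply/funext => x; rewrite sav_gE mulrBl mulVKf// gt_eqF.
rewrite innerZl// exprMn -sqrrN opprB.
rewrite [leRHS](_ : _ = (r - Num.sqrt (I U)) ^+ 2 * (L ^+ 2 / c0 * vol * inner e e)); last by ring.
by rewrite ler_wpM2l ?sqr_ge0//; exact: inner_sav_g_CS.
Qed.

Lemma inner_f_sub_le u V : L2 u -> L2 V ->
  `|inner (fun x => f (u x) - f (V x)) (fun x => u x - V x)| <=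
    L * inner (fun x => u x - V x) (fun x => u x - V x).
Proof.
move=> Lu LV; have Ld := L2B oO Lu LV.
rewrite -ler_sqr ?nnegrE ?mulr_ge0 ?inner_ge0// real_normK ?num_real//.
by apply: le_trans (inner_f_lipschitz LV Lu Ld) _; rewrite exprMn mulrA.
Qed.

(** Taylor expansion of f around u, the exact solution, since the spectral estimate concerns the
    linearization there; the quadratic remainder times u - V gives the cube. *)
Lemma inner_f_sub_cubic u V : L2 u -> L2 V ->
  mu.-integrable Omega (EFin \o (fun x => `|u x - V x| ^+ 3)) ->
  inner (fun x => (derive1 f) (u x) * (u x - V x)) (fun x => u x - V x) -
    L * \int[mu]_(x in Omega) `|u x - V x| ^+ 3 <=
  inner (fun x => f (u x) - f (V x)) (fun x => u x - V x).
Proof.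
move=> Lu LV i3; have Ld := L2B oO Lu LV; have LfU := L2_f Lu; have LfV := L2_f LV.
have Lf' := L2_f'M Lu Ld.
have i1 := L2_integrableM Lf' Ld; have i2 := L2_integrableM (L2B oO LfU LfV) Ld.
have iL : mu.-integrable Omega (EFin \o (fun x => L * `|u x - V x| ^+ 3)).
  by apply: eq_integrable (integrableZl mO L i3) => // x _.
rewrite -RintegralZl// -RintegralB//; apply: le_Rintegral => //.
  exact: (integrableB mO i1 iL).
move=> x Ox /=; rewrite lerBlDr -lerBlDl.
have h := taylor_order1 df ddf f''_le (u x) (V x).
apply: le_trans (ler_norm _) _.
have -> : derive1 f (u x) * (u x - V x) * (u x - V x) - (f (u x) - f (V x)) * (u x - V x)
    = (f (V x) - f (u x) - derive1 f (u x) * (V x - u x)) * (u x - V x) by ring.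
rewrite normrM exprSr mulrA ler_wpM2r//; apply: le_trans h _.
by rewrite real_normK ?num_real// -sqrrN opprB.
Qed.

End nonlinearity.

(** * Uniform time steps *)

(** The integral of a nonnegative function is a supremum over the simple functions below it, and
    this set grows with the function, measurable or not. *)
Lemma ge0_le_integral_nonmeasurable dd (T : measurableType dd) (R : realType)
    (mu : {measure set T -> \bar R}) (D : set T) (f g : T -> \bar R) :
  (forall x, D x -> 0 <= f x)%E -> (forall x, D x -> f x <= g x)%E ->
  (\int[mu]_(x in D) f x <= \int[mu]_(x in D) g x)%E.
Proof.
move=> f0 fg; have g0 x : D x -> (0 <= g x)%E.
  by move=> Dx; rewrite (le_trans (f0 x Dx))// fg.
rewrite !ge0_integralE//; apply: ereal_sup_le => _ [h /= hf <-].
exists h => //= x; apply: (le_trans (hf x)); rewrite /patch; case: ifPn => // xD.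
by apply: fg; exact: set_mem.
Qed.

Section time_steps.
Variables (R : realType) (tau : R).
Hypothesis tau0 : 0 < tau.
Notation leb := (@lebesgue_measure R).
Let I (n : nat) : set R := `]n%:R * tau, n.+1%:R * tau]%classic.

Lemma time_step_inj n k x : I n x -> I k x -> n = k.
Proof.
rewrite /I /= !in_itv /= => /andP[n1 n2] /andP[k1 k2].
have := lt_le_trans n1 k2; have := lt_le_trans k1 n2.
rewrite !ltr_pM2r// !ltr_nat => ? ?; apply/eqP; rewrite eqn_leq.
by apply/andP; split.
Qed.

Lemma time_step_length n : leb (I n) = tau%:E.
Proof.
rewrite /I lebesgue_measure_itv/= lte_fin ltr_pM2r// ltr_nat ltnSn -EFinD.
by rewrite -mulrBl -natrB// subSnn mul1r.
Qed.

(* The bound G, a norm of u_t or of its derivative, is not known to be measurable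
   in time; only its inner products with fixed elements of L^2 are. *)
Lemma time_steps_integral_le (D : set R) (M : nat) (h : nat -> R -> R)
    (G : R -> R) (B : R) :
  (forall n, (n < M)%N -> I n `<=` D) ->
  (forall n, (n < M)%N -> measurable_fun (I n) (h n)) ->
  (forall n r, (n < M)%N -> I n r -> h n r ^+ 2 <= G r) ->
  (forall r, D r -> 0 <= G r) ->
  (\int[leb]_(r in D) (G r)%:E <= B%:E)%E ->
  (forall n, (n < M)%N -> sqint leb (I n) (h n)) /\
  \sum_(n < M) \int[leb]_(r in I n) (h n r * h n r) <= B.
Proof.
move=> ID mh hG G0 GB.
have mI n : measurable (I n : set (measurableTypeR R)) by exact: measurable_itv.
pose H n := ((fun r => (h n r ^+ 2)%:E) \_ (I n)).
have H0 n x : (0 <= H n x)%E.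
  by rewrite /H /patch; case: ifP => // _; rewrite lee_fin sqr_ge0.
have mH n : (n < M)%N -> measurable_fun setT (H n).
  move=> nM; apply/(measurable_restrictT _ (mI n)).
  apply/measurable_EFinP; apply: measurable_funX; exact: mh.
have HE n : (\int[leb]_(x in I n) (h n x ^+ 2)%:E = \int[leb]_(x in setT) H n x)%E.
  by rewrite /H integral_mkcond.
have key : (\sum_(n < M) \int[leb]_(x in I n) (h n x ^+ 2)%:E <= B%:E)%E.
  apply: le_trans GB; under eq_bigr do rewrite HE.
  have <- : (\int[leb]_x (\sum_(k < M) H k x) = \sum_(k < M) \int[leb]_x H k x)%E.
    apply: (@ge0_integral_sum _ _ _ leb _ measurableT _ (fun k : 'I_M => H k)).
    - by move=> k; exact: mH.
    - by [].
  (* Every time lies in at most one step, so the measurable sum of the [H k] stays below the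
     extension of [G] by 0. *)
  rewrite [leRHS]integral_mkcond; apply: ge0_le_integral_nonmeasurable.
    by move=> x _; exact: sume_ge0.
  move=> x _; have [[n nM Inx]|nI] := pselect (exists2 n, (n < M)%N & I n x).
    rewrite (bigD1 (Ordinal nM))//= big1 ?adde0; last first.
      move=> k kn; rewrite /H /patch ifN//; apply/negP => /set_mem Ikx.
      move/negP: kn; apply; apply/eqP/val_inj => /=; exact: time_step_inj Ikx Inx.
    rewrite /H /patch (mem_set Inx) (mem_set (ID _ nM _ Inx)) lee_fin; exact: hG.
  rewrite big1; last first.
    move=> k _; rewrite /H /patch ifN//; apply/negP => /set_mem Ikx.
    by apply: nI; exists k.
  rewrite /patch; case: ifPn => // /set_mem Dx; rewrite lee_fin; exact: G0.
have fin n : (n < M)%N -> (\int[leb]_(x in I n) (h n x ^+ 2)%:E < +oo)%E.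
  move=> nM; apply: le_lt_trans (ltry B); apply: le_trans key.
  rewrite (bigD1 (Ordinal nM))//= leeDl// sume_ge0// => k _.
  by apply: integral_ge0 => x _; rewrite lee_fin sqr_ge0.
have S n : (n < M)%N -> sqint leb (I n) (h n).
  move=> nM; split; first exact: mh.
  apply/integrableP; split.
    by apply/measurable_EFinP; apply: measurable_funX; exact: mh.
  apply: le_lt_trans (fin n nM); apply: ge0_le_integral_nonmeasurable => x _ //=.
  by rewrite ger0_norm ?sqr_ge0.
split => //; rewrite -lee_fin -sumEFin; apply: le_trans key.
rewrite le_eqVlt; apply/orP; left; apply/eqP; apply: eq_bigr => n _.
rewrite /Rintegral fineK; first by apply: eq_integral => x _; rewrite expr2.
apply: integrable_fin_num; first exact: mI.
exact: (sqint_mul (mI n) (S n (ltn_ord n)) (S n (ltn_ord n))).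
Qed.

Lemma time_step_CS n (g : R -> R) : sqint leb (I n) g ->
  (\int[leb]_(r in I n) g r) ^+ 2 <= tau * \int[leb]_(r in I n) (g r * g r).
Proof.
move=> Sg; have mI : measurable (I n : set (measurableTypeR R)) by exact: measurable_itv.
have S1 : sqint leb (I n) (fun=> 1).
  split; first exact: measurable_cst.
  apply/integrableP; split; first exact/measurable_EFinP/measurable_cst.
  rewrite /=; under eq_integral do rewrite expr1n normr1.
  have := @integral_cst _ _ _ leb _ mI 1%E.
  rewrite [X in (_ * X)%E](_ : _ = tau%:E); last exact: time_step_length.
  by rewrite mul1e /= => ->; rewrite ltry.
have := cauchy_schwarz mI S1 Sg.
under eq_Rintegral do rewrite mul1r.
under [X in _ <= X * _ -> _]eq_Rintegral do rewrite mul1r.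
rewrite Rintegral_cst//= [X in fine X](_ : _ = tau%:E); last exact: time_step_length.
by rewrite /= mul1r.
Qed.

Lemma time_step_tail n (g : R -> R) s : sqint leb (I n) g -> I n s ->
  (\int[leb]_(r in `[s, n.+1%:R * tau]) g r) ^+ 2 <=
  tau * \int[leb]_(r in I n) (g r * g r).
Proof.
move=> Sg Is; have mI : measurable (I n : set (measurableTypeR R)) by exact: measurable_itv.
have JI : `[s, n.+1%:R * tau]%classic `<=` I n.
  move=> r /=; rewrite /I /= !in_itv /= => /andP[sr ->]; rewrite andbT.
  by apply: lt_le_trans sr; move: Is; rewrite /I /= in_itv /= => /andP[].
have mJ : measurable (`[s, n.+1%:R * tau]%classic : set (measurableTypeR R)) by exact: measurable_itv.
have S1 : sqint leb (I n) (fun=> 1).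
  split; first exact: measurable_cst.
  apply/integrableP; split; first exact/measurable_EFinP/measurable_cst.
  rewrite /=; under eq_integral do rewrite expr1n normr1.
  have := @integral_cst _ _ _ leb _ mI 1%E.
  rewrite [X in (_ * X)%E](_ : _ = tau%:E); last exact: time_step_length.
  by rewrite mul1e /= => ->; rewrite ltry.
have ig : leb.-integrable (I n) (EFin \o g).
  by apply: eq_integrable (sqint_mul mI Sg S1) => // r _ /=; rewrite mulr1.
have Sa : sqint leb (I n) (fun r => `|g r|).
  have [mg ig2] := Sg; split; first exact: measurableT_comp.
  by apply: eq_integrable ig2 => // r _ /=; rewrite real_normK ?num_real.
have igJ := integrableS mI mJ JI ig.
have iga : leb.-integrable (I n) (EFin \o (fun r => `|g r|)).
  by apply: eq_integrable (sqint_mul mI Sa S1) => // r _ /=; rewrite mulr1.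
have h : `|\int[leb]_(r in `[s, n.+1%:R * tau]) g r| <= \int[leb]_(r in I n) `|g r|.
  apply: le_trans (le_normr_Rintegral mJ igJ) _.
  apply: fine_le.
  - exact: integrable_fin_num (integrableS mI mJ JI iga).
  - exact: integrable_fin_num iga.
  by apply: ge0_subset_integral => //; case/integrableP : iga.
have := time_step_CS Sa.
under [X in _ <= _ * X -> _]eq_Rintegral do rewrite -expr2 real_normK ?num_real// expr2.
apply: le_trans; rewrite -[leLHS]real_normK ?num_real//.
by rewrite ler_sqr ?nnegrE//; apply: le_trans h.
Qed.

End time_steps.

(** * Consistency of the implicit Euler step *)

Section time_regularity.
Variables (R : realType) (n : nat) (Omega : set 'rV[R]_n).
Notation E := ('rV[R]_n).
Notation mu := (lebesgue_rV R n).
Notation leb := (@lebesgue_measure R).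
Hypothesis oO : open Omega.
Hypothesis bO : bounded_set Omega.

Notation L2 := (@L2 R n Omega).
Notation inner := (@inner R n Omega).
Notation H1 := (@H1 R n Omega).
Notation L20 := (@L20 R n Omega).
Notation gi := (@dirichlet R n Omega).
Notation N := (@inv_laplacian R n Omega).
Notation sqm := (@dual_sqr R n Omega).

Variable K : R.
Hypothesis poincare : forall v, H1 v -> L20 v -> inner v v <= K * gi v v.
Hypothesis K0 : 0 <= K.

Variable tau : R.
Hypothesis tau0 : 0 < tau.
Let I (k : nat) : set R := `]k%:R * tau, k.+1%:R * tau]%classic.
Let J (k : nat) : set R := `[k%:R * tau, k.+1%:R * tau]%classic.

Let mI k : measurable (I k : set (measurableTypeR R)).
Proof. exact: measurable_itv. Qed.
Let mJ k : measurable (J k : set (measurableTypeR R)).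
Proof. exact: measurable_itv. Qed.
Let IJ k : I k `<=` J k.
Proof. exact: subset_itv_oc_cc. Qed.

Let step_le k : k%:R * tau <= k.+1%:R * tau.
Proof. by rewrite ler_pM2r// ler_nat. Qed.

Variables u ut : R -> E -> R.
Hypothesis Lu : forall t, 0 <= t -> L2 (u t).
Hypothesis ut0 : forall t, 0 < t -> L20 (ut t).
Hypothesis du : time_derivative Omega `[0, +oo[ u ut.

Let Lut t : 0 < t -> L2 (ut t). Proof. by move=> /ut0[]. Qed.
Let node_ge0 k : 0 <= k%:R * tau. Proof. by rewrite mulr_ge0// ltW. Qed.
Let I_gt0 k r : I k r -> 0 < r.
Proof.
by rewrite /I /= in_itv /= => /andP[h _]; exact: le_lt_trans h.
Qed.

Notation delta k := (fun x => u (k.+1%:R * tau) x - u (k%:R * tau) x).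

Lemma increment_inner k phi : L2 phi ->
  leb.-integrable (I k) (fun r => (inner (ut r) phi)%:E) /\
  inner (delta k) phi = \int[leb]_(r in I k) inner (ut r) phi.
Proof.
move=> Lp; have [] := du Lp _ _ (step_le k).
- by rewrite /= in_itv /= andbT.
- by rewrite /= in_itv /= andbT.
move=> hi hE; have hI := integrableS (mJ k) (mI k) (@IJ k) hi.
split => //; rewrite innerBl//; [|exact: Lu|exact: Lu].
by rewrite hE /I Rintegral_itv_obnd_cbnd.
Qed.

(** Each increment is tested with its own normalization [psi k]: its squared norm is the square of
    the integral of (u_t, psi k), at most tau times the integral of (u_t, psi k)^2, and |(u_t, psi
    k)| <= |u_t|. *)
Lemma increments_sqr_le (M : nat) (B : R) :
  (\int[leb]_(t in `[0%R, +oo[) (L2norm Omega (ut t) ^+ 2)%:E <= B%:E)%E ->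
  \sum_(k < M) inner (delta k) (delta k) <= tau * B.
Proof.
move=> hB.
have Ld k : L2 (delta k) by apply: L2B => //; exact: Lu.
(* If the increment has norm 0, then 0^-1 = 0 makes [psi k] vanish; this is why [psi1] is an
   inequality. *)
pose c k := (Num.sqrt (inner (delta k) (delta k)))^-1.
pose psi k : E -> R := fun x => c k * delta k x.
have Lp k : L2 (psi k) by exact: L2Z.
have psi1 k : inner (psi k) (psi k) <= 1.
  rewrite innerZl// innerZr// mulrA -expr2 exprVn sqr_sqrtr ?inner_ge0//.
  by have [->|h] := eqVneq (inner (delta k) (delta k)) 0; [rewrite mulr0|rewrite mulVf].
have [||||S hS] := @time_steps_integral_le R tau tau0 `[0, +oo[%classic M
  (fun k r => inner (ut r) (psi k)) (fun r => L2norm Omega (ut r) ^+ 2) B _ _ _ _ hB.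
- by move=> k _ r /I_gt0 r0; rewrite /= in_itv /= ltW.
- move=> k _; have [h _] := increment_inner k (Lp k).
  by apply/measurable_EFinP; case/integrableP : h.
- move=> k r _ /I_gt0 r0; rewrite L2normE (le_trans (inner_CS oO (Lut r0) (Lp k)))//.
  by rewrite ler_piMr ?inner_ge0.
- by move=> r _; exact: sqr_ge0.
apply: le_trans (ler_wpM2l (ltW tau0) hS); rewrite mulr_sumr; apply: ler_sum => k _.
apply: le_trans (time_step_CS tau0 (S _ (ltn_ord k))).
have [_ <-] := increment_inner k (Lp k).
rewrite innerZr// exprMn exprVn sqr_sqrtr ?inner_ge0//.
have [->|h] := eqVneq (inner (delta k) (delta k)) 0; first by rewrite expr0n mulr0.
by rewrite expr2 mulrA mulVf// mul1r.
Qed.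

Variable q : R -> E -> R.
Hypothesis q0 : forall t, 0 < t -> L20 (q t).
Hypothesis dq : time_derivative Omega `]0, +oo[ (fun t => inv_lap Omega (ut t)) q.

(** [dq] speaks of closed intervals inside t > 0, while the step k = 0 starts at 0; [I k] is
    exhausted by closed intervals starting at [s i], beyond its left end. *)
Let measurable_inner_q k psi : L2 psi -> measurable_fun (I k) (fun r => inner (q r) psi).
Proof.
move=> Lp.
pose s (i : nat) : R := k%:R * tau + tau / i.+1%:R.
pose A (i : nat) : set R := `[s i, k.+1%:R * tau]%classic.
have -> : I k = \bigcup_i A i.
  apply/seteqP; split => r; last first.
    move=> [i _]; rewrite /A /I /= !in_itv /= => /andP[h ->]; rewrite andbT.
    by apply: lt_le_trans h; rewrite /s ltrDl divr_gt0.
  rewrite /I /= in_itv /= => /andP[h1 h2].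
  have h3 : 0 < (r - k%:R * tau) / tau by rewrite divr_gt0// subr_gt0.
  exists (Num.trunc ((r - k%:R * tau) / tau)^-1) => //.
  rewrite /A /= in_itv /= h2 andbT /s -lerBrDl ler_pdivrMr// -ler_pdivrMl ?subr_gt0//.
  rewrite mulrC -invf_div; apply/ltW; rewrite invf_div.
  by rewrite -invf_div truncnS_gt// ltW// invr_gt0.
apply/(measurable_fun_bigcup (E := A : (set (measurableTypeR R))^nat)).
  by move=> i; exact: measurable_itv.
move=> i; have s0 : 0 < s i by rewrite /s ltr_wpDl// divr_gt0.
have si : s i <= k.+1%:R * tau.
  by rewrite /s -(natr1 k) mulrDl mul1r lerD2l ler_pdivrMr// ler_peMr ?(ltW tau0)// ler1n.
have [||h _] := dq Lp _ _ si.
- by rewrite /= in_itv /= s0.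
- by rewrite /= in_itv /= (lt_le_trans s0 si).
by apply/measurable_EFinP; case/integrableP : h.
Qed.

(** By symmetry (u_t, N e) = - (Delta^-1 u_t, e), so the consistency error is the mean over the step
    of the pairings of u_t(r) - u_t(t') with N e, each an integral of (q, e) from r to t'. [Q k] is
    the integral of (q, psi k)^2, with e normalized in the Dirichlet norm to match the H^{-1} norm
    of q. *)
Lemma consistency_le (M : nat) (B : R) (e : nat -> E -> R) :
  (forall k, (k < M)%N -> H1 (e k) /\ L20 (e k)) ->
  (\int[leb]_(t in `]0%R, +oo[) (normm1 Omega (q t) ^+ 2)%:E <= B%:E)%E ->
  exists Q : nat -> R, [/\ forall k, 0 <= Q k, \sum_(k < M) Q k <= B &
    forall k, (k < M)%N ->
      inner (fun x => delta k x / tau - ut (k.+1%:R * tau) x) (N (e k)) ^+ 2 <=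
      tau * Q k * gi (e k) (e k)].
Proof.
move=> he hB.
pose c k := (Num.sqrt (gi (e k) (e k)))^-1.
pose psi k : E -> R := fun x => c k * e k x.
have Hp k : (k < M)%N -> H1 (psi k) by move=> /he[He _]; exact: H1Z.
have psi1 k : (k < M)%N -> gi (psi k) (psi k) <= 1.
  move=> /he[He _]; rewrite (giZl oO bO _ He) ?(giZr oO bO _ He He); last exact: H1Z.
  rewrite mulrA -expr2 exprVn sqr_sqrtr ?gi_ge0//.
  by have [->|h] := eqVneq (gi (e k) (e k)) 0; [rewrite mulr0|rewrite mulVf].
have [||||S hS] := @time_steps_integral_le R tau tau0 `]0, +oo[%classic M
  (fun k r => inner (q r) (psi k)) (fun r => normm1 Omega (q r) ^+ 2) B _ _ _ _ hB.
- by move=> k _ r /I_gt0 r0; rewrite /= in_itv /= r0.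
- by move=> k kM; apply: measurable_inner_q; exact: H1_L2 (Hp k kM).
- move=> k r kM /I_gt0 r0; rewrite dual_sqrE.
  apply: (le_trans (dual_CS oO bO poincare K0 (q0 r0) (Hp k kM))).
  by rewrite ler_piMr ?dual_sqr_ge0// psi1.
- by move=> r _; exact: sqr_ge0.
exists (fun k => \int[leb]_(r in I k) (inner (q r) (psi k) * inner (q r) (psi k))).
split => //; first by move=> k; apply: Rintegral_ge0 => r _; rewrite -expr2 sqr_ge0.
move=> k kM; have [He e0] := he k kM; have Le := H1_L2 He.
set Q := \int[leb]_(r in I k) _; set t' := k.+1%:R * tau.
have t'0 : 0 < t' by rewrite /t' mulr_gt0.
have LN := H1_L2 (H1_N oO bO poincare K0 e0).
set g := gi (e k) (e k); have g0 : 0 <= g by exact: gi_ge0.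
have Q0 : 0 <= Q by apply: Rintegral_ge0 => r _; rewrite -expr2 sqr_ge0.
have [iu uE] := increment_inner k LN.
(* When g = 0 the normalization is lost, but then (q, e) = 0 by [dual_CS]. *)
have qE r : 0 < r -> inner (q r) (e k) = Num.sqrt g * inner (q r) (psi k).
  move=> r0; have [Lq _] := q0 r0; rewrite (innerZr oO _ Le Lq) mulrA.
  have [gz|gz] := eqVneq g 0; last by rewrite mulfV ?mul1r// sqrtr_eq0 -ltNge lt_neqAle eq_sym gz.
  rewrite gz sqrtr0 !mul0r; apply/eqP; rewrite -sqrf_eq0 eq_le sqr_ge0 andbT.
  by apply: (le_trans (dual_CS oO bO poincare K0 (q0 r0) He)); rewrite -/g gz mulr0.
have sym r : 0 < r -> inner (ut r) (N (e k)) = - inner (inv_lap Omega (ut r)) (e k).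
  move=> r0; have u0 := ut0 r0.
  rewrite (inner_N_sym oO bO poincare K0 u0 e0) /inv_lap -/(neg_inv_lap Omega (ut r)).
  rewrite innerC; have LNu := H1_L2 (H1_N oO bO poincare K0 u0).
  move: LNu; rewrite inv_laplacian.unlock => LNu.
  by rewrite (innerNl oO LNu Le) opprK.
pose b := Num.sqrt (tau * Q * g).
have bound r : I k r -> `|inner (ut r) (N (e k)) - inner (ut t') (N (e k))| <= b.
  move=> Ir; have r0 := I_gt0 Ir; rewrite (sym _ r0) (sym _ t'0) opprK addrC.
  have rt : r <= t' by move: Ir; rewrite /I /= in_itv /= => /andP[].
  have [||iq ->] := dq Le _ _ rt.
  - by rewrite /= in_itv /= r0.
  - by rewrite /= in_itv /= t'0.
  rewrite -sqrtr_sqr ler_sqrt ?mulr_ge0 ?(ltW tau0)//.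
  have -> : \int[leb]_(s in `[r, t']) inner (q s) (e k) =
    Num.sqrt g * \int[leb]_(s in `[r, t']) inner (q s) (psi k).
    rewrite -RintegralZl//; last first.
      have [||h _] := dq (H1_L2 (Hp k kM)) _ _ rt => //.
      - by rewrite /= in_itv /= r0.
      - by rewrite /= in_itv /= t'0.
    apply: eq_Rintegral => s; rewrite inE /= in_itv /= => /andP[rs _].
    by rewrite qE// (lt_le_trans r0).
  rewrite exprMn sqr_sqrtr// mulrC ler_wpM2r//.
  exact: time_step_tail (S k kM) Ir.
have i1 (c0 : R) : leb.-integrable (I k) (EFin \o (fun=> c0)).
  apply: measurable_bounded_integrable => //.
    rewrite [X in (X < _)%E](_ : _ = tau%:E) ?ltry//; exact: time_step_length.
  by exists `|c0|; split => // x hx y _; exact: ltW.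
have lenI : fine (leb (I k)) = tau.
  by rewrite [X in fine X](_ : _ = tau%:E)//; exact: time_step_length.
have E1 : tau * inner (fun x => delta k x / tau - ut t' x) (N (e k)) =
    \int[leb]_(r in I k) (inner (ut r) (N (e k)) - inner (ut t') (N (e k))).
  rewrite RintegralB// -uE.
  have Ld : L2 (delta k) by apply: L2B => //; exact: Lu.
  rewrite (_ : (fun x => delta k x / tau - ut t' x) = (fun x => tau^-1 * delta k x - ut t' x)); last first.
    by apply/funext => x; rewrite mulrC.
  rewrite (innerBl oO (L2Z oO tau^-1 Ld) (Lut t'0) LN) (innerZl oO _ Ld LN).
  rewrite Rintegral_cst ?lenI//.
  move: (inner (ut t') _) (inner (delta k) _) => p1 p2.
  by field; rewrite gt_eqF.
have E2 : `|tau * inner (fun x => delta k x / tau - ut t' x) (N (e k))| <= tau * b.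
  rewrite E1; pose w r := inner (ut r) (N (e k)) - inner (ut t') (N (e k)).
  have ii : leb.-integrable (I k) (EFin \o w) by exact: (integrableB (mI k) iu (i1 _)).
  apply: (le_trans (le_normr_Rintegral (mI k) ii)).
  rewrite mulrC -lenI -Rintegral_cst//; apply: le_Rintegral => //.
  - exact: integrable_norm ii.
move: E2; rewrite normrM gtr0_norm// ler_pM2l// => E2.
rewrite -real_normK ?num_real// -(@sqr_sqrtr _ (tau * Q * g)) ?mulr_ge0 ?(ltW tau0)//.
by rewrite ler_sqr ?nnegrE ?sqrtr_ge0.
Qed.

End time_regularity.

(** * The error recursion *)

Lemma young_sqr (R : realFieldType) (a c b s : R) :
  b ^+ 2 <= a * c -> 0 <= a -> 0 <= c -> 0 < s -> b <= s * a + c / (4 * s).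
Proof.
move=> h a0 c0 s0; have r0 : 0 <= s * a + c / (4 * s).
  by rewrite addr_ge0// ?divr_ge0// mulr_ge0// ltW.
apply: (le_trans (ler_norm _)).
rewrite -ler_sqr ?nnegrE// real_normK ?num_real//; apply: (le_trans h).
rewrite -subr_ge0 (_ : _ - _ = (s * a - c / (4 * s)) ^+ 2) ?sqr_ge0//.
by field; rewrite gt_eqF.
Qed.

Section error_recursion.
Variables (R : realFieldType) (n : nat) (eps tau T : R).
Hypotheses (eps0 : 0 < eps) (eps1 : eps < 1) (tau0 : 0 < tau).
Hypothesis ntau : n%:R * tau <= T.
(* x = |e^k|_{-1}^2, y = |e^{k+1} - e^k|_{-1}^2, G = |grad e^k|^2, m = |e^k|^2,
   p = |u(t_{k+1}) - u(t_k)|^2, D = |e^{k+1} - e^k|^2, d = |u^{k+1} - u^k|^2,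
   Tc = int |e^{k+1}|^3; b is the consistency error, A1 + A2 the nonlinear term,
   and P2, P3, A stand for eps^-rho2, eps^-rho3, eps^-alpha0. *)
Variables (x y G p Q m D d A1 b A2 Tc : nat -> R).
Variables (C1 C2 C3 C4 C5 L lam P2 P3 A : R).
Hypotheses (C1_ge0 : 0 <= C1) (C2_ge0 : 0 <= C2) (C3_ge0 : 0 <= C3)
  (C4_ge0 : 0 <= C4) (C5_ge0 : 0 <= C5) (L_ge0 : 0 <= L) (lam_ge0 : 0 <= lam).
Hypotheses (P2_ge1 : 1 <= P2) (P2A : P2 ^+ 2 <= eps ^+ 4 * A)
  (P3A : P3 <= eps ^+ 4 * A).
Hypotheses (x0 : x 0%N = 0) (G0 : G 0%N = 0).
Hypotheses (x_ge0 : forall k, 0 <= x k) (y_ge0 : forall k, 0 <= y k)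
  (G_ge0 : forall k, 0 <= G k) (p_ge0 : forall k, 0 <= p k)
  (Q_ge0 : forall k, 0 <= Q k) (m_ge0 : forall k, 0 <= m k)
  (d_ge0 : forall k, 0 <= d k) (Tc_ge0 : forall k, 0 <= Tc k).
Let S k := \sum_(j < k) d j.
Hypothesis stepE : forall k, (k < n)%N ->
  2^-1 * (x k.+1 - x k + y k) + tau * (eps * G k.+1 + eps^-1 * A1 k) =
  tau * b k - tau * (eps^-1 * A2 k).
Hypothesis b_le : forall k, (k < n)%N -> b k ^+ 2 <= tau * Q k * G k.+1.
Hypothesis A2_le : forall k, (k < n)%N ->
  A2 k ^+ 2 <= C1 * (d k + S k ^+ 2) * m k.+1.
Hypothesis d_le : forall k, (k < n)%N -> d k <= 2 * p k + 2 * D k.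
Hypothesis D_le : forall k, (k < n)%N -> D k ^+ 2 <= y k * (2 * (G k.+1 + G k)).
Hypothesis m_le : forall k, (k < n)%N -> m k.+1 ^+ 2 <= x k.+1 * G k.+1.
Hypothesis A1_crude : forall k, (k < n)%N -> - A1 k <= L * m k.+1.
Hypothesis A1_fine : forall k, (k < n)%N ->
  eps ^+ 4 * G k.+1 - lam * x k.+1 - eps ^+ 2 * L * m k.+1 - eps^-1 * C3 * Tc k
  <= eps * G k.+1 + eps^-1 * A1 k.
Hypothesis Tc_le : forall k, (k < n)%N -> Tc k ^+ 4 <= C4 * (m k.+1 ^+ 3 * G k.+1 ^+ 3).
Hypothesis sum_p : \sum_(k < n) p k <= tau * (C2 * P2).
Hypothesis sum_Q : \sum_(k < n) Q k <= C5 * P3.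

(** [C_S] gathers 2 C2 from the sum of p and 2 + 2 from the Young terms in [S_le]. [c1] dominates
    twice the coefficient lam + 2 L^2 + 4 of tau x k.+1 in the refined step. [C_src] adds the three
    parts of [src], and 1 so as to be at least 1. *)
Let C_S := 2 * C2 + 4.
Let c1 := 2 * lam + 8 * L ^+ 2 + 8.
Let C_src := 8 * C5 + C1 * C2 + T * C1 * C_S ^+ 2 / 2 + 1.

Variable kappa : R.
Hypothesis kappaE : (1 + 2 * c1 * tau) ^+ n * C_src <= kappa.
Let M := kappa * A * tau ^+ 2.

Hypothesis s1 : c1 * tau <= 2^-1.
Hypothesis s2 : 4 * tau + 2 * L ^+ 2 * tau / eps ^+ 3 <= 4^-1.
Hypothesis s3 : 32 * C1 * (C1 + 1) * tau <= eps ^+ 12.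
Hypothesis s4 : 2 * (kappa * A) ^+ 2 * tau <= eps ^+ 4.
Hypothesis s5 : (C3 / eps) ^+ 8 * C4 ^+ 2 * ((6 * M) ^+ 3 * (3 * M / (eps * tau))) <=
  (eps ^+ 4 / 16) ^+ 8.

Let src k := 8 * tau ^+ 2 * Q k / eps ^+ 4 + tau * C1 * p k / eps ^+ 4 +
  tau * C1 * S k ^+ 2 / (2 * eps ^+ 4).
(** The quantity propagated by Gronwall. The term in G k / 16 pays for the old gradient:
    interpolating [D k] leaves G k with weight 1/32 on the right, doubled when the identity is
    multiplied by 2. *)
Let Phi k := x k + tau * eps ^+ 4 * G k / 16 +
  \sum_(j < k) (2^-1 * y j + tau * eps ^+ 4 * G j.+1).

Let S_ge0 k : 0 <= S k. Proof. by apply: sumr_ge0. Qed.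
Let eps4 : 0 < eps ^+ 4. Proof. exact: exprn_gt0. Qed.

Let src_ge0 k : 0 <= src k.
Proof.
have t0 := ltW tau0; have e0 := ltW eps4.
apply: addr_ge0; [apply: addr_ge0|]; apply: divr_ge0;
  do ?apply: mulr_ge0 => //; exact: ltW.
Qed.

Let step_source k : (k < n)%N ->
  2^-1 * (x k.+1 - x k + y k) + tau * (eps * G k.+1 + eps^-1 * A1 k) <=
  tau * eps ^+ 4 * G k.+1 / 8 + 4 * tau * x k.+1 + y k / 8 +
  tau * eps ^+ 4 * (G k.+1 + G k) / 32 + src k / 2.
Proof.
move=> kn; rewrite stepE//.
have e0 := gt_eqF eps0.
have hb : b k <= eps ^+ 4 / 16 * G k.+1 + 4 * tau * Q k / eps ^+ 4.
  have := @young_sqr _ (G k.+1) (tau * Q k) (b k) (eps ^+ 4 / 16).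
  rewrite mulrC b_le// G_ge0 mulr_ge0 ?(ltW tau0)// => /(_ erefl erefl erefl).
  rewrite divr_gt0// => /(_ erefl) /le_trans; apply; rewrite lerD2l.
  by rewrite le_eqVlt; apply/orP; left; apply/eqP; field; rewrite e0.
have hA : - (eps^-1 * A2 k) <= eps ^+ 2 * m k.+1 + C1 * (d k + S k ^+ 2) / (4 * eps ^+ 4).
  have h : (- (eps^-1 * A2 k)) ^+ 2 <= m k.+1 * (C1 * (d k + S k ^+ 2) / eps ^+ 2).
    rewrite sqrrN exprMn exprVn mulrC ler_pdivrMr ?exprn_gt0//.
    by rewrite mulrA divfK ?sqrf_eq0 ?e0// mulrC A2_le.
  have c0 : 0 <= C1 * (d k + S k ^+ 2) / eps ^+ 2.
    by rewrite divr_ge0 ?sqr_ge0// mulr_ge0// addr_ge0 ?sqr_ge0.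
  apply: (le_trans (young_sqr h (m_ge0 _) c0 (exprn_gt0 2 eps0))); rewrite lerD2l.
  by rewrite le_eqVlt; apply/orP; left; apply/eqP; field; rewrite e0.
have hm : eps ^+ 2 * m k.+1 <= eps ^+ 4 / 16 * G k.+1 + 4 * x k.+1.
  have := @young_sqr _ (G k.+1) (x k.+1) (m k.+1) (eps ^+ 2 / 16).
  rewrite mulrC m_le// G_ge0 x_ge0 divr_gt0 ?exprn_gt0// => /(_ erefl erefl erefl erefl).
  rewrite -(ler_pM2l (exprn_gt0 2 eps0)) => /le_trans; apply.
  by rewrite le_eqVlt; apply/orP; left; apply/eqP; field; rewrite e0.
have hD : C1 * D k / (2 * eps ^+ 4) <=
    4 * C1 * (C1 + 1) / eps ^+ 12 * y k + eps ^+ 4 * (G k.+1 + G k) / 32.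
  (* This Young weight leaves at most eps^4/32 on the gradients and 4 C1 (C1 + 1)/eps^12 on y, which
     [s3] reduces to 1/8 after multiplication by tau. C1 + 1 replaces C1 to allow C1 = 0. *)
  have s0 : 0 < 8 * (C1 + 1) / eps ^+ 8.
    by rewrite divr_gt0 ?exprn_gt0// mulr_gt0// ltr_wpDl.
  have GG : 0 <= 2 * (G k.+1 + G k) by rewrite mulr_ge0 ?addr_ge0.
  have h := young_sqr (D_le kn) (y_ge0 k) GG s0.
  have c0 : 0 <= C1 / (2 * eps ^+ 4) by rewrite divr_ge0// mulr_ge0// ltW.
  have := ler_wpM2l c0 h.
  rewrite mulrAC => /le_trans; apply.
  have C11 : 0 < C1 + 1 by rewrite ltr_wpDl.
  have -> : C1 / (2 * eps ^+ 4) * (8 * (C1 + 1) / eps ^+ 8 * y k +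
      2 * (G k.+1 + G k) / (4 * (8 * (C1 + 1) / eps ^+ 8))) =
    4 * C1 * (C1 + 1) / eps ^+ 12 * y k + eps ^+ 4 * (G k.+1 + G k) / 32 * (C1 / (C1 + 1)).
    by field; rewrite e0 gt_eqF.
  rewrite lerD2l ler_piMr//; first by rewrite divr_ge0// mulr_ge0 ?addr_ge0// ltW.
  by rewrite ler_pdivrMr// mul1r lerDl.
have hy : tau * (4 * C1 * (C1 + 1) / eps ^+ 12 * y k) <= y k / 8.
  rewrite mulrA [y k / 8]mulrC ler_wpM2r// mulrA ler_pdivrMr ?exprn_gt0//.
  by move: s3; lra.
have hd : C1 * d k / (4 * eps ^+ 4) <= C1 * p k / (2 * eps ^+ 4) + C1 * D k / (2 * eps ^+ 4).
  have c0 : 0 <= C1 / (4 * eps ^+ 4) by rewrite divr_ge0// mulr_ge0// ltW.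
  have := ler_wpM2l c0 (d_le kn); rewrite mulrAC => /le_trans; apply.
  by rewrite le_eqVlt; apply/orP; left; apply/eqP; field; rewrite e0.
have h := lerD hb hA; rewrite -mulrN -mulrDr.
apply: (le_trans (ler_wpM2l (ltW tau0) h)).
have h1 := ler_wpM2l (ltW tau0) hm.
have h2 := ler_wpM2l (ltW tau0) (le_trans hd (lerD (lexx _) hD)).
have -> : tau * (eps ^+ 4 / 16 * G k.+1 + 4 * tau * Q k / eps ^+ 4 +
  (eps ^+ 2 * m k.+1 + C1 * (d k + S k ^+ 2) / (4 * eps ^+ 4))) =
  tau * eps ^+ 4 * G k.+1 / 16 + 4 * tau ^+ 2 * Q k / eps ^+ 4 + tau * (eps ^+ 2 * m k.+1) +
  tau * (C1 * d k / (4 * eps ^+ 4)) + tau * C1 * S k ^+ 2 / (4 * eps ^+ 4).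
  by field; rewrite e0.
have srcE : src k / 2 = 4 * tau ^+ 2 * Q k / eps ^+ 4 + tau * (C1 * p k / (2 * eps ^+ 4)) +
  tau * C1 * S k ^+ 2 / (4 * eps ^+ 4) by rewrite /src; field; rewrite e0.
rewrite srcE; move: h1 h2 hy.
rewrite [X in _ <= X -> _]mulrDr [X in _ -> _ <= X -> _]mulrDr [tau * (_ + _ : R)]mulrDr.
have -> : tau * (eps ^+ 4 / 16 * G k.+1) = tau * eps ^+ 4 * G k.+1 / 16 by ring.
have -> : tau * (eps ^+ 4 * (G k.+1 + G k) / 32) = tau * eps ^+ 4 * (G k.+1 + G k) / 32 by ring.
have -> : tau * (4 * x k.+1) = 4 * tau * x k.+1 by ring.
move: (tau * (eps ^+ 2 * m k.+1)) (tau * (C1 * d k / _)) (tau * (C1 * p k / _))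
  (tau * (_ * y k)) (tau * C1 * S k ^+ 2 / _) (4 * tau ^+ 2 * Q k / _)
  (tau * eps ^+ 4 * (G k.+1 + G k) / 32) => q1 q2 q3 q4 q5 q6 q7.
lra.
Qed.

Let A0 : 0 < A.
Proof.
by rewrite -(pmulr_rgt0 _ eps4) (lt_le_trans _ P2A)// exprn_gt0// (lt_le_trans _ P2_ge1).
Qed.

Let c1_ge0 : 0 <= c1. Proof. by rewrite !addr_ge0 ?mulr_ge0 ?sqr_ge0. Qed.

Let T0 : 0 <= T. Proof. by rewrite (le_trans _ ntau)// mulr_ge0// ltW. Qed.

Let C_src1 : 1 <= C_src.
Proof.
have h1 : 0 <= T * C1 * C_S ^+ 2 / 2 by rewrite divr_ge0// mulr_ge0 ?sqr_ge0// mulr_ge0.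
have h2 : 0 <= C1 * C2 by rewrite mulr_ge0.
by rewrite /C_src; move: C5_ge0 h1 h2; lra.
Qed.

Let E_ge1 k : 1 <= (1 + 2 * c1 * tau) ^+ k.
Proof. by rewrite exprn_ege1// lerDl !mulr_ge0// ltW. Qed.

Let kappa1 : 1 <= kappa.
Proof. by apply: le_trans kappaE; rewrite -[leLHS]mulr1 ler_pM. Qed.

Let M0 : 0 < M.
Proof. by rewrite !mulr_gt0 ?exprn_gt0// (lt_le_trans _ kappa1). Qed.

Let teG0 k : 0 <= tau * eps ^+ 4 * G k.
Proof. by apply: mulr_ge0 => //; apply: mulr_ge0; exact: ltW. Qed.

Let sum_ge0 k : 0 <= \sum_(j < k) (2^-1 * y j + tau * eps ^+ 4 * G j.+1).
Proof. by apply: sumr_ge0 => j _; rewrite addr_ge0 ?teG0// mulr_ge0 ?invr_ge0. Qed.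

Let x_le_Phi k : x k <= Phi k.
Proof.
by rewrite /Phi -addrA lerDl addr_ge0 ?sum_ge0// divr_ge0 ?teG0.
Qed.

Let sum_prefix k (h : nat -> R) : (k <= n)%N -> (forall j, 0 <= h j) ->
  \sum_(j < k) h j <= \sum_(j < n) h j.
Proof.
move=> kn h0; rewrite -!(big_mkord xpredT h) [leRHS](big_cat_nat (n := k))//=.
by rewrite lerDl; apply: sumr_ge0.
Qed.

Let sum_shift k : \sum_(j < k) G j <= \sum_(j < k) G j.+1.
Proof.
rewrite -subr_ge0 -sumrB; have -> : \sum_(j < k) (G j.+1 - G j) = G k - G 0%N.
  by rewrite -(big_mkord xpredT (fun j => G j.+1 - G j)) telescope_sumr.
by rewrite G0 subr0.
Qed.

(** The exact increments contribute the sum of p; the increments of the error are interpolated, and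
    both resulting sums are controlled by [Phi k]. *)
Let S_le k : (k <= n)%N -> Phi k <= M -> S k <= C_S * tau * P2.
Proof.
move=> kn hM; have kA : 0 < kappa * A by rewrite mulr_gt0// (lt_le_trans _ kappa1).
(* The weight that makes M / (tau eps^4 a) equal to tau, while 2 a M <= tau is exactly [s4]. *)
pose a := kappa * A / eps ^+ 4; have a0 : 0 < a by rewrite divr_gt0.
have hx := x_ge0 k.
have hG : 0 <= tau * eps ^+ 4 * G k / 16 by rewrite divr_ge0 ?teG0.
have : \sum_(j < k) (2^-1 * y j + tau * eps ^+ 4 * G j.+1) <= M.
  by apply: le_trans hM; rewrite /Phi lerDr addr_ge0.
rewrite big_split/= -!mulr_sumr; have := sum_shift k.
have hS : S k <= \sum_(j < k) (2 * p j + 2 * (a * y j + (G j.+1 + G j) / (2 * a))).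
  apply: ler_sum => j _; have jn : (j < n)%N by exact: leq_trans kn.
  apply: (le_trans (d_le jn)); rewrite lerD2l ler_pM2l//.
  have GG : 0 <= 2 * (G j.+1 + G j) by rewrite mulr_ge0 ?addr_ge0.
  apply: (le_trans (young_sqr (D_le jn) (y_ge0 j) GG a0)); rewrite lerD2l.
  by rewrite le_eqVlt; apply/orP; left; apply/eqP; field; rewrite gt_eqF.
move: hS; rewrite big_split/= -!mulr_sumr big_split/= -mulr_sumr -mulr_suml big_split/=.
set Y := \sum_(j < k) y j; set Gs := \sum_(j < k) G j; set Gt := \sum_(j < k) G j.+1.
move=> hS G12 hsum; have Y0 : 0 <= Y by exact: sumr_ge0.
have Gt0 : 0 <= Gt by exact: sumr_ge0.
have te : 0 < tau * eps ^+ 4 by rewrite mulr_gt0.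
have teG : 0 <= tau * eps ^+ 4 * Gt by rewrite mulr_ge0// ltW.
have Y2 : Y <= 2 * M by move: hsum teG; lra.
have GtM : tau * eps ^+ 4 * Gt <= M by move: hsum Y0; lra.
have h1 : a * Y <= tau.
  apply: (le_trans (ler_wpM2l (ltW a0) Y2)).
  have -> : a * (2 * M) = (2 * (kappa * A) ^+ 2 * tau) / eps ^+ 4 * tau.
    by rewrite /a /M; field; rewrite gt_eqF.
  by rewrite ler_piMl ?(ltW tau0)// ler_pdivrMr// mul1r.
have h2 : (Gt + Gs) / (2 * a) <= tau.
  apply: (@le_trans _ _ (Gt / a)).
    rewrite (_ : Gt / a = 2 * Gt / (2 * a)); last by field; rewrite gt_eqF.
    apply: ler_wpM2r; first by rewrite invr_ge0 pmulr_rge0 ?ltW.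
    by move: G12; lra.
  rewrite ler_pdivrMr// -(ler_pM2l te); apply: (le_trans GtM).
  rewrite le_eqVlt; apply/orP; left; apply/eqP; rewrite /a /M; field.
  by rewrite gt_eqF.
have hp := le_trans (sum_prefix kn p_ge0) sum_p.
have : tau <= tau * P2 by rewrite ler_peMr// ltW.
by move: hS h1 h2 hp; rewrite /C_S; lra.
Qed.

(** The division by eps^4 in [src] is undone by P3 <= eps^4 A and P2 <= P2^2 <= eps^4 A. In the part
    with S^2, the number of steps is compensated by n tau <= T. *)
Let sum_src k : (k <= n)%N -> (forall j, (j < k)%N -> S j <= C_S * tau * P2) ->
  \sum_(j < k) src j <= C_src * (A * tau ^+ 2).
Proof.
move=> kn hS; rewrite /src !big_split/= -!mulr_suml -!mulr_sumr.
have hp := le_trans (sum_prefix kn p_ge0) sum_p.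
have hQ := le_trans (sum_prefix kn Q_ge0) sum_Q.
have hSS : \sum_(j < k) S j ^+ 2 <= n%:R * (C_S * tau * P2) ^+ 2.
  apply: (@le_trans _ _ (\sum_(j < k) (C_S * tau * P2) ^+ 2)).
    apply: ler_sum => j _; rewrite ler_sqr ?nnegrE ?hS//.
    by rewrite mulr_ge0 ?(le_trans _ P2_ge1)// mulr_ge0 ?(ltW tau0)// addr_ge0// mulr_ge0.
  by rewrite sumr_const card_ord -[leLHS]mulr_natl ler_wpM2r ?sqr_ge0// ler_nat.
have t0 := ltW tau0.
have P2P : P2 <= P2 ^+ 2 by rewrite expr2 ler_peMr// (le_trans _ P2_ge1).
have g1 : 8 * tau ^+ 2 * (\sum_(j < k) Q j) / eps ^+ 4 <= 8 * C5 * (A * tau ^+ 2).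
  rewrite ler_pdivrMr//; have := ler_wpM2l (mulr_ge0 (ler0n R 8) (sqr_ge0 tau)) (le_trans hQ (ler_wpM2l C5_ge0 P3A)).
  by move=> /le_trans; apply; rewrite le_eqVlt; apply/orP; left; apply/eqP; ring.
have g2 : tau * C1 * (\sum_(j < k) p j) / eps ^+ 4 <= C1 * C2 * (A * tau ^+ 2).
  rewrite ler_pdivrMr//.
  have h : \sum_(j < k) p j <= tau * (C2 * (eps ^+ 4 * A)).
    by apply: (le_trans hp); rewrite ler_wpM2l// ler_wpM2l// (le_trans P2P).
  have := ler_wpM2l (mulr_ge0 t0 C1_ge0) h.
  by move=> /le_trans; apply; rewrite le_eqVlt; apply/orP; left; apply/eqP; ring.
have g3 : tau * C1 * (\sum_(j < k) S j ^+ 2) / (2 * eps ^+ 4) <=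
    T * C1 * C_S ^+ 2 / 2 * (A * tau ^+ 2).
  rewrite ler_pdivrMr ?mulr_gt0//.
  have h : \sum_(j < k) S j ^+ 2 <= n%:R * (C_S ^+ 2 * tau ^+ 2 * (eps ^+ 4 * A)).
    apply: (le_trans hSS); rewrite ler_wpM2l// !exprMn ler_wpM2l//.
    by rewrite mulr_ge0 ?sqr_ge0.
  have h' := ler_wpM2l (mulr_ge0 t0 C1_ge0) h; apply: (le_trans h').
  rewrite [leLHS](_ : _ = C1 * (C_S ^+ 2 * tau ^+ 2 * (eps ^+ 4 * A)) * (n%:R * tau)); last by ring.
  rewrite [leRHS](_ : _ = C1 * (C_S ^+ 2 * tau ^+ 2 * (eps ^+ 4 * A)) * T); last by field.
  rewrite ler_wpM2l// mulr_ge0// mulr_ge0//; first by rewrite mulr_ge0 ?sqr_ge0.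
  by rewrite mulr_ge0// ltW.
have AT : 0 <= A * tau ^+ 2 by rewrite mulr_ge0 ?sqr_ge0 ?ltW.
move: g1 g2 g3; rewrite /C_src !mulrDl mul1r; lra.
Qed.

Let tauG_le k : tau * eps ^+ 4 * G k <= eps * tau * G k.
Proof.
rewrite ler_wpM2r// [eps * tau]mulrC ler_wpM2l ?(ltW tau0)//.
by rewrite exprS ler_piMr ?(ltW eps0)// exprn_ile1// ltW.
Qed.

Let Lm k : (k < n)%N -> L * m k.+1 <= eps ^+ 2 / 8 * G k.+1 + 2 * L ^+ 2 * x k.+1 / eps ^+ 2.
Proof.
move=> kn; have h : (L * m k.+1) ^+ 2 <= G k.+1 * (L ^+ 2 * x k.+1).
  by rewrite exprMn [leRHS]mulrCA ler_wpM2l ?sqr_ge0// mulrC m_le.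
have c0 : 0 <= L ^+ 2 * x k.+1 by rewrite mulr_ge0 ?sqr_ge0.
have s0 : 0 < eps ^+ 2 / 8 by rewrite divr_gt0 ?exprn_gt0.
apply: (le_trans (young_sqr h (G_ge0 _) c0 s0)); rewrite lerD2l.
by rewrite le_eqVlt; apply/orP; left; apply/eqP; field; rewrite gt_eqF.
Qed.

(** Only A1 >= - L m is used; it is absorbed by eps times the squared gradient at the price of L^2
    tau / eps^3, small by [s2]. A constant factor is lost, so the bound cannot be iterated, but it
    gives the smallness required by the cubic term. *)
Let crude_step k : (k < n)%N -> Phi k <= M -> src k <= M ->
  x k.+1 <= 6 * M /\ eps * tau * G k.+1 <= 3 * M.
Proof.
move=> kn hM hs; have hC := step_source kn.
have hxk : x k <= M := le_trans (x_le_Phi k) hM.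
have hGk : tau * eps ^+ 4 * G k <= 16 * M.
  by have := sum_ge0 k; move: hM (x_ge0 k); rewrite /Phi; lra.
have hL : - (tau * (eps^-1 * A1 k)) <= eps * tau * G k.+1 / 8 + 2 * L ^+ 2 * tau / eps ^+ 3 * x k.+1.
  have te : 0 <= tau / eps by rewrite divr_ge0// ltW.
  have := ler_wpM2l te (le_trans (A1_crude kn) (Lm kn)).
  rewrite (_ : tau / eps * - A1 k = - (tau * (eps^-1 * A1 k))); last by ring.
  move=> /le_trans; apply.
  by rewrite le_eqVlt; apply/orP; left; apply/eqP; field; rewrite gt_eqF.
have hG' := tauG_le k.+1.
have hX : (4 * tau + 2 * L ^+ 2 * tau / eps ^+ 3) * x k.+1 <= 4^-1 * x k.+1.
  by rewrite ler_wpM2r.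
have etG : 0 <= eps * tau * G k.+1 by rewrite mulr_ge0// mulr_ge0// ltW.
have M0' := ltW M0; have xk1 := x_ge0 k.+1; have yk := y_ge0 k; have xk := x_ge0 k.
move: hC hL hX hG' etG hGk hs hxk M0' xk1 yk xk.
move: (src k) (eps^-1 * A1 k) (2 * L ^+ 2 * tau / eps ^+ 3) M => q1 q2 q3 N0.
by move=> *; split; lra.
Qed.

(** By interpolation of m, Tc^8 <= C4^2 x^3 G G^8. The eighth power thus isolates a factor x^3 G,
    which the crude bounds make small; [s5] is the resulting condition. *)
Let cubic_le k : (k < n)%N -> x k.+1 <= 6 * M -> eps * tau * G k.+1 <= 3 * M ->
  eps^-1 * C3 * Tc k <= eps ^+ 4 / 16 * G k.+1.
Proof.
move=> kn hx hG.
have ec : 0 <= eps^-1 * C3 by rewrite mulr_ge0// invr_ge0 ltW.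
have h1 : 0 <= eps^-1 * C3 * Tc k by rewrite mulr_ge0.
have h2 : 0 <= eps ^+ 4 / 16 * G k.+1 by rewrite mulr_ge0// divr_ge0// ltW.
rewrite -(@ler_pXn2r _ 8)// [leLHS]exprMn [leRHS]exprMn.
have hT : Tc k ^+ 8 <= C4 ^+ 2 * (x k.+1 ^+ 3 * G k.+1) * G k.+1 ^+ 8.
  have hm3 : (m k.+1 ^+ 2) ^+ 3 <= (x k.+1 * G k.+1) ^+ 3.
    by rewrite lerXn2r ?nnegrE ?sqr_ge0 ?m_le// mulr_ge0.
  have c0 : 0 <= C4 ^+ 2 * G k.+1 ^+ 6 by rewrite mulr_ge0 ?sqr_ge0 ?exprn_ge0.
  have -> : C4 ^+ 2 * (x k.+1 ^+ 3 * G k.+1) * G k.+1 ^+ 8 =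
    C4 ^+ 2 * G k.+1 ^+ 6 * (x k.+1 * G k.+1) ^+ 3 by ring.
  apply: le_trans (ler_wpM2l c0 hm3).
  rewrite [leRHS](_ : _ = (C4 * (m k.+1 ^+ 3 * G k.+1 ^+ 3)) ^+ 2); last by ring.
  rewrite (_ : Tc k ^+ 8 = (Tc k ^+ 4) ^+ 2); last by ring.
  rewrite ler_sqr ?nnegrE ?Tc_le ?exprn_ge0//.
  by rewrite mulr_ge0// mulr_ge0 ?exprn_ge0.
have e8 : 0 <= (eps^-1 * C3) ^+ 8 by rewrite exprn_ge0.
apply: (le_trans (ler_wpM2l e8 hT)); rewrite [leLHS]mulrA.
apply: ler_wpM2r; first exact: exprn_ge0.
rewrite [leLHS]mulrA [eps^-1 * C3]mulrC; apply: le_trans s5; apply: ler_wpM2l.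
  by rewrite mulr_ge0 ?sqr_ge0// exprn_ge0// divr_ge0// ltW.
rewrite ler_pM ?exprn_ge0//.
  by rewrite lerXn2r ?nnegrE// mulr_ge0// ltW.
by rewrite ler_pdivlMr ?mulr_gt0// mulrC.
Qed.

Let refined_step k : (k < n)%N -> Phi k <= M -> src k <= M ->
  Phi k.+1 <= (1 + 2 * c1 * tau) * (Phi k + src k).
Proof.
move=> kn hM hs; have [hx hG] := crude_step kn hM hs.
have hC := step_source kn; have hT := cubic_le kn hx hG; have hA := A1_fine kn.
have hL : eps ^+ 2 * L * m k.+1 <= eps ^+ 4 / 8 * G k.+1 + 2 * L ^+ 2 * x k.+1.
  have := ler_wpM2l (sqr_ge0 eps) (Lm kn); rewrite mulrA => /le_trans; apply.
  by rewrite le_eqVlt; apply/orP; left; apply/eqP; field; rewrite gt_eqF.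
have key : tau * (eps ^+ 4 * G k.+1 - lam * x k.+1 - (eps ^+ 4 / 8 * G k.+1 + 2 * L ^+ 2 * x k.+1) -
    eps ^+ 4 / 16 * G k.+1) <= tau * (eps * G k.+1 + eps^-1 * A1 k).
  rewrite ler_wpM2l ?(ltW tau0)//; apply: le_trans hA.
  by move: hL hT; lra.
have PhiS : Phi k.+1 <= Phi k + c1 * tau * x k.+1 + src k.
  have E1 : Phi k.+1 - Phi k = x k.+1 - x k + tau * eps ^+ 4 * G k.+1 / 16 -
      tau * eps ^+ 4 * G k / 16 + 2^-1 * y k + tau * eps ^+ 4 * G k.+1.
    by rewrite /Phi big_ord_recr/=; ring.
  have xk1 := x_ge0 k.+1; have yk := y_ge0 k.
  have teG := teG0 k.+1.
  have txk : c1 * tau * x k.+1 = 2 * (tau * lam * x k.+1) + 8 * (tau * L ^+ 2 * x k.+1) + 8 * (tau * x k.+1).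
    by rewrite /c1; ring.
  have t1 : 0 <= tau * lam * x k.+1 by rewrite mulr_ge0// mulr_ge0// ltW.
  have t2 : 0 <= tau * L ^+ 2 * x k.+1 by rewrite mulr_ge0// mulr_ge0 ?sqr_ge0// ltW.
  have hC' := le_trans (lerD (lexx _) key) hC.
  have {}hC : 2^-1 * (x k.+1 - x k + y k) + 13 / 16 * (tau * eps ^+ 4 * G k.+1) <=
    tau * lam * x k.+1 + 2 * (tau * L ^+ 2 * x k.+1) + tau * eps ^+ 4 * G k.+1 / 8 +
    4 * (tau * x k.+1) + y k / 8 + (tau * eps ^+ 4 * G k.+1 + tau * eps ^+ 4 * G k) / 32 + src k / 2.
    move: hC'; rewrite -subr_ge0 => h; rewrite -subr_ge0; apply: (le_trans h).
    by rewrite le_eqVlt; apply/orP; left; apply/eqP; field.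
  rewrite -lerBlDr -lerBlDr in hC *; rewrite txk.
  move: hC t1 t2 teG E1.
  move: (tau * lam * x k.+1) (tau * L ^+ 2 * x k.+1) (tau * x k.+1) (src k) (Phi k.+1) (Phi k)
    (tau * eps ^+ 4 * G k.+1) (tau * eps ^+ 4 * G k) => q1 q2 q3 q4 q5 q6 q7 q8.
  lra.
have h1 : Phi k.+1 * (1 - c1 * tau) <= Phi k + src k.
  have ct : 0 <= c1 * tau by rewrite mulr_ge0// ltW.
  have := ler_wpM2l ct (x_le_Phi k.+1); move: PhiS; lra.
have ct : 0 <= c1 * tau by rewrite mulr_ge0// ltW.
have Ph : 0 <= Phi k.+1 by exact: le_trans (x_ge0 _) (x_le_Phi _).
(* For c1 tau <= 1/2, the implicit factor 1/(1 - c1 tau) is at most 1 + 2 c1 tau. *)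
have h2 : 1 <= (1 + 2 * c1 * tau) * (1 - c1 * tau).
  by rewrite -mulrA; move: s1 ct; set c := c1 * tau; clearbody c; nra.
apply: (@le_trans _ _ (Phi k.+1 * ((1 + 2 * c1 * tau) * (1 - c1 * tau)))).
  by rewrite ler_peMr.
rewrite mulrCA ler_wpM2l// (le_trans _ (E_ge1 1))//.
Qed.

(** At stage k the induction knows the Gronwall bound on [Phi k] and the bounds on S i for i < k.
    From [Phi k] <= M follows the bound on S k, so [src k] is under control before the step to k +
    1. *)
Lemma error_recursion k : (k <= n)%N ->
  x k + tau * eps ^+ 4 * G k / 16 +
    \sum_(j < k) (2^-1 * y j + tau * eps ^+ 4 * G j.+1) <= kappa * A * tau ^+ 2.
Proof.
rewrite -/(Phi k) -/M => kn0.
have PhiM j : (j <= n)%N -> (forall i, (i < j)%N -> S i <= C_S * tau * P2) ->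
    Phi j <= (1 + 2 * c1 * tau) ^+ j * \sum_(i < j) src i -> Phi j <= M.
  move=> jn hS /le_trans; apply; rewrite /M -[leRHS]mulrA.
  have AT : 0 <= A * tau ^+ 2 by rewrite mulr_ge0 ?sqr_ge0// ltW.
  apply: (le_trans _ (ler_wpM2r AT kappaE)); rewrite -[leRHS]mulrA.
  apply: ler_pM; [|exact: sumr_ge0| |exact: sum_src].
  - by rewrite (le_trans _ (E_ge1 j)).
  - by apply: ler_weXn2l => //; rewrite lerDl !mulr_ge0// ltW.
suff [h1 h2] : Phi k <= (1 + 2 * c1 * tau) ^+ k * \sum_(i < k) src i /\
    forall i, (i < k)%N -> S i <= C_S * tau * P2 by exact: PhiM.
elim: k kn0 => [_|k ih kn].
  by split => //; rewrite /Phi !big_ord0 x0 G0 !mulr0 mul0r !addr0.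
have [h1 h2] := ih (ltnW kn); have hM := PhiM _ (ltnW kn) h2 h1.
have hS := S_le (ltnW kn) hM.
have h2' i : (i < k.+1)%N -> S i <= C_S * tau * P2.
  by rewrite ltnS leq_eqVlt => /predU1P[->//|/h2].
have hs : src k <= M.
  have : src k <= \sum_(i < k.+1) src i by rewrite big_ord_recr/= lerDr sumr_ge0.
  move=> /le_trans; apply; apply: (le_trans (sum_src kn h2')).
  have AT : 0 <= A * tau ^+ 2 by rewrite mulr_ge0 ?sqr_ge0// ltW.
  rewrite /M -[leRHS]mulrA; apply: ler_wpM2r => //.
  by apply: le_trans kappaE; rewrite ler_peMl// (le_trans _ C_src1).
split => //; apply: (le_trans (refined_step kn hM hs)).
rewrite big_ord_recr/= exprS -[leRHS]mulrA; apply: ler_wpM2l.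
  by rewrite (le_trans _ (E_ge1 1)).
rewrite mulrDr lerD// ler_peMl//.
Qed.

End error_recursion.

(** D sums the constants of the five conditions, so its inverse serves them all. In the last one,
    648 = 6^3 3 comes from the crude bounds 6 M and 3 M, and M^4 / tau, of size A^4 tau^7, is split
    as (tau A^2)^2 tau^5. *)
Lemma small_step_conditions (R : realFieldType) (c1 L C1 C3 C4 kappa : R) :
  0 <= c1 -> 0 <= L -> 0 <= C1 -> 0 <= C3 -> 0 <= C4 -> 0 <= kappa ->
  exists2 Ct : R, 0 < Ct & forall eps tau A : R, 0 < eps -> eps < 1 -> 0 < tau ->
    1 <= A -> tau * A ^+ 2 <= Ct * eps ^+ 20 ->
    let M := kappa * A * tau ^+ 2 in
    [/\ c1 * tau <= 2^-1, 4 * tau + 2 * L ^+ 2 * tau / eps ^+ 3 <= 4^-1,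
      32 * C1 * (C1 + 1) * tau <= eps ^+ 12,
      2 * (kappa * A) ^+ 2 * tau <= eps ^+ 4 &
      (C3 / eps) ^+ 8 * C4 ^+ 2 * ((6 * M) ^+ 3 * (3 * M / (eps * tau))) <=
      (eps ^+ 4 / 16) ^+ 8].
Proof.
move=> c10 L0 C10 C30 C40 k0.
pose c2 := 4 * (4 + 2 * L ^+ 2); pose c3 := 32 * C1 * (C1 + 1).
pose c4 := 2 * kappa ^+ 2; pose c5 := 16 ^+ 8 * 648 * (C3 ^+ 8 * C4 ^+ 2 * kappa ^+ 4).
have c20 : 0 <= c2 by rewrite mulr_ge0 ?addr_ge0 ?mulr_ge0 ?sqr_ge0.
have c30 : 0 <= c3 by rewrite mulr_ge0 ?addr_ge0// mulr_ge0.
have c40 : 0 <= c4 by rewrite mulr_ge0 ?sqr_ge0.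
have c50 : 0 <= c5.
  apply: mulr_ge0; first by rewrite mulr_ge0 ?exprn_ge0 ?ler0n.
  by apply: mulr_ge0; [apply: mulr_ge0; [exact: exprn_ge0|exact: sqr_ge0]|exact: exprn_ge0].
pose D := 1 + 2 * c1 + c2 + c3 + c4 + c5.
have D1 : 1 <= D by rewrite /D; clearbody c2 c3 c4 c5; lra.
have D0 : 0 < D by rewrite (lt_le_trans _ D1).
have Ct1 : D^-1 <= 1 by rewrite invf_le1.
have hc c : c <= D -> c * D^-1 <= 1 by move=> h; rewrite ler_pdivrMr// mul1r.
exists D^-1 => [|eps tau A e0 e1 t0 A1 h M]; first by rewrite invr_gt0.
have Ct0 : 0 < D^-1 by rewrite invr_gt0.
have d1 := hc (2 * c1); have d2 := hc c2; have d3 := hc c3; have d4 := hc c4; have d5 := hc c5.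
have {}d1 : 2 * c1 * D^-1 <= 1 by apply: d1; rewrite /D; clearbody c2 c3 c4 c5; lra.
have {}d2 : c2 * D^-1 <= 1 by apply: d2; rewrite /D; clearbody c2 c3 c4 c5; lra.
have {}d3 : c3 * D^-1 <= 1 by apply: d3; rewrite /D; clearbody c2 c3 c4 c5; lra.
have {}d4 : c4 * D^-1 <= 1 by apply: d4; rewrite /D; clearbody c2 c3 c4 c5; lra.
have {}d5 : c5 * D^-1 <= 1 by apply: d5; rewrite /D; clearbody c2 c3 c4 c5; lra.
have epow i j : (j <= i)%N -> eps ^+ i <= eps ^+ j by move=> ij; rewrite ler_wiXn2l// ltW.
have ep i : 0 < eps ^+ i by exact: exprn_gt0.
have tA : tau <= tau * A ^+ 2 by rewrite ler_peMr ?(ltW t0)// exprn_ege1.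
have tj j : (j <= 20)%N -> tau <= D^-1 * eps ^+ j.
  by move=> j20; rewrite (le_trans tA)// (le_trans h)// ler_pM2l// epow.
have tD : tau <= D^-1 by have := tj 0%N isT; rewrite expr0 mulr1.
split.
- have := ler_wpM2l c10 tD; move: d1; lra.
- have t3 : tau / eps ^+ 3 <= D^-1 by rewrite ler_pdivrMr// tj.
  have L2 : 0 <= 2 * L ^+ 2 by rewrite mulr_ge0 ?sqr_ge0.
  have := ler_wpM2l L2 t3; rewrite mulrA => h2.
  by move: d2; rewrite /c2 mulrDr mulrDl; move: h2 tD; lra.
- have := ler_wpM2l c30 (tj 12%N isT); rewrite -/c3 => /le_trans; apply.
  by rewrite mulrA ler_piMl// ltW.
- have := ler_wpM2l c40 h; rewrite (_ : c4 * (tau * A ^+ 2) = 2 * (kappa * A) ^+ 2 * tau); last first.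
    by rewrite /c4; ring.
  move=> /le_trans; apply; rewrite mulrA (le_trans _ (epow 20%N 4%N isT))//.
  by rewrite ler_piMl// ltW.
- have -> : (C3 / eps) ^+ 8 * C4 ^+ 2 * ((6 * M) ^+ 3 * (3 * M / (eps * tau))) =
    648 * (C3 ^+ 8 * C4 ^+ 2 * kappa ^+ 4) * ((tau * A ^+ 2) ^+ 2 * tau ^+ 5) / eps ^+ 9.
    by rewrite /M; field; rewrite !gt_eqF.
  have h1 : (tau * A ^+ 2) ^+ 2 <= (D^-1 * eps ^+ 20) ^+ 2.
    by rewrite ler_sqr ?nnegrE// mulr_ge0 ?sqr_ge0 ?(ltW t0)// ltW.
  have h2 : tau ^+ 5 <= (eps ^+ 20) ^+ 5.
    rewrite lerXn2r ?nnegrE ?(ltW t0) ?(ltW (ep _))//.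
    by rewrite (le_trans (tj 20%N isT))// ler_piMl// ltW.
  have h3 : (tau * A ^+ 2) ^+ 2 * tau ^+ 5 <= D^-1 * eps ^+ 41.
    have h4 : (tau * A ^+ 2) ^+ 2 * tau ^+ 5 <= (D^-1 * eps ^+ 20) ^+ 2 * (eps ^+ 20) ^+ 5.
      by rewrite ler_pM ?sqr_ge0// exprn_ge0// ltW.
    apply: (le_trans h4); rewrite exprMn -mulrA -exprM -exprM -exprD expr2.
    rewrite -[leLHS]mulrA ler_pM2l// -[leRHS]mul1r ler_pM ?(ltW Ct0) ?(ltW (ep _))//.
    exact: epow.
  rewrite ler_pdivrMr//.
  have k5 : 0 <= 648 * (C3 ^+ 8 * C4 ^+ 2 * kappa ^+ 4).
    apply: mulr_ge0; first exact: ler0n.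
    by apply: mulr_ge0; [apply: mulr_ge0; [exact: exprn_ge0|exact: sqr_ge0]|exact: exprn_ge0].
  apply: (le_trans (ler_wpM2l k5 h3)).
  have -> : (eps ^+ 4 / 16) ^+ 8 * eps ^+ 9 = eps ^+ 41 / 16 ^+ 8 by field.
  rewrite ler_pdivlMr ?exprn_gt0//.
  rewrite [leLHS](_ : _ = c5 * D^-1 * eps ^+ 41); last by rewrite /c5; ring.
  by rewrite ler_piMl// ltW.
Qed.

(** * The error of the SAV scheme *)

Section nonmeasurable.
Import HBNNSimple.

(* Functions that agree almost everywhere with a measurable function need not
   be measurable for the Borel sigma-algebra. *)
Lemma ge0_ae_eq_integral_nonmeasurable dd (T : measurableType dd) (R : realType)
    (mu : {measure set T -> \bar R}) (D : set T) (f g : T -> \bar R) :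
  measurable D ->
  (forall x, D x -> 0 <= f x)%E -> (forall x, D x -> 0 <= g x)%E ->
  f = g %[ae mu in D] -> (\int[mu]_(x in D) f x = \int[mu]_(x in D) g x)%E.
Proof.
move=> mD.
suff h f1 g1 : (forall x, D x -> 0 <= f1 x)%E -> (forall x, D x -> 0 <= g1 x)%E ->
    f1 = g1 %[ae mu in D] -> (\int[mu]_(x in D) f1 x <= \int[mu]_(x in D) g1 x)%E.
  move=> f0 g0 fg; apply/eqP; rewrite eq_le !h//.
  by apply: filterS fg => x fgx Dx; rewrite fgx.
move=> f0 g0 [B [mB B0 fgB]].
rewrite [leLHS]ge0_integralE//; apply: ge_ereal_sup => _ [k /= kf <-].
have := integral_nnsfun mu measurableT k; rewrite patch_setT => <-.
(* Cutting the simple function [k] off the negligible set [B] keeps its integral, and outside [B] a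
   bound by [f1] on D is a bound by [g1]. *)
have -> : (\int[mu]_x (k x)%:E = \int[mu]_x (((fun x => (k x)%:E) \_ (~` B)) x))%E.
  apply: ae_eq_integral => //.
  - by apply/measurable_EFinP; exact: measurable_funTS.
  - apply/(measurable_restrictT _ (measurableC mB)).
    by apply/measurable_EFinP; exact: measurable_funTS.
  - exists B; split => // x /= h; apply: contrapT => nB; apply: h => _.
    by rewrite patchE mem_set.
rewrite [leRHS]integral_mkcond; apply: ge0_le_integral_nonmeasurable => x _.
  by rewrite patchE; case: ifP => // _; rewrite lee_fin.
rewrite patchE; case: ifPn => [/set_mem nB|_]; last by apply: erestrict_ge0.
apply: (le_trans (kf x)); rewrite !patchE; case: ifPn => // /set_mem Dx.
have -> : f1 x = g1 x; last by [].
by apply: contrapT => ne; apply: nB; apply: fgB => /= /(_ Dx).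
Qed.

End nonmeasurable.

Section sav_error.
Variables (R : realType) (n : nat) (Omega : set 'rV[R]_n).
Notation E := ('rV[R]_n).
Notation mu := (lebesgue_rV R n).
Notation leb := (@lebesgue_measure R).
Hypothesis oO : open Omega.
Hypothesis bO : bounded_set Omega.
Let mO := measurable_Omega oO.

Notation L2 := (@L2 R n Omega).
Notation inner := (@inner R n Omega).
Notation H1 := (@H1 R n Omega).
Notation L20 := (@L20 R n Omega).
Notation gi := (@dirichlet R n Omega).
Notation N := (@inv_laplacian R n Omega).
Notation sqm := (@dual_sqr R n Omega).
Notation one := (fun=> 1 : R).

Variable K : R.
Hypothesis poincare : forall v, H1 v -> L20 v -> inner v v <= K * gi v v.
Hypothesis K0 : 0 <= K.

Variables (F : R -> R) (L c0 : R).
Notation f := (derive1 F).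
Hypothesis df : forall x, derivable f x 1.
Hypothesis ddf : forall x, derivable (derive1 f) x 1.
Hypothesis F0 : forall x, 0 <= F x.
Hypothesis L0 : 0 <= L.
Hypothesis f_le : forall x, `|f x| <= L.
Hypothesis f'_le : forall x, `|(derive1 f) x| <= L.
Hypothesis f''_le : forall x, `|derive1 (derive1 f) x| <= L.
Hypothesis c00 : 0 < c0.
Notation I v := (\int[mu]_(x in Omega) F (v x) + c0).
Notation g := (sav_g Omega F c0).

Variable CT : R.
Hypothesis taylor : forall v w, L2 v -> L2 w ->
  `|Num.sqrt (I v) - Num.sqrt (I w) - 2^-1 * inner (g w) (fun x => v x - w x)| <=
    CT * inner (fun x => v x - w x) (fun x => v x - w x).
Variable C4 : R.
Hypothesis cubic : forall v, H1 v -> L20 v ->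
  mu.-integrable Omega (EFin \o (fun x => `|v x| ^+ 3)) /\
  (\int[mu]_(x in Omega) `|v x| ^+ 3) ^+ 4 <= C4 * (inner v v ^+ 3 * gi v v ^+ 3).

Variables (eps tau T lam : R) (M : nat).
Hypotheses (eps0 : 0 < eps) (eps1 : eps < 1) (tau0 : 0 < tau).
Hypothesis tauT : M.+1%:R * tau = T.

Variables (u0 : E -> R) (u ut : R -> E -> R).
Hypothesis Lu : forall t, 0 <= t -> L2 (u t).
Hypothesis u00 : u 0 = u0 %[ae mu in Omega].
Hypothesis du : time_derivative Omega `[0, +oo[ u ut.
Hypothesis hu : forall t : R, 0 < t -> exists2 w,
  neumann_laplacian Omega w (ut t) &
  chemical_potential Omega eps (u t) (fun x => f (u t x)) w.
Hypothesis spectral : forall t v, 0 <= t <= T -> H1 v -> L20 v ->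
  - lam * sqm v <= eps * gi v v + eps^-1 * inner (fun x => derive1 f (u t x) * v x) v.
Hypothesis lam0 : 0 <= lam.

Variables (U W : nat -> E -> R) (r : nat -> R).
Hypothesis scheme : sav_scheme Omega F c0 eps tau M u0 U W r.

Let tn (k : nat) := k%:R * tau.
Let e k : E -> R := fun x => u (tn k) x - U k x.
Let delta k : E -> R := fun x => u (tn k.+1) x - u (tn k) x.
Let dU k : E -> R := fun x => U k.+1 x - U k x.
Let de k : E -> R := fun x => e k.+1 x - e k x.

Let tn_ge0 k : 0 <= tn k. Proof. by rewrite mulr_ge0// ltW. Qed.
Let tn_gt0 k : 0 < tn k.+1. Proof. by rewrite mulr_gt0. Qed.

Let ut0 t : 0 < t -> L20 (ut t).
Proof. by move=> /hu[w hw _]; exact: (neumann_laplacian_L20 oO bO hw). Qed.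

Let H1u k : H1 (u (tn k.+1)).
Proof. by have [w _ [z [Hu _ _] _]] := hu (tn_gt0 k). Qed.

Let chem_H1 v s w : chemical_potential Omega eps v s w -> H1 v.
Proof. by move=> [z [Hv _ _] _]. Qed.

Let H1U k : (k <= M)%N -> H1 (U k.+1).
Proof. by case: scheme => _ _ h /h[_ /chem_H1]. Qed.

(** For k = 0, agreement with u0 almost everywhere does not give Borel measurability. Instead U 0 is
    recovered from U 1 and the quotient (U 1 - U 0)/tau, which is in L^2 as the Laplacian of W 1. *)
Let L2U k : (k <= M.+1)%N -> L2 (U k).
Proof.
case: k => [_|k kM]; last exact: H1_L2 (H1U kM).
have [_ _ /(_ 0%N isT)[[_ Lw _] hc _]] := scheme.
have := L2B oO (H1_L2 (chem_H1 hc)) (L2Z oO tau Lw).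
rewrite (_ : (fun x => _) = U 0%N)//; apply/funext => x.
by rewrite mulrC divfK ?gt_eqF// subKr.
Qed.

Let L20dU k : (k <= M)%N -> L20 (dU k).
Proof.
case: scheme => _ _ h /h[/(neumann_laplacian_L20 oO bO) /(L20Z oO bO tau) + _ _].
rewrite (_ : (fun x => _) = dU k)//; apply/funext => x.
by rewrite mulrC divfK ?gt_eqF.
Qed.

Let L2delta k : L2 (delta k). Proof. by apply: L2B => //; exact: Lu. Qed.

Let L20delta k : L20 (delta k).
Proof.
apply/L20P; split => //.
have [_ ->] := increment_inner oO tau0 Lu du k (L2_cst oO bO 1).
rewrite (@eq_Rintegral _ _ _ _ _ (fun=> 0)); first by rewrite Rintegral_cst ?mul0r//; exact: measurable_itv.
move=> s; rewrite inE /= in_itv /= => /andP[h _].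
by have /L20P[_] := ut0 (le_lt_trans (tn_ge0 k) h).
Qed.

Let e0_ae : e 0%N = (fun=> 0) %[ae mu in Omega].
Proof.
have [U00 _ _] := scheme; apply: filterS2 U00 u00 => x Ux ux Ox.
by rewrite /e /tn mul0r Ux ?ux ?subrr.
Qed.

Let L2e k : (k <= M.+1)%N -> L2 (e k).
Proof. by move=> kM; apply: L2B => //; [exact: Lu|exact: L2U]. Qed.

Let ae0_sym : (fun=> 0) = e 0%N %[ae mu in Omega].
Proof. by apply: filterS e0_ae => x h /h. Qed.

Let H1e k : (k <= M.+1)%N -> H1 (e k).
Proof.
case: k => [_|k kM]; last by apply: H1B => //; exact: H1U.
by apply: (H1_ae oO bO (H1_cst oO bO 0) _ ae0_sym); exact: L2e.
Qed.

Let deE k : de k = (fun x => delta k x - dU k x).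
Proof. by apply/funext => x; rewrite /de /e /delta /dU; ring. Qed.

Let L20e k : (k <= M.+1)%N -> L20 (e k).
Proof.
elim: k => [_|k ih kM].
  apply: (L20_ae oO bO _ _ ae0_sym); last exact: L2e.
  by apply/L20P; split; [exact: L2_cst|rewrite inner0l].
have -> : e k.+1 = (fun x => e k x + (delta k x - dU k x)).
  by apply/funext => x; rewrite /e /delta /dU; ring.
apply: L20D => //; first exact: ih (ltnW kM).
by apply: L20B => //; exact: L20dU.
Qed.

Let sqm_e0 : sqm (e 0%N) = 0.
Proof. exact: (dual_sqr_ae0 oO bO poincare K0 (L20e (leq0n _)) e0_ae). Qed.

Let gi_e0 : gi (e 0%N) (e 0%N) = 0.
Proof.
have He := H1e (leq0n M.+1).
by rewrite (gi_ae oO bO He (H1_cst oO bO 0) He e0_ae) (gi_cst oO bO _ He).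
Qed.

Let vol := inner one one.
Let V := L ^+ 2 / c0 * vol.
Let S k := \sum_(j < k) inner (dU j) (dU j).

Let V0 : 0 <= V.
Proof. by rewrite mulr_ge0 ?inner_ge0// divr_ge0 ?sqr_ge0// ltW. Qed.

Let L2dU k : (k <= M)%N -> L2 (dU k). Proof. by move=> /L20dU[]. Qed.

(** The update of r is the linearization of the square root of the energy at U k, so each step adds
    only the Taylor defect. *)
Let r_err k : (k <= M.+1)%N -> `|r k - Num.sqrt (I (U k))| <= CT * S k.
Proof.
elim: k => [_|k ih kM].
  have [U00 -> _] := scheme; rewrite /S big_ord0 mulr0.
  suff -> : \int[mu]_(x in Omega) F (u0 x) = \int[mu]_(x in Omega) F (U 0%N x).
    by rewrite subrr normr0.
  (* The datum u0 is only known to agree almost everywhere with measurable functions. *)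
  rewrite /Rintegral; congr fine; apply: ge0_ae_eq_integral_nonmeasurable => //.
  - by move=> x _; rewrite lee_fin.
  - by move=> x _; rewrite lee_fin.
  by apply: filterS U00 => x h Ox; rewrite h.
have [_ _ /(_ k kM)[_ _ hr]] := scheme.
have ht := taylor (L2U kM) (L2U (ltnW kM)).
have -> : r k.+1 - Num.sqrt (I (U k.+1)) = (r k - Num.sqrt (I (U k))) -
    (Num.sqrt (I (U k.+1)) - Num.sqrt (I (U k)) - 2^-1 * inner (g (U k)) (fun x => U k.+1 x - U k x)).
  by rewrite -hr; ring.
apply: (le_trans (ler_normB _ _)); rewrite /S big_ord_recr/= mulrDr.
exact: (lerD (ih (ltnW kM)) ht).
Qed.

(** f(u') - r' g(U) is split at f(U') and f(U): [A1] is the part seen by the spectral estimate, [A2]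
    the explicit lag of f plus the residual of r. *)
Let A1 k := inner (fun x => f (u (tn k.+1) x) - f (U k.+1 x)) (e k.+1).
Let A2 k := inner (fun x => f (U k.+1 x) - f (U k x)) (e k.+1) +
  inner (fun x => f (U k x) - r k.+1 * g (U k) x) (e k.+1).
Let b k := inner (fun x => delta k x / tau - ut (tn k.+1) x) (N (e k.+1)).
(** Squaring the two parts of [A2] gives 2 L^2 |dU|^2 and 2 V (2 CT^2 S^2 + V |dU|^2 / 2); the sum
    of all coefficients serves both |dU|^2 and S^2. *)
Let C1 := 2 * L ^+ 2 + V ^+ 2 + 4 * V * CT ^+ 2.

Let A2_le k : (k < M.+1)%N ->
  A2 k ^+ 2 <= C1 * (inner (dU k) (dU k) + S k ^+ 2) * inner (e k.+1) (e k.+1).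
Proof.
move=> kM; have LU := L2U (ltnW kM); have LU' := L2U kM; have Le := L2e kM.
have h1 := inner_f_lipschitz oO bO df L0 f_le f'_le LU LU' Le.
have h2 := inner_sav_residual oO bO df F0 L0 f_le c00 (r k.+1) LU Le.
have h3 := inner_sav_g_CS oO bO df F0 L0 f_le c00 LU (L2dU kM).
have h4 := r_err (ltnW kM).
have [_ _ /(_ k kM)[_ _ hr]] := scheme.
have d0 := inner_ge0 Omega (dU k); have m0 := inner_ge0 Omega (e k.+1).
have h5 : (r k.+1 - Num.sqrt (I (U k))) ^+ 2 <= 2 * CT ^+ 2 * S k ^+ 2 + 2^-1 * V * inner (dU k) (dU k).
  have -> : r k.+1 - Num.sqrt (I (U k)) =
      (r k - Num.sqrt (I (U k))) + 2^-1 * inner (g (U k)) (dU k).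
    by rewrite -[r k.+1](subrK (r k)) hr; ring.
  have h6 : (r k - Num.sqrt (I (U k))) ^+ 2 <= CT ^+ 2 * S k ^+ 2.
    rewrite -exprMn -[leLHS]real_normK ?num_real// ler_sqr ?nnegrE//.
    by apply: le_trans h4.
  move: h3 h6; rewrite -/vol -/V.
  rewrite -[2 * CT ^+ 2 * _]mulrA -[2^-1 * V * _]mulrA.
  move: (r k - _) (inner (g (U k)) (dU k)) (CT ^+ 2 * S k ^+ 2) (V * inner _ _) => p q w z hz hw.
  rewrite (_ : _ ^+ 2 = 2 * p ^+ 2 + 2^-1 * q ^+ 2 - (p - 2^-1 * q) ^+ 2); last by field.
  by have := sqr_ge0 (p - 2^-1 * q); move: hz hw; move: ((p - 2^-1 * q) ^+ 2) (p ^+ 2) (q ^+ 2) => *; lra.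
have h6 := ler_wpM2r m0 (ler_wpM2l V0 h5).
move: h1 h2; rewrite -/vol -/V -/(dU k) => h1 h2.
have h7 : A2 k ^+ 2 <= 2 * (L ^+ 2 * inner (dU k) (dU k) * inner (e k.+1) (e k.+1)) +
    2 * (V * (2 * CT ^+ 2 * S k ^+ 2 + 2^-1 * V * inner (dU k) (dU k)) * inner (e k.+1) (e k.+1)).
  move: h1 (le_trans h2 h6); rewrite /A2.
  move: (inner _ (e k.+1)) (inner (fun x => f (U k x) - _) (e k.+1)) (L ^+ 2 * _ * _) (V * _ * _) => p q w z hz hw.
  rewrite (_ : (p + q) ^+ 2 = 2 * p ^+ 2 + 2 * q ^+ 2 - (p - q) ^+ 2); last by ring.
  by have := sqr_ge0 (p - q); move: hz hw; move: ((p - q) ^+ 2) (p ^+ 2) (q ^+ 2) => *; lra.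
apply: (le_trans h7).
have CT2 := sqr_ge0 CT; have V2 := sqr_ge0 V; have L2' := sqr_ge0 L.
have d1 : 0 <= inner (dU k) (dU k) * inner (e k.+1) (e k.+1) by rewrite mulr_ge0.
have d2 : 0 <= S k ^+ 2 * inner (e k.+1) (e k.+1) by rewrite mulr_ge0 ?sqr_ge0.
have VC : 0 <= 4 * V * CT ^+ 2 by rewrite mulr_ge0// mulr_ge0.
have t1 := mulr_ge0 VC d1.
have t2 : 0 <= (2 * L ^+ 2 + V ^+ 2) * (S k ^+ 2 * inner (e k.+1) (e k.+1)).
  by rewrite mulr_ge0// addr_ge0// mulr_ge0.
rewrite -subr_ge0; apply: (le_trans (addr_ge0 t1 t2)).
by rewrite le_eqVlt; apply/orP; left; apply/eqP; rewrite /C1; field.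
Qed.

Let gsum k : (k < M.+1)%N ->
  gi (de k) (de k) <= 2 * (gi (e k.+1) (e k.+1) + gi (e k) (e k)).
Proof.
move=> kM; have He := H1e (ltnW kM); have He' := H1e kM.
have Hs := H1D oO bO He' He; have Hd := H1B oO bO He' He.
have := gi_ge0 Omega (fun x => e k.+1 x + e k x).
rewrite (giDl oO bO He' He Hs) (giDr oO bO He' He He') (giDr oO bO He' He He).
rewrite (giBl oO bO He' He Hd) (giBr oO bO He' He He') (giBr oO bO He' He He).
rewrite (giC Omega (e k) (e k.+1)).
by move: (gi (e k.+1) (e k.+1)) (gi (e k.+1) (e k)) (gi (e k) (e k)) => *; lra.
Qed.

Let step_identity k : (k < M.+1)%N ->
  2^-1 * (sqm (e k.+1) - sqm (e k) + sqm (de k)) +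
    tau * (eps * gi (e k.+1) (e k.+1) + eps^-1 * A1 k) =
  tau * b k - tau * (eps^-1 * A2 k).
Proof.
move=> kM; have LU := L2U (ltnW kM); have LU' := L2U kM; have Le := L2e kM.
have He := H1e kM; have E0 := L20e kM.
have LN := H1_L2 (H1_N oO bO poincare K0 E0).
have Lu' := Lu (tn_ge0 k.+1).
have Lfu := L2_f oO bO df f_le Lu'; have LfU := L2_f oO bO df f_le LU.
have LfU' := L2_f oO bO df f_le LU'.
have Lg := L2Z oO (r k.+1) (L2_sav_g oO bO c0 df f_le LU).
have [_ _ /(_ k kM)[hw hc _]] := scheme.
have ha := chemical_potential_weak oO bO poincare K0 hw hc Lg He E0.
have [w hw' hc'] := hu (tn_gt0 k).
have hb := chemical_potential_weak oO bO poincare K0 hw' hc' Lfu He E0.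
have hg := giBl oO bO (H1u k) (H1U kM) He; rewrite -/(e k.+1) in hg.
have hd : inner (fun x => f (u (tn k.+1) x)) (e k.+1) -
    inner (fun x => r k.+1 * g (U k) x) (e k.+1) = A1 k + A2 k.
  rewrite /A1 /A2 (innerBl oO Lfu LfU' Le) (innerBl oO LfU' LfU Le) (innerBl oO LfU Lg Le).
  move: (inner (fun x => f (u (tn k.+1) x)) _) (inner (fun x => f (U k.+1 x)) _).
  move: (inner (fun x => f (U k x)) _) (inner (fun x => r k.+1 * _) _) => q1 q2 q3 q4.
  by ring.
have hp := dual_sqr_polar oO bO poincare K0 E0 (L20e (ltnW kM)); rewrite -/(de k) in hp.
rewrite -hp deE (innerBl oO (L2delta k) (L2dU kM) LN).
have hU : inner (dU k) (N (e k.+1)) = tau * inner (fun x => (U k.+1 x - U k x) / tau) (N (e k.+1)).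
  have -> : (fun x => (U k.+1 x - U k x) / tau) = (fun x => tau^-1 * dU k x).
    by apply/funext => x; rewrite mulrC.
  by rewrite (innerZl oO _ (L2dU kM) LN) mulVKf// gt_eqF.
have hD : tau * b k = inner (delta k) (N (e k.+1)) - tau * inner (ut (tn k.+1)) (N (e k.+1)).
  have [Lut _] := ut0 (tn_gt0 k); rewrite /b.
  have -> : (fun x => delta k x / tau - ut (tn k.+1) x) = (fun x => tau^-1 * delta k x - ut (tn k.+1) x).
    by apply/funext => x; rewrite mulrC.
  rewrite (innerBl oO (L2Z oO _ (L2delta k)) Lut LN) (innerZl oO _ (L2delta k) LN).
  by rewrite mulrBr mulVKf// gt_eqF.
rewrite hD hU ha hb hg.
rewrite -[A2 k](addKr (A1 k)) -hd.
move: (A1 k) (gi (u _) _) (gi (U _) _) (inner _ (e k.+1)) (inner _ (e k.+1)) (inner (delta k) _) => q1 q2 q3 q4 q5 q6.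
by ring.
Qed.

Let A1_crude k : (k < M.+1)%N -> - A1 k <= L * inner (e k.+1) (e k.+1).
Proof.
move=> kM; have := inner_f_sub_le oO bO df L0 f_le f'_le (Lu (tn_ge0 k.+1)) (L2U kM).
rewrite -/(e k.+1) -/(A1 k) => /(le_trans _); apply.
by rewrite -normrN ler_norm.
Qed.

(** With B = (f'(u) e, e), (1 - eps^3)(eps G + B/eps) = eps G + B/eps - eps^4 G - eps^2 B: the
    spectral estimate bounds the left side, and - B <= L |e|^2. Replacing B by [A1] costs the cubic
    remainder. *)
Let A1_fine k : (k < M.+1)%N ->
  eps ^+ 4 * gi (e k.+1) (e k.+1) - lam * sqm (e k.+1) -
    eps ^+ 2 * L * inner (e k.+1) (e k.+1) -
    eps^-1 * L * \int[mu]_(x in Omega) `|e k.+1 x| ^+ 3 <=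
  eps * gi (e k.+1) (e k.+1) + eps^-1 * A1 k.
Proof.
move=> kM; have Lu' := Lu (tn_ge0 k.+1); have Le := L2e kM.
have [i3 _] := cubic (H1e kM) (L20e kM).
have h1 := inner_f_sub_cubic oO bO df ddf L0 f_le f'_le f''_le Lu' (L2U kM) i3.
have tT : 0 <= tn k.+1 <= T.
  by rewrite tn_ge0/= -tauT /tn ler_pM2r// ler_nat.
have h2 := spectral tT (H1e kM) (L20e kM).
rewrite -/(e k.+1) -/(A1 k) in h1.
have Lfe := L2_f'M oO ddf L0 f'_le Lu' Le.
have h3 : inner (fun x => derive1 f (u (tn k.+1) x) * e k.+1 x) (e k.+1) ^+ 2 <=
    (L * inner (e k.+1) (e k.+1)) ^+ 2.
  apply: (le_trans (inner_CS oO Lfe Le)).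
  rewrite exprMn expr2 [inner (e k.+1) (e k.+1) ^+ 2]expr2 -[L * L]expr2 mulrA.
  rewrite ler_wpM2r ?inner_ge0//; apply: (inner_dom oO Lfe Le L0) => x _.
  by rewrite normrM ler_wpM2r.
have m0 : 0 <= L * inner (e k.+1) (e k.+1) by rewrite mulr_ge0 ?inner_ge0.
move: h1 h2 h3 m0.
have -> : eps ^+ 2 * L * inner (e k.+1) (e k.+1) = eps ^+ 2 * (L * inner (e k.+1) (e k.+1)).
  by rewrite mulrA.
have -> : eps^-1 * L * \int[mu]_(x in Omega) `|e k.+1 x| ^+ 3 =
  eps^-1 * (L * \int[mu]_(x in Omega) `|e k.+1 x| ^+ 3) by rewrite mulrA.
have s0 := dual_sqr_ge0 Omega (e k.+1); move: s0.
move: (inner (fun x => _) (e k.+1)) (L * inner _ _) (L * \int[mu]_(x in Omega) _) (A1 k)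
  (gi (e k.+1) (e k.+1)) (sqm (e k.+1)) => B m Tc a G x x0 h1 h2 h3 m0.
have Bm : - B <= m.
  by rewrite (le_trans (ler_norm _))// normrN -ler_sqr ?nnegrE// real_normK ?num_real.
have e3 : eps ^+ 3 <= 1 by rewrite exprn_ile1// ltW.
have e30 : 0 <= 1 - eps ^+ 3 by rewrite subr_ge0.
have ei : 0 <= eps^-1 by rewrite invr_ge0 ltW.
have g1 := ler_wpM2l e30 h2.
have g2 := ler_wpM2l (sqr_ge0 eps) Bm.
have g3 := ler_wpM2l ei h1.
have g4 : 0 <= eps ^+ 3 * (lam * x) by apply: mulr_ge0; [apply: exprn_ge0; exact: ltW|exact: mulr_ge0].
have E1 : (1 - eps ^+ 3) * (eps * G + eps^-1 * B) =
  eps * G + eps^-1 * B - eps ^+ 4 * G - eps ^+ 2 * B by field; rewrite gt_eqF.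
rewrite E1 in g1; move: g1 g2 g3 g4.
rewrite !mulrBr !mulrBl.
move: (eps^-1 * B) (eps^-1 * a) (eps^-1 * Tc) => *; lra.
Qed.

Variables (B2 B3 : R) (q : R -> E -> R).
Hypothesis ut_le :
  (\int[leb]_(t in `[0%R, +oo[) (L2norm Omega (ut t) ^+ 2)%:E <= B2%:E)%E.
Hypothesis q0 : forall t, 0 < t -> L20 (q t).
Hypothesis dq : time_derivative Omega `]0, +oo[ (fun t => inv_lap Omega (ut t)) q.
Hypothesis q_le :
  (\int[leb]_(t in `]0%R, +oo[) (normm1 Omega (q t) ^+ 2)%:E <= B3%:E)%E.
Variables (C2 C5 P2 P3 A kappa : R).
Hypotheses (B2E : B2 = C2 * P2) (B3E : B3 = C5 * P3).
Hypotheses (C20 : 0 <= C2) (C50 : 0 <= C5) (C40 : 0 <= C4).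
Hypotheses (P2_ge1 : 1 <= P2) (P2A : P2 ^+ 2 <= eps ^+ 4 * A)
  (P3A : P3 <= eps ^+ 4 * A).
Let c1 := 2 * lam + 8 * L ^+ 2 + 8.
Hypothesis kappaE : (1 + 2 * c1 * tau) ^+ M.+1 *
  (8 * C5 + C1 * C2 + T * C1 * (2 * C2 + 4) ^+ 2 / 2 + 1) <= kappa.
Let Mk := kappa * A * tau ^+ 2.
Hypothesis s1 : c1 * tau <= 2^-1.
Hypothesis s2 : 4 * tau + 2 * L ^+ 2 * tau / eps ^+ 3 <= 4^-1.
Hypothesis s3 : 32 * C1 * (C1 + 1) * tau <= eps ^+ 12.
Hypothesis s4 : 2 * (kappa * A) ^+ 2 * tau <= eps ^+ 4.
Hypothesis s5 : (L / eps) ^+ 8 * C4 ^+ 2 * ((6 * Mk) ^+ 3 * (3 * Mk / (eps * tau))) <=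
  (eps ^+ 4 / 16) ^+ 8.

Lemma sav_error_bound :
  [/\ forall k, (k <= M.+1)%N -> H1 (e k),
      gi (e 0%N) (e 0%N) = 0 &
      forall k, (k <= M.+1)%N ->
      sqm (e k) + tau * eps ^+ 4 * gi (e k) (e k) / 16 +
        \sum_(j < k) (2^-1 * sqm (de j) + tau * eps ^+ 4 * gi (e j.+1) (e j.+1))
      <= kappa * A * tau ^+ 2].
Proof.
split => //.
have he k : (k < M.+1)%N -> H1 (e k.+1) /\ L20 (e k.+1).
  by move=> kM; split; [exact: H1e|exact: L20e].
have [Q [Q0 sQ hQ]] :=
  consistency_le oO bO poincare K0 tau0 Lu ut0 du q0 dq he q_le.
have sp := increments_sqr_le oO tau0 Lu ut0 du M.+1 ut_le.
have C10 : 0 <= C1.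
  apply: addr_ge0; [apply: addr_ge0; last exact: sqr_ge0|].
    by rewrite mulr_ge0 ?sqr_ge0.
  by apply: mulr_ge0; [exact: mulr_ge0|exact: sqr_ge0].
apply: (@error_recursion R M.+1 eps tau T eps0 eps1 tau0 _
  (fun k => sqm (e k)) (fun k => sqm (de k)) (fun k => gi (e k) (e k))
  (fun k => inner (delta k) (delta k)) Q (fun k => inner (e k) (e k))
  (fun k => inner (de k) (de k)) (fun k => inner (dU k) (dU k)) A1 b A2
  (fun k => \int[mu]_(x in Omega) `|e k.+1 x| ^+ 3)
  C1 C2 L C4 C5 L lam P2 P3 A) => //.
- by rewrite tauT.
- by move=> k; exact: dual_sqr_ge0.
- by move=> k; exact: dual_sqr_ge0.
- by move=> k; exact: gi_ge0.
- by move=> k; exact: inner_ge0.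
- by move=> k; exact: inner_ge0.
- by move=> k; exact: inner_ge0.
- by move=> k; apply: Rintegral_ge0 => x _; rewrite exprn_ge0.
(* The bound [d_le]: dU is delta - de, and the square of delta + de is nonnegative. *)
- move=> k kM; have Ld := L2delta k; have LdU := L2dU kM.
  have Lde : L2 (de k) by rewrite deE; exact: L2B.
  have Lp := L2D oO Ld Lde.
  have := inner_ge0 Omega (fun x => delta k x + de k x).
  have -> : dU k = (fun x => delta k x - de k x).
    by apply/funext => x; rewrite deE subKr.
  have Lm := L2B oO Ld Lde.
  rewrite (innerDl oO Ld Lde Lp) (innerDr oO Ld Lde Ld) (innerDr oO Ld Lde Lde).
  rewrite (innerBl oO Ld Lde Lm) (innerBr oO Ld Lde Ld) (innerBr oO Ld Lde Lde).
  rewrite (innerC Omega (de k) (delta k)).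
  by move: (inner (delta k) (delta k)) (inner (delta k) (de k)) (inner (de k) (de k)) => *; lra.
- move=> k kM; have He := H1e (ltnW kM); have He' := H1e kM.
  have Hd := H1B oO bO He' He; have d0 := L20B oO bO (L20e kM) (L20e (ltnW kM)).
  apply: (le_trans (dual_CS oO bO poincare K0 d0 Hd)).
  by rewrite ler_wpM2l ?dual_sqr_ge0// gsum.
- move=> k kM; exact: (dual_CS oO bO poincare K0 (L20e kM) (H1e kM)).
- by move=> k kM; have [] := cubic (H1e kM) (L20e kM).
- by rewrite -B2E.
- by rewrite -B3E.
Qed.

End sav_error.

(** Each maximum costs X; the one on gradients is a single term of the sum, which avoids the weight
    1/16. As G 0 = 0, the sum of D is at most 4 times that of G, so the remaining sums cost 5/2
    X. *)
Lemma error_norms_le (R : realFieldType) (n m : nat) (eps tau X : R) (x y G D : nat -> R) :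
  0 <= tau -> (forall k, 0 <= x k) -> (forall k, 0 <= y k) -> (forall k, 0 <= G k) ->
  G 0%N = 0 -> (forall k, (k < n)%N -> D k.+1 <= 2 * (G k.+1 + G k)) ->
  (forall k, (k <= n)%N -> x k + tau * eps ^+ 4 * G k / 16 +
    \sum_(j < k) (2^-1 * y j.+1 + tau * eps ^+ 4 * G j.+1) <= X) ->
  (m <= n)%N ->
  \big[Num.max/0]_(1 <= k < m.+1) x k + 2^-1 * \sum_(1 <= k < m.+1) y k +
  2^-1 * eps ^+ 4 * \sum_(1 <= k < m.+1) tau * G k +
  \big[Num.max/0]_(1 <= k < m.+1) (tau * eps ^+ 4 * G k) +
  2^-1 * eps ^+ 4 * \sum_(1 <= k < m.+1) tau * D k <= 5 * X.
Proof.
move=> t0 x0 y0 G0 G00 hD hX mn.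
have w0 : 0 <= tau * eps ^+ 4 by rewrite mulr_ge0// -[4%N]/(2 * 2)%N exprM sqr_ge0.
have s0 k : 0 <= \sum_(j < k) (2^-1 * y j.+1 + tau * eps ^+ 4 * G j.+1).
  by apply: sumr_ge0 => j _; rewrite addr_ge0// mulr_ge0// invr_ge0.
have X0 : 0 <= X.
  by apply: le_trans (hX 0%N isT); rewrite !addr_ge0// divr_ge0// mulr_ge0.
have xX k : (k <= n)%N -> x k <= X.
  by move=> /hX; apply: le_trans; rewrite -addrA lerDl addr_ge0// divr_ge0// mulr_ge0.
have sX k : (k <= n)%N -> \sum_(j < k) (2^-1 * y j.+1 + tau * eps ^+ 4 * G j.+1) <= X.
  by move=> /hX; apply: le_trans; rewrite lerDr addr_ge0// divr_ge0// mulr_ge0.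
have GX k : (0 < k <= n)%N -> tau * eps ^+ 4 * G k <= X.
  case: k => // k kn; apply: le_trans (sX k.+1 kn); rewrite big_ord_recr/=.
  rewrite addrA lerDr; apply: addr_ge0; [exact: s0|by rewrite mulr_ge0// invr_ge0].
have h1 : \big[Num.max/0]_(1 <= k < m.+1) x k <= X.
  rewrite big_nat; apply: bigmax_le => // k /andP[_ km].
  by apply: xX; apply: leq_trans mn.
have h2 : \big[Num.max/0]_(1 <= k < m.+1) (tau * eps ^+ 4 * G k) <= X.
  rewrite big_nat; apply: bigmax_le => // k /andP[k0 km].
  by apply: GX; rewrite k0; apply: leq_trans mn.
have := sX m mn; rewrite big_split/= -!mulr_sumr => h3.
rewrite !big_add1/= !big_mkord in h1 h2 *.
have hG : \sum_(j < m) G j <= \sum_(j < m) G j.+1.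
  rewrite -subr_ge0 -sumrB; have -> : \sum_(j < m) (G j.+1 - G j) = G m - G 0%N.
    by rewrite -(big_mkord xpredT (fun j => G j.+1 - G j)) telescope_sumr.
  by rewrite G00 subr0.
have h4 : \sum_(j < m) D j.+1 <= 4 * \sum_(j < m) G j.+1.
  apply: (@le_trans _ _ (\sum_(j < m) (2 * (G j.+1 + G j)))).
    by apply: ler_sum => j _; apply: hD; apply: leq_trans mn.
  by rewrite -mulr_sumr big_split/=; move: hG; lra.
have := ler_wpM2l w0 h4.
have Y0 : 0 <= \sum_(j < m) y j.+1 by exact: sumr_ge0.
have Gs0 : 0 <= tau * eps ^+ 4 * \sum_(j < m) G j.+1 by rewrite mulr_ge0// sumr_ge0.
rewrite [tau * eps ^+ 4 * (4 * _)]mulrCA.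
have -> : 2^-1 * eps ^+ 4 * (tau * \sum_(j < m) G j.+1) = 2^-1 * (tau * eps ^+ 4 * \sum_(j < m) G j.+1) by ring.
have -> : 2^-1 * eps ^+ 4 * (tau * \sum_(j < m) D j.+1) = 2^-1 * (tau * eps ^+ 4 * \sum_(j < m) D j.+1) by ring.
move: (tau * eps ^+ 4 * \sum_(j < m) D j.+1) (tau * eps ^+ 4 * \sum_(j < m) G j.+1) Gs0 h3 => a b b0 h3 h5.
by move: h1 h2 h3 h5 Y0 b0; lra.
Qed.

(** Equality for d = 2, which is where the exponent 20 comes from. *)
Lemma exponent_le (R : realFieldType) (d : nat) (al : R) : d = 2%N \/ d = 3%N ->
  0 <= al -> 2 * al + 20 <= (4 * al + 32 + 4 * d%:R) / (4 - d%:R).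
Proof. by move=> [->|->] al0; rewrite ler_pdivlMr; lra. Qed.

Section gradients.
Variables (R : realType) (n : nat) (Omega : set 'rV[R]_n).
Hypothesis oO : open Omega.

Lemma dirichletE (v : 'rV[R]_n -> R) :
  vL2norm Omega (grad Omega v) ^+ 2 = dirichlet Omega v v.
Proof. by rewrite vL2normE giE. Qed.

(** The error norm subtracts the chosen gradients themselves, so the parallelogram inequality is
    applied to these vector fields and not to the gradient of v - w. *)
Lemma grad_diff_le (v w : 'rV[R]_n -> R) : H1 Omega v -> H1 Omega w ->
  vL2norm Omega (fun i x => grad Omega v i x - grad Omega w i x) ^+ 2 <=
  2 * (dirichlet Omega v v + dirichlet Omega w w).
Proof.
move=> Hv Hw; rewrite vL2normE !giE.
have Lv := L2_grad Hv; have Lw := L2_grad Hw; move: Lv Lw.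
move: (grad Omega v) (grad Omega w) => Gv Gw Lv Lw.
have Lm : L2v Omega (fun i x => Gv i x - Gw i x) by move=> i; exact: L2B.
have Lp : L2v Omega (fun i x => Gv i x + Gw i x) by move=> i; exact: L2D.
have := vinner_ge0 Omega (fun i x => Gv i x + Gw i x).
rewrite (vinnerDl oO Lv Lw Lp) (vinnerBl oO Lv Lw Lm).
rewrite (vinnerC Omega Gv (fun i x => Gv i x + Gw i x)).
rewrite (vinnerC Omega Gw (fun i x => Gv i x + Gw i x)).
rewrite (vinnerC Omega Gv (fun i x => Gv i x - Gw i x)).
rewrite (vinnerC Omega Gw (fun i x => Gv i x - Gw i x)).
rewrite (vinnerDl oO Lv Lw Lv) (vinnerDl oO Lv Lw Lw).
rewrite (vinnerBl oO Lv Lw Lv) (vinnerBl oO Lv Lw Lw) (vinnerC Omega Gw Gv).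
by move: (vinner Omega Gv Gv) (vinner Omega Gv Gw) (vinner Omega Gw Gw) => *; lra.
Qed.

End gradients.

Theorem theorem4p1 (R : realType) (d : nat) (hd : d = 2%N \/ d = 3%N)
  (Omega : set 'rV[R]_d) (hOmega : regular_domain Omega)
  (T : R) (hT : 0 < T) (c0 : R) (hc0 : 0 < c0)
  (F : R -> R) (hA : assumptionA F)
  (eps0 : R) (heps0 : 0 < eps0 < 1)
  (u0 : R -> 'rV[R]_d -> R) (u ut : R -> R -> 'rV[R]_d -> R)
  (hCH : forall eps : R, 0 < eps < eps0 ->
     cahn_hilliard Omega F eps (u0 eps) (u eps) (ut eps))
  (m0 rho1 rho2 rho3 : R) (hrho1 : 0 < rho1) (hrho2 : 0 < rho2)
  (hrho3 : 0 < rho3)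
  (hB : assumptionB Omega F eps0 u ut m0 rho1 rho2 rho3)
  (lambda0 : R) (hlambda0 : 0 < lambda0)
  (hspec : spectral_estimate Omega F T eps0 lambda0 u) :
  let alpha0 := Num.max (Num.max (rho1 + 3) (2 * rho2 + 4))
                        (Num.max (rho2 + 6) (rho3 + 4)) in
  let beta0 := (4 * alpha0 + 32 + 4 * d%:R) / (4 - d%:R) in
  exists Ctilde kappa0 : R, [/\ 0 < Ctilde, 0 < kappa0 &
    forall (eps : R) (N : nat), 0 < eps < eps0 -> (0 < N)%N ->
    let tau := T / N.+1%:R in
    tau <= Ctilde * eps `^ beta0 ->
    forall (U W : nat -> 'rV[R]_d -> R) (r : nat -> R),
    sav_scheme Omega F c0 eps tau N (u0 eps) U W r ->
    let e n : 'rV[R]_d -> R := fun x => u eps (n%:R * tau) x - U n x in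
    let grade n := grad Omega (e n) in
    let dgrade n : 'I_d -> 'rV[R]_d -> R :=
      fun i x => grade n i x - grade n.-1 i x in
    forall m : nat, (1 <= m <= N.+1)%N ->
      \big[Num.max/0]_(1 <= n < m.+1) normm1 Omega (e n) ^+ 2 +
      2^-1 * \sum_(1 <= n < m.+1)
        normm1 Omega (fun x => e n x - e n.-1 x) ^+ 2 +
      2^-1 * eps ^+ 4 * \sum_(1 <= n < m.+1)
        tau * vL2norm Omega (grade n) ^+ 2 +
      \big[Num.max/0]_(1 <= n < m.+1)
        (tau * eps ^+ 4 * vL2norm Omega (grade n) ^+ 2) +
      2^-1 * eps ^+ 4 * \sum_(1 <= n < m.+1)
        tau * vL2norm Omega (dgrade n) ^+ 2
      <= kappa0 * eps `^ (- alpha0) * tau ^+ 2].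
Proof.
move=> alpha0 beta0.
have [[oO _ _ bO] [KC hKC] hGN] := hOmega.
(* Squaring suits the squared norms and gives a nonnegative constant whatever the sign of [KC]. *)
have K0 : 0 <= KC ^+ 2 by exact: sqr_ge0.
have poincare v : H1 Omega v -> L20 Omega v -> inner Omega v v <= KC ^+ 2 * dirichlet Omega v v.
  move=> Hv v0; rewrite -L2normE -dirichletE -exprMn.
  have h := hKC v Hv v0; have n0 : 0 <= L2norm Omega v by exact: sqrtr_ge0.
  by rewrite ler_sqr// nnegrE (le_trans n0).
have [[hk _] [F1 Fm1] Fpos _ [L L0 hL]] := hA.
have dF x : derivable F x 1 by exact: (hk 0%N).
have df x : derivable (derive1 F) x 1 by exact: (hk 1%N).
have ddf x : derivable (derive1 (derive1 F)) x 1 by exact: (hk 2%N).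
have f_le x : `|derive1 F x| <= L by have [] := hL x.
have f'_le x : `|derive1 (derive1 F) x| <= L by have [] := hL x.
have f''_le x : `|derive1 (derive1 (derive1 F)) x| <= L by have [] := hL x.
have F0 x : 0 <= F x.
  have [->|x1] := eqVneq x 1; first by rewrite F1.
  have [->|xm1] := eqVneq x (-1); first by rewrite Fm1.
  by rewrite ltW// Fpos.
have [CT _ taylor] := sqrt_energy_taylor oO bO dF df F0 L0 f_le f'_le hc0.
have [C4 C40 cubic] := cubic_bound oO poincare K0 hd hGN.
have [_ _ _ [C2 C20 hC2] [C5 C50 hC5]] := hB.
pose V := L ^+ 2 / c0 * inner Omega (fun=> 1) (fun=> 1).
pose C1 := 2 * L ^+ 2 + V ^+ 2 + 4 * V * CT ^+ 2.
pose c1 := 2 * lambda0 + 8 * L ^+ 2 + 8.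
pose Cs := 8 * C5 + C1 * C2 + T * C1 * (2 * C2 + 4) ^+ 2 / 2 + 1.
(* The exponential dominates (1 + 2 c1 tau)^(N+1) for every step size, because (N+1) tau = T. *)
pose kappa := expR (2 * c1 * T) * Cs.
have V0 : 0 <= V by rewrite mulr_ge0 ?inner_ge0// divr_ge0 ?sqr_ge0// ltW.
have C10 : 0 <= C1.
  apply: addr_ge0; [apply: addr_ge0; last exact: sqr_ge0|].
    by rewrite mulr_ge0 ?sqr_ge0.
  by apply: mulr_ge0; [exact: mulr_ge0|exact: sqr_ge0].
have c10 : 0 <= c1.
  by rewrite /c1 addr_ge0// addr_ge0 ?mulr_ge0 ?sqr_ge0// ltW.
have Cs0 : 0 < Cs.
  apply: ltr_wpDl => //; apply: addr_ge0.
    by apply: addr_ge0; apply: mulr_ge0 => //; exact: ltW.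
  apply: divr_ge0 => //; apply: mulr_ge0; last exact: sqr_ge0.
  by apply: mulr_ge0 => //; exact: ltW.
have kappa0 : 0 < kappa by rewrite mulr_gt0// expR_gt0.
have [Ct Ct0 hCt] := small_step_conditions c10 L0 C10 L0 C40 (ltW kappa0).
exists Ct, (5 * kappa); split => //; first by rewrite mulr_gt0.
move=> eps N heps N0 tau htau U W r hs e grade dgrade m /andP[_ mN].
have [e0 ee0] := andP heps; have [_ e01] := andP heps0.
have e1 : eps < 1 by exact: lt_trans e01.
have tau0 : 0 < tau by rewrite divr_gt0.
have tauT : N.+1%:R * tau = T by rewrite mulrC divfK.
pose A := eps `^ (- alpha0).
have a1 : 2 * rho2 + 4 <= alpha0 by rewrite /alpha0 !le_max lexx orbT.
have a2 : rho3 + 4 <= alpha0 by rewrite /alpha0 !le_max lexx !orbT.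
have emono (a b : R) : a <= b -> eps `^ b <= eps `^ a.
  by move=> ab; apply: ger_powR => //; rewrite e0 ltW.
have e4 : eps ^+ 4 = eps `^ 4 by rewrite -powR_mulrn// ltW.
have en0 : eps != 0 by rewrite gt_eqF.
have pD (a b : R) : eps `^ a * eps `^ b = eps `^ (a + b) by rewrite powRD// en0 implybT.
have P2A : (eps `^ (- rho2)) ^+ 2 <= eps ^+ 4 * A.
  by rewrite e4 /A expr2 !pD; apply: emono; move: a1; lra.
have P3A : eps `^ (- rho3) <= eps ^+ 4 * A.
  by rewrite e4 /A pD; apply: emono; move: a2; lra.
have ge1 (a : R) : a <= 0 -> 1 <= eps `^ a by move=> a0; rewrite -(powRr0 eps) emono.
have A1 : 1 <= A by apply: ge1; move: a1 hrho2; lra.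
(* A^2 is eps^(-2 alpha0), and beta0 - 2 alpha0 >= 20 with eps < 1. *)
have htauA : tau * A ^+ 2 <= Ct * eps ^+ 20.
  have ab : 2 * alpha0 + 20 <= beta0.
    have al0 : 0 <= alpha0 by move: a1 hrho2; lra.
    exact: exponent_le.
  have e20 : eps ^+ 20 = eps `^ 20 by rewrite -powR_mulrn// ltW.
  have := ler_wpM2r (sqr_ge0 A) htau; move=> /le_trans; apply.
  rewrite -mulrA ler_pM2l// e20 /A expr2 !pD; apply: emono; move: ab; lra.
have [s1 s2 s3 s4 s5] := hCt eps tau A e0 e1 tau0 A1 htauA.
have [Lu u00 du hu] := hCH eps heps.
have [q [dq q0 hq]] := hC5 eps heps.
have spectral t v : 0 <= t <= T -> H1 Omega v -> L20 Omega v ->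
    - lambda0 * dual_sqr Omega v <= eps * dirichlet Omega v v +
      eps^-1 * inner Omega (fun x => derive1 (derive1 F) (u eps t x) * v x) v.
  by move=> tT Hv v0; rewrite -dual_sqrE -dirichletE; exact: hspec.
have kE : (1 + 2 * c1 * tau) ^+ N.+1 * Cs <= kappa.
  rewrite /kappa ler_pM2r// -tauT.
  rewrite (_ : 2 * c1 * (N.+1%:R * tau) = N.+1%:R * (2 * c1 * tau)); last by ring.
  rewrite expRM_natl lerXn2r ?nnegrE ?expR_ge0//.
    by rewrite addr_ge0// mulr_ge0 ?(ltW tau0)// mulr_ge0.
  exact: expR_ge1Dx.
have hE := @sav_error_bound R d Omega oO bO (KC ^+ 2) poincare K0 F L c0
  df ddf F0 L0 f_le f'_le f''_le hc0 CT taylor C4 cubic eps tau T lambda0 N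
  e0 e1 tau0 tauT (u0 eps) (u eps) (ut eps) Lu u00 du hu.
have {}hE := hE spectral (ltW hlambda0).
have {}hE := hE U W r hs.
have {}hE := hE _ _ q (hC2 eps heps) q0 dq hq.
have {}hE := hE C2 C5 (eps `^ (- rho2)) (eps `^ (- rho3)) A kappa erefl erefl (ltW C20) (ltW C50) C40.
have P21 : 1 <= eps `^ (- rho2) by apply: ge1; rewrite oppr_le0 ltW.
have {}hE := hE P21 P2A P3A.
have {}hE := hE kE s1 s2 s3 s4 s5.
have [He G0 hX] := hE.
rewrite (_ : 5 * kappa * _ * _ = 5 * (kappa * A * tau ^+ 2)); last by rewrite !mulrA.
apply: (@error_norms_le _ N.+1 m eps tau (kappa * A * tau ^+ 2)
  (fun n => normm1 Omega (e n) ^+ 2) (fun n => normm1 Omega (fun x => e n x - e n.-1 x) ^+ 2)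
  (fun n => vL2norm Omega (grade n) ^+ 2) (fun n => vL2norm Omega (dgrade n) ^+ 2)
  (ltW tau0)) => //.
- by move=> k; exact: sqr_ge0.
- by move=> k; exact: sqr_ge0.
- by move=> k; exact: sqr_ge0.
- by rewrite dirichletE.
- move=> k kN; have h := grad_diff_le oO (He _ kN) (He _ (ltnW kN)).
  rewrite -(dirichletE Omega (e k.+1)) -(dirichletE Omega (e k)) in h; exact: h.
- move=> k kN; have := hX k kN.
  rewrite -(dual_sqrE Omega (e k)) -(dirichletE Omega (e k)).
  have -> : \sum_(j < k) (2^-1 * dual_sqr Omega (fun x => e j.+1 x - e j x) +
      tau * eps ^+ 4 * dirichlet Omega (e j.+1) (e j.+1)) =
    \sum_(j < k) (2^-1 * normm1 Omega (fun x => e j.+1 x - e j x) ^+ 2 +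
      tau * eps ^+ 4 * vL2norm Omega (grade j.+1) ^+ 2).
    by apply: eq_bigr => j _; rewrite -(dirichletE Omega (e j.+1)) -dual_sqrE.
  by [].
Qed.
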